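(* Let $n\ge2$ and $M\ge2$ be integers, $s\in[-1,1)$, and $h\in\mathcal{AM}([-1,1])$. Let $m=2k-1+\varepsilon$ ($\varepsilon\in\{0,1\}$) be such that $s\in I_m$, and suppose $M=L_m(n,r)$ with $r\in I_m$. Let $(\alpha_i,\rho_i)_{i=0}^{k-1+\varepsilon}$ be the Levenshtein nodes and weights associated with $s$ (and $m$), let $(\alpha_i',\rho_i')_{i=0}^{k-1+\varepsilon}$ be those associated with $r$ (and $m$), and let $f_m^{(h)}$ be the polynomial associated with $n,s,m,h$, all as in the context. Then every code $C\in C(n,M,s)$ satisfies $$M^2\sum_{i=0}^{k-1+\varepsilon}\rho_i'h(\alpha_i')\ \le\ E_h(C)\ \le\ M\left(\frac{M}{L_m(n,s)}-1\right)f_m^{(h)}(1)+M^2\sum_{i=0}^{k-1+\varepsilon}\rho_ih(\alpha_i).$$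
   Context: Codes and energy. $\mathbb{S}^{n-1}$ is the unit sphere in $\mathbb{R}^n$; a spherical code is a finite subset $C\subset\mathbb{S}^{n-1}$. $E_h(C)=\sum_{x,y\in C,\,x\neq y}h(\langle x,y\rangle)$ (ordered pairs). $s(C)=\max\{\langle x,y\rangle:x,y\in C,x\ne y\}$; $C(n,M,s)=\{C\subset\mathbb{S}^{n-1}:|C|=M,\ s(C)=s\}$. Absolutely monotone potentials. $\mathcal{AM}([-1,1])$ is the set of $h:[-1,1]\to(0,+\infty]$ with $h^{(k)}(t)\ge0$ for every $t\in[-1,1)$ and every integer $k\ge0$ (so $h$ is finite and smooth on $[-1,1)$), where $h(1)=\lim_{t\to1^-}h(t)$. Gegenbauer polynomials. $P_0^{(n)}=1$, $P_1^{(n)}=t$, $(i+n-2)P_{i+1}^{(n)}(t)=(2i+n-2)tP_i^{(n)}(t)-iP_{i-1}^{(n)}(t)$ for $i\ge1$, so $P_i^{(n)}(1)=1$; they are orthogonal on $[-1,1]$ for the weight $(1-t^2)^{(n-3)/2}$. The Gegenbauer coefficients of $f\in C([-1,1])$ are $f_i=\int_{-1}^1 fP_i^{(n)}(1-t^2)^{(n-3)/2}dt\big/\int_{-1}^1 (P_i^{(n)})^2(1-t^2)^{(n-3)/2}dt$, so that $f=\sum_i f_iP_i^{(n)}$. Levenshtein parameters. $P_i^{(\alpha,\beta)}$ denotes the Jacobi polynomial. For $a,b\in\{0,1\}$ and $i\ge1$, $t_i^{a,b}$ is the greatest zero of $P_i^{(a+\frac{n-3}2,\,b+\frac{n-3}2)}$,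 and $t_0^{1,1}=-1$. Set $I_{2k-1}=[t_{k-1}^{1,1},t_k^{1,0}]$ and $I_{2k}=[t_k^{1,0},t_k^{1,1}]$ for $k\ge1$; these intervals cover $[-1,1)$ and have non-overlapping interiors. Define for $s\in I_{2k-1}$, resp. $s\in I_{2k}$, $$L_{2k-1}(n,s)=\binom{k+n-3}{k-1}\left[\frac{2k+n-3}{n-1}-\frac{P_{k-1}^{(n)}(s)-P_k^{(n)}(s)}{(1-s)P_k^{(n)}(s)}\right],$$ $$L_{2k}(n,s)=\binom{k+n-2}{k}\left[\frac{2k+n-1}{n-1}-\frac{(1+s)(P_k^{(n)}(s)-P_{k+1}^{(n)}(s))}{(1-s)(P_k^{(n)}(s)+P_{k+1}^{(n)}(s))}\right].$$ $L_m(n,\cdot)$ is strictly increasing on $I_m$. Given $s\in I_m$, write $m=2k-1+\varepsilon$ with $\varepsilon\in\{0,1\}$, $k\ge1$. Put $Q_i^\varepsilon=P_i^{(\frac{n-1}2,\,\varepsilon+\frac{n-3}2)}$. The nodes $\alpha_0<\dots<\alpha_{k-1+\varepsilon}=s$ associated with $s$ are the (simple) roots of $$(t+1)^\varepsilon\bigl(Q_k^\varepsilon(t)Q_{k-1}^\varepsilon(s)-Q_k^\varepsilon(s)Q_{k-1}^\varepsilon(t)\bigr)=0$$ (so $\alpha_0=-1$ if $m=2k$). The weights $\rho_0,\dots,\rho_{k-1+\varepsilon}$ associated with $s$ are those for which Levenshtein's quadrature $$f_0=\frac{f(1)}{L_m(n,s)}+\sum_{i=0}^{k-1+\varepsilon}\rho_if(\alpha_i)$$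 holds for every real polynomial $f$ of degree at most $m$. The nodes $\alpha_i'$ and weights $\rho_i'$ associated with $r$ are obtained by replacing $s$ by $r$ throughout (so $\alpha_{k-1+\varepsilon}'=r$ and $L_m(n,r)=M$). The multiset $T$, of cardinality $m$, is $\{\alpha_0,\alpha_0,\dots,\alpha_{k-2},\alpha_{k-2},\alpha_{k-1}\}$ if $m=2k-1$, and $\{\alpha_0=-1,\alpha_1,\alpha_1,\dots,\alpha_{k-1},\alpha_{k-1},\alpha_k\}$ if $m=2k$. The Levenshtein polynomial is $f_m^{(n,s)}(t)=\prod_{\alpha_i\in T}(t-\alpha_i)=\sum_{i=0}^m\ell_iP_i^{(n)}(t)$; it is known that $\ell_i>0$ for $i=0,\dots,m$. The polynomial $f_m^{(h)}$. $g_T=\sum_{i=0}^{\deg(g_T)}g_iP_i^{(n)}$ is the Hermite interpolation polynomial of degree at most $m-1$ that agrees with $h$ at the points of $T$ counted with multiplicity (both $h$ and $h'$ are interpolated at doubled points). Then $f_m^{(h)}=-\lambda f_m^{(n,s)}+g_T$ with $\lambda=\max\{g_i/\ell_i:1\le i\le\deg(g_T)\}$. *)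

(* Defs.v *)
From mathcomp Require Export all_boot all_order all_algebra.
From mathcomp Require Export finmap.
From mathcomp Require Export all_classical all_reals all_analysis.
Set Implicit Arguments.
Unset Strict Implicit.
Unset Printing Implicit Defensive.
Export Order.TTheory GRing.Theory Num.Theory.
Export numFieldNormedType.Exports.
Local Open Scope classical_set_scope.
Local Open Scope ring_scope.

(* The library's norm on ['rV[R]_n] is the sup norm, hence an explicit
   Euclidean inner product. *)
Definition dot (R : realType) (n : nat) (x y : 'rV[R]_n) : R :=
  \sum_(i < n) x 0 i * y 0 i.

Definition spherical_code (R : realType) (n : nat) (C : {fset 'rV[R]_n}) : Prop :=
  forall x, x \in C -> dot x x = 1.

(* -1 is a lower bound for the inner products of unit vectors, so the default
   value of the maximum only matters for codes with at most one point. *)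
Definition max_inner (R : realType) (n : nat) (C : {fset 'rV[R]_n}) : R :=
  \big[Num.max/-1]_(x <- C) \big[Num.max/-1]_(y <- C | x != y) dot x y.

Definition code_class (R : realType) (n M : nat) (s : R) : set {fset 'rV[R]_n} :=
  [set C | [/\ spherical_code C, (#|` C | = M)%fset & max_inner C = s]].

Definition energy (R : realType) (n : nat) (h : R -> \bar R)
    (C : {fset 'rV[R]_n}) : \bar R :=
  (\sum_(x <- C) \sum_(y <- C | x != y) h (dot x y))%E.

(* Derivative relative to a domain [D]: a two-sided derivative at interior
   points of [D] and a one-sided one at its endpoints; only the values of [f]
   on [D] matter when [x] is in [D]. *)
Definition diff_quotient (R : realType) (f : R -> R) (x y : R) : R :=
  (f y - f x) / (y - x).

Definition derivable_within (R : realType) (D : set R) (f : R -> R) (x : R) : Prop :=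
  cvg (diff_quotient f x y @[y --> within D x^']).

Definition derive_within (R : realType) (D : set R) (f : R -> R) (x : R) : R :=
  lim (diff_quotient f x y @[y --> within D x^']).

Definition deriven_within (R : realType) (D : set R) (k : nat) (f : R -> R) : R -> R :=
  iter k (derive_within D) f.

(* Potentials are total functions whose values outside [-1, 1] are irrelevant;
   h(1) may be +oo. *)
Record absolutely_monotone (R : realType) (h : R -> \bar R) : Prop :=
  AbsolutelyMonotone {
    am_gt0 : forall t : R, -1 <= t <= 1 -> (0 < h t)%E ;
    am_fin : forall t : R, -1 <= t < 1 -> h t \is a fin_num ;
    am_smooth : forall k (t : R), -1 <= t < 1 ->
      derivable_within `[-1, 1[ (deriven_within `[-1, 1[ k (fine \o h)) t ;
    am_ge0 : forall k (t : R), -1 <= t < 1 ->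
      0 <= deriven_within `[-1, 1[ k (fine \o h) t ;
    am_lim : h t @[t --> 1^'-] --> h 1
  }.

Fixpoint gegenbauer (R : realType) (n i : nat) : {poly R} :=
  match i with
  | 0 => 1
  | i1.+1 =>
    match i1 with
    | 0 => 'X
    | i2.+1 =>
      ((i1 + n - 2)%N%:R)^-1 *:
        ((2 * i1 + n - 2)%N%:R *: ('X * gegenbauer R n i1)
         - i1%:R *: gegenbauer R n i2)
    end
  end.

(* The value given by [powR] at t = -1, 1 is irrelevant to the integrals. *)
Definition gegenbauer_weight (R : realType) (n : nat) (t : R) : R :=
  (1 - t ^+ 2) `^ ((n%:R - 3) / 2).

Definition gegenbauer_coef (R : realType) (n i : nat) (f : R -> R) : R :=
  (\int[lebesgue_measure]_(t in `[-1, 1])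
      (f t * (gegenbauer R n i).[t] * gegenbauer_weight n t)) /
  (\int[lebesgue_measure]_(t in `[-1, 1])
      ((gegenbauer R n i).[t] ^+ 2 * gegenbauer_weight n t)).

Definition gbinom (R : realType) (x : R) (j : nat) : R :=
  (\prod_(l < j) (x - l%:R)) / j`!%:R.

(* Szego, Orthogonal Polynomials, (4.3.2), normalized by
   P_i^(a,b)(1) = binom(i + a, i). *)
Definition jacobi (R : realType) (a b : R) (i : nat) : {poly R} :=
  \sum_(j < i.+1) (gbinom (i%:R + a) (i - j) * gbinom (i%:R + b) j) *:
    ((2^-1 *: ('X - 1)) ^+ j * (2^-1 *: ('X + 1)) ^+ (i - j)).

(* The set of zeros is finite, and nonempty for i >= 1, so that the supremum is
   a maximum. *)
Definition greatest_zero (R : realType) (p : {poly R}) : R :=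
  sup [set x | root p x].

(* t_i^{a,b}; the value for i = 0 is only used for a = b = 1. *)
Definition lev_t (R : realType) (n : nat) (a b : bool) (i : nat) : R :=
  if i == 0%N then -1
  else greatest_zero (jacobi (a%:R + (n%:R - 3) / 2) (b%:R + (n%:R - 3) / 2) i).

(* In what follows a degree m >= 1 is represented by the pair [k], [eps] with
   m = 2k - 1 + eps and k >= 1. *)
Definition lev_deg (k : nat) (eps : bool) : nat := (2 * k - 1 + eps)%N.

Definition lev_interval (R : realType) (n k : nat) (eps : bool) : set R :=
  if eps then `[lev_t R n true false k, lev_t R n true true k]%classic
  else `[lev_t R n true true k.-1, lev_t R n true false k]%classic.

Definition lev_L (R : realType) (n k : nat) (eps : bool) (s : R) : R :=
  let P i := (gegenbauer R n i).[s] in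
  if eps then
    'C(k + n - 2, k)%:R *
      ((2 * k + n - 1)%N%:R / (n - 1)%N%:R
       - ((1 + s) * (P k - P k.+1)) / ((1 - s) * (P k + P k.+1)))
  else
    'C(k + n - 3, k - 1)%:R *
      ((2 * k + n - 3)%N%:R / (n - 1)%N%:R
       - (P k.-1 - P k) / ((1 - s) * P k)).

Definition lev_Q (R : realType) (n : nat) (eps : bool) (i : nat) : {poly R} :=
  jacobi ((n%:R - 1) / 2) (eps%:R + (n%:R - 3) / 2) i.

Definition lev_node_poly (R : realType) (n k : nat) (eps : bool) (s : R) : {poly R} :=
  ('X + 1) ^+ eps *
  ((lev_Q R n eps k.-1).[s] *: lev_Q R n eps k
   - (lev_Q R n eps k).[s] *: lev_Q R n eps k.-1).

Definition is_lev_nodes (R : realType) (n k : nat) (eps : bool) (s : R)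
    (alpha : (k + eps).-tuple R) : Prop :=
  [/\ sorted <%R alpha,
      forall x, (x \in alpha) = root (lev_node_poly n k eps s) x
    & alpha`_(k - 1 + eps) = s].

Definition is_lev_weights (R : realType) (n k : nat) (eps : bool) (s : R)
    (alpha rho : (k + eps).-tuple R) : Prop :=
  forall f : {poly R}, (size f <= (lev_deg k eps).+1)%N ->
    gegenbauer_coef n 0 (horner f) =
      f.[1] / lev_L n k eps s + \sum_(i < k + eps) rho`_i * f.[alpha`_i].

(* The multiset T: the last node, and alpha_0 = -1 when m is even, are simple;
   all the others are doubled. *)
Definition lev_T (R : realType) (k : nat) (eps : bool)
    (alpha : (k + eps).-tuple R) : seq R :=
  (if eps then [:: alpha`_0] else [::])
  ++ flatten [seq [:: alpha`_i; alpha`_i] | i <- iota eps (k - 1)]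
  ++ [:: alpha`_(k - 1 + eps)].

Definition lev_poly (R : realType) (T : seq R) : {poly R} :=
  \prod_(x <- T) ('X - x%:P).

Definition is_hermite_interpolant (R : realType) (D : set R) (T : seq R)
    (f : R -> R) (g : {poly R}) : Prop :=
  (size g <= size T)%N /\
  forall x j, (j < count_mem x T)%N -> g^`(j).[x] = deriven_within D j f x.

(* max {g_i / l_i : 1 <= i <= deg g}.  Starting the maximum at the term i = 1
   gives the maximum proper if deg g >= 1, and 0 if g is constant (where the
   maximum is over the empty set), since then g_1 = 0. *)
Definition lev_lambda (R : realType) (n : nat) (T : seq R) (g : {poly R}) : R :=
  let ratio i := gegenbauer_coef n i (horner g) /
                 gegenbauer_coef n i (horner (lev_poly T)) in
  \big[Num.max/ratio 1%N]_(1 <= i < size g) ratio i.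

Definition lev_fh (R : realType) (n : nat) (T : seq R) (g : {poly R}) : {poly R} :=
  - lev_lambda n T g *: lev_poly T + g.

(* Main.v *)
(* Both bounds come from Delsarte's linear programming method.  Gegenbauer
   polynomials are positive definite on the sphere, being Gram matrices of zonal
   harmonics for Fischer's inner product; so for a polynomial f whose Gegenbauer
   coefficients f_i, i >= 1, are nonnegative (nonpositive), the sum of
   f(<x, y>) over all pairs of points of a code with M points is at least (at
   most) M^2 f_0, and f_0 is given by Levenshtein's quadrature when deg f <= m.

   The lower bound takes for f the Hermite interpolant of h at all nodes for r,
   each doubled except -1: it lies below h, because the error term is a
   nonnegative multiple of the node product, and it is positive definite,
   because Newton's form is a nonnegative combination of products of initial
   segments of the nodes.  Those products are positive definite by an argument
   of Cohn and Woo: such a product is a nonnegative combination of kernel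
   polynomials of the discrete measure carried by the nodes, and these are
   nonnegative combinations of Jacobi polynomials, hence of Gegenbauer
   polynomials, as products of Gegenbauer polynomials are positive definite.

   The upper bound takes f = f_m^(h): on [-1, s] the interpolation error and
   the Levenshtein polynomial are nonpositive, so that f lies above h there,
   while subtracting lambda f_m^(n,s) makes the coefficients f_i, i >= 1,
   nonpositive; lambda >= 0 since the leading coefficient of g_T is a divided
   difference of h.  *)
Require Import Defs.
From mathcomp Require Import -(notations) mpoly.
From mathcomp Require polyrcf.
From HB Require Import structures.
From mathcomp Require Import ring lra zify measurable_realfun.
Set Implicit Arguments.
Unset Strict Implicit.
Unset Printing Implicit Defensive.
Local Open Scope classical_set_scope.
Local Open Scope ring_scope.

(** * Means for the Gegenbauer weight *)

(** The hypotheses do not say where the nodes lie, which sign the weights have, or which sign Q_k(s)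
    and Q_{k-1}(s) have; yet [h] is controlled on [-1, 1) only and positive definiteness of the node
    products depends on these signs. All of this is extracted from the quadrature, by testing it on
    polynomials of degree at most m that vanish at most of the nodes. The membership of s in I_m is
    decisive twice: the lower end of the interval keeps the nodes from falling below -1, and the
    upper end forces Q_k(s) <= 0, which brings the product over all nodes into the positive definite
    cone. Since lambda is a maximum of quotients by the l_i, nonnegative coefficients do not suffice
    for the Levenshtein polynomial: strict positivity in every degree up to m is tracked separately.
    Orthogonality of both the Gegenbauer and the Jacobi polynomials comes from one integration by
    parts against the weight. *)

Lemma gegenbauer_weightE (R : realType) (n : nat) (t : R) : -1 < t < 1 ->
  (2 <= n)%N ->
  gegenbauer_weight n t = Num.sqrt (1 - t ^+ 2) ^+ n.-1 / (1 - t ^+ 2).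
Proof.
move=> t1 n2; have t2 : 0 < 1 - t ^+ 2 by nra.
rewrite /gegenbauer_weight.
have -> : (n%:R - 3) / 2 = n.-1%:R / 2 - 1 :> R.
  by rewrite -subn1 natrB ?(leq_trans _ n2)//; field.
rewrite powRB; last by rewrite (gt_eqF t2) implybT.
by rewrite powRr1 ?ltW// [_ / 2]mulrC powRrM powR12_sqrt ?ltW//
  powR_mulrn// sqrtr_ge0.
Qed.

Lemma measurable_gegenbauer_weight (R : realType) (n : nat) (A : set R) :
  measurable_fun A (gegenbauer_weight n : R -> R).
Proof.
apply: measurable_funTS; apply: (measurableT_comp (measurable_powR _)).
by apply: measurable_funB => //; exact: measurable_funX.
Qed.

Lemma gegenbauer_weight_ge0 (R : realType) (n : nat) (t : R) :
  0 <= gegenbauer_weight n t.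
Proof. exact: powR_ge0. Qed.

Lemma gegenbauer_weight_gt0 (R : realType) (n : nat) (t : R) : -1 < t < 1 ->
  0 < gegenbauer_weight n t.
Proof. by move=> t1; apply: powR_gt0; nra. Qed.

Lemma continuous_gegenbauer_weight (R : realType) (n : nat) (t : R) :
  -1 < t < 1 -> {for t, continuous (gegenbauer_weight n : R -> R)}.
Proof.
move=> t1; rewrite /gegenbauer_weight.
apply: (@continuous_comp _ _ _ (fun t : R => 1 - t ^+ 2)
   (fun x => x `^ ((n%:R - 3) / 2))).
  by apply: cvgB; [exact: cvg_cst|apply: cvgM; exact: cvg_id].
apply: differentiable_continuous; apply/derivable1_diffP.
by apply: derivable_powR; rewrite in_itv/= andbT; nra.
Qed.

Lemma arcsine_integral (R : realType) (a : R) : 0 < a < 1 ->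
  (\int[lebesgue_measure]_(t in `[(- a)%R, a]) (gegenbauer_weight 2 t)%:E =
   (asin a - asin (- a))%:E)%E.
Proof.
move=> a1; rewrite (@continuous_FTC2 _ _ asin); first by rewrite EFinB.
- lra.
- apply: continuous_in_subspaceT => x; rewrite inE/= in_itv/= => xa.
  by apply: continuous_gegenbauer_weight; lra.
- split.
  + move=> x; rewrite in_itv/= => xa.
    by have /@ex_derive := @is_derive1_asin R x ltac:(lra).
  + by apply: cvg_at_right_filter; apply: continuous_asin; lra.
  + by apply: cvg_at_left_filter; apply: continuous_asin; lra.
- move=> x; rewrite in_itv/= => xa.
  have x2 : 0 < 1 - x ^+ 2 by nra.
  rewrite derive1E gegenbauer_weightE//; last lra.
  rewrite (@derive_val _ _ _ _ _ _ _ (@is_derive1_asin R x ltac:(lra))).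
  by rewrite expr1 -{3}[1 - x ^+ 2]sqr_sqrtr ?ltW// expr2 invfM mulrA mulfV ?mul1r
     ?sqrtr_eq0 -?ltNge.
Qed.

Lemma oo_bigcup (R : realType) :
  `](-1), 1[%classic =
  \bigcup_i `[- (1 - (i.+2%:R)^-1), 1 - (i.+2%:R)^-1]%classic :> set R.
Proof.
apply/seteqP; split => x /=.
  rewrite in_itv/= => x1.
  have e0 : 0 < 1 - `|x| by rewrite subr_gt0 ltr_norml; lra.
  exists (Num.truncn (1 - `|x|)^-1) => //=.
  have lt1 : (1 - `|x|)^-1 < (Num.truncn (1 - `|x|)^-1).+2%:R.
    by rewrite (lt_trans (truncnS_gt _))// ltr_nat.
  rewrite in_itv/= -ler_norml lerBrDl -lerBrDr.
  by rewrite invf_ple ?posrE ?ltr0n// ltW.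
move=> [i _]; rewrite /= !in_itv/=.
have : 0 < (i.+2%:R : R)^-1 by rewrite invr_gt0 ltr0n.
move: (i.+2%:R^-1) => e. lra.
Qed.

(** Since [Num.sqrt (1 - t ^+ 2) <= 1], the weight for n = 2 dominates all the others inside the
    interval; its integrals over segments exhausting ]-1, 1[ are differences of arcsines, hence at
    most pi, and monotone convergence concludes. *)
Lemma integrable_gegenbauer_weight (R : realType) (n : nat) : (2 <= n)%N ->
  lebesgue_measure.-integrable `[(-1 : R), 1]
    (EFin \o gegenbauer_weight n).
Proof.
move=> n2.
have mw A : measurable_fun A (EFin \o (gegenbauer_weight n : R -> R)).
  by apply/measurable_EFinP; exact: measurable_gegenbauer_weight.
apply/integrableP; split; first exact: mw.
rewrite integral_itv_bndoo; last by apply: measurableT_comp => //; exact: mw.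
apply: (@le_lt_trans _ _ (\int[lebesgue_measure]_(t in `](-1 : R)%R, 1%R[)
    (gegenbauer_weight 2 t)%:E)%E).
  apply: ge0_le_integral => //.
  - by apply: measurableT_comp => //; exact: mw.
  - by apply/measurable_EFinP; exact: measurable_gegenbauer_weight.
  - move=> t; rewrite /= in_itv/= => t1.
    rewrite lee_fin ger0_norm ?gegenbauer_weight_ge0// !gegenbauer_weightE//.
    have t2 : 0 < 1 - t ^+ 2 by nra.
    rewrite ler_pM2r ?invr_gt0// expr1.
    have q1 : Num.sqrt (1 - t ^+ 2) <= 1 by rewrite -[leRHS]sqrtr1 ler_wsqrtr//; nra.
    case: n n2 {mw} => [//|[//|n]] _ /=.
    by rewrite exprS ler_piMr ?sqrtr_ge0// exprn_ile1 ?sqrtr_ge0.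
rewrite oo_bigcup.
have e0 (i : nat) : 0 < (i.+2%:R : R)^-1 < 1.
  by rewrite invr_gt0 ltr0n/= invf_lt1 ?ltr0n// ltr1n.
pose I (i : nat) : set R := `[- (1 - (i.+2%:R)^-1), 1 - (i.+2%:R)^-1]%classic.
have nd : nondecreasing_seq I.
  move=> i j ij; rewrite subsetEset => x; rewrite /I /= !in_itv/=.
  have : (j.+2%:R : R)^-1 <= (i.+2%:R)^-1 by rewrite lef_pV2 ?posrE ?ltr0n// ler_nat.
  move: (j.+2%:R^-1 : R) (i.+2%:R^-1 : R) => u v; lra.
have cv : (\int[lebesgue_measure]_(t in I i) (gegenbauer_weight 2 t)%:E)%E
    @[i --> \oo] -->
    (\int[lebesgue_measure]_(t in \bigcup_i I i) (gegenbauer_weight 2 t)%:E)%E.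
  apply: ge0_nondecreasing_set_cvg_integral => //.
  - by move=> i; exact: measurable_itv.
  - by move=> i; apply/measurable_EFinP; exact: measurable_gegenbauer_weight.
  - by move=> i x _; rewrite lee_fin gegenbauer_weight_ge0.
rewrite -(cvg_lim _ cv)//.
apply: (@le_lt_trans _ _ pi%:E); last exact: ltry.
apply: lime_le; first exact: (cvgP _ cv).
apply: nearW => i; rewrite /I arcsine_integral; last by have := e0 i; move: (i.+2%:R^-1) => e; lra.
rewrite lee_fin; have := e0 i; set e := _^-1 => ei.
have := @asin_lepi2 R (1 - e) ltac:(lra).
have := @asin_geNpi2 R (- (1 - e)) ltac:(lra).
lra.
Qed.

Lemma integrable_horner_weight (R : realType) (n : nat) (p : {poly R}) :
  (2 <= n)%N ->
  lebesgue_measure.-integrable `[(-1 : R), 1]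
    (EFin \o (fun t => p.[t] * gegenbauer_weight n t)).
Proof.
move=> n2; have [M Mp] : exists M, forall t : R, -1 <= t <= 1 -> `|p.[t]| <= M.
  have /compact_bounded[M [Mr Mb]] :
      compact [set p.[t] | t in `[(-1 : R), 1]].
    apply: continuous_compact; last exact: segment_compact.
    by apply: continuous_subspaceT => x; exact: continuous_horner.
  exists (M + 1) => t t1; apply: Mb; first by rewrite ltrDl.
  by exists t => //; rewrite /= in_itv.
have wi : lebesgue_measure.-integrable `[(-1 : R), 1]
    (fun t => (M%:E * (gegenbauer_weight n t)%:E)%E).
  by apply: integrableZl => //; exact: integrable_gegenbauer_weight.
apply: (le_integrable _ _ _ wi) => //.
- apply/measurable_EFinP; apply: measurable_funM; first exact: measurable_poly.
  exact: measurable_gegenbauer_weight.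
- move=> t; rewrite /= in_itv/= => t1.
  rewrite lee_fin !normrM ler_wpM2r// (le_trans (Mp _ t1))// ler_norm//.
Qed.

(* The primitive of a polynomial times the weight; it is differentiable inside
   the interval even when the weight blows up at the endpoints. *)
Lemma weighted_primitive (R : realType) (n : nat) (p : {poly R}) : (2 <= n)%N ->
  let F (x : R) := \int[lebesgue_measure]_(t in `[-1, x])
    (p.[t] * gegenbauer_weight n t) in
  [/\ F (-1) = 0, {within `[-1, 1], continuous F}
    & forall x : R, -1 < x < 1 ->
      derivable F x 1 /\ F^`()%classic x = p.[x] * gegenbauer_weight n x].
Proof.
move=> n2 F; split.
- by rewrite /F set_itv1 Rintegral_set1.
- by apply: parameterized_integral_continuous; [lra|exact: integrable_horner_weight].
- move=> x x1; apply: (@continuous_FTC1_closed _ _ _ _ 1); [lra| |lra|].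
    exact: integrable_horner_weight.
  by apply: cvgM; [exact: continuous_horner|exact: continuous_gegenbauer_weight].
Qed.

(** Integration by parts: p (1 - t^2)^((n-1)/2) is a primitive of the integrand inside the interval,
    and it vanishes at both ends because n >= 2. *)
Lemma weighted_integral_pearson (R : realType) (n : nat) (p : {poly R}) :
  (2 <= n)%N ->
  \int[lebesgue_measure]_(t in `[-1, 1])
    ((p^`() * (1 - 'X^2) - (n.-1)%:R *: ('X * p)).[t] * gegenbauer_weight n t)
  = 0.
Proof.
move=> n2; set q := (_ - _ *: _ : {poly R}).
have := weighted_primitive q n2.
set F := fun x : R => _; rewrite -/(F 1) => -[F0 cF dF].
pose G (x : R) := p.[x] * Num.sqrt (1 - x ^+ 2) ^+ n.-1.
have cs : continuous (fun x : R => Num.sqrt (1 - x ^+ 2)).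
  move=> x; apply: (@continuous_comp _ _ _ (fun t : R => 1 - t ^+ 2) Num.sqrt).
    by apply: cvgB; [exact: cvg_cst|apply: cvgM; exact: cvg_id].
  exact: sqrt_continuous.
have cG : continuous G.
  move=> x; apply: cvgM; first exact: continuous_horner.
  apply: (@continuous_comp _ _ _ (fun x : R => Num.sqrt (1 - x ^+ 2))
    (fun y => y ^+ n.-1)); [exact: cs|exact: exprn_continuous].
have dG (x : R) : -1 < x < 1 -> is_derive x 1 G (q.[x] * gegenbauer_weight n x).
  move=> x1; have x2 : 0 < 1 - x ^+ 2 by nra.
  have s0 : 0 < Num.sqrt (1 - x ^+ 2) by rewrite sqrtr_gt0.
  have dsq : is_derive x (1 : R) (fun y : R => Num.sqrt (1 - y ^+ 2))
      ((2 * Num.sqrt (1 - x ^+ 2))^-1 * (- 2 * x)).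
    have -> : (fun y : R => Num.sqrt (1 - y ^+ 2)) =
        Num.sqrt \o horner (1 - 'X^2).
      by apply/funext => y /=; rewrite !hornerE.
    apply: is_derive_eq.
      apply: is_derive1_comp; apply: is_derive1_sqrt; rewrite !hornerE/=; nra.
    by rewrite derivB derivC derivXn !hornerE/=; ring.
  have := is_deriveM (is_derive_poly p x) (is_deriveX n.-1 dsq).
  rewrite exprfctE => /is_derive_eq; apply.
  rewrite gegenbauer_weightE// /q !hornerE/=.
  move: s0 (sqr_sqrtr (ltW x2)); set s := Num.sqrt _ => s0 sE.
  case: n n2 {F0 cF dF F G cG q} => [//|[//|n]] _ /=.
  rewrite /GRing.scale/= exprS -sE.
  field; lra.
(* The integrand may blow up at the endpoints, so the two primitives are compared through their
   difference, which is continuous up to the ends and has derivative 0 inside. *)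
have [||c _] := @MVT R (fun x => F x - G x) (fun=> 0) (-1) 1 ltac:(lra).
- move=> x; rewrite in_itv/= => x1.
  have [dFx Fx] := dF x x1.
  rewrite -[0](subrr (q.[x] * gegenbauer_weight n x)).
  apply: is_deriveB; last exact: dG.
  by apply: DeriveDef; [exact: dFx|rewrite -derive1E].
- by move=> x; apply: cvgB; [exact: cF|exact: continuous_subspaceT].
- rewrite mul0r F0 /G expr1n sqrrN expr1n subrr sqrtr0 expr0n.
  have -> : (n.-1 == 0)%N = false by lia.
  by rewrite !mulr0 !subr0.
Qed.

(** The primitive is nondecreasing; if the integral were zero it would be constant, and p would
    vanish throughout ]-1, 1[. *)
Lemma weighted_integral_gt0 (R : realType) (n : nat) (p : {poly R}) :
  (2 <= n)%N -> p != 0 -> (forall t : R, -1 <= t <= 1 -> 0 <= p.[t]) ->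
  0 < \int[lebesgue_measure]_(t in `[-1, 1]) (p.[t] * gegenbauer_weight n t).
Proof.
move=> n2 p0 pge0; rewrite lt_neqAle; apply/andP; split; last first.
  apply: Rintegral_ge0 => t; rewrite /= in_itv/= => t1.
  by rewrite mulr_ge0 ?pge0 ?gegenbauer_weight_ge0.
apply/negP => /eqP F1; move/negP: p0; apply; apply/eqP.
have := weighted_primitive p n2.
set F := fun x : R => _; rewrite -/(F 1) in F1 * => -[F0 cF dF].
have dF0 (x : R) : -1 < x < 1 -> p.[x] = 0.
  have Fm (u v : R) : -1 <= u -> u <= v -> v <= 1 -> F u <= F v.
    move=> u1 uv v1; apply: (@ger0_derive1_le_cc _ F (-1) 1) => //.
    - by move=> y; rewrite in_itv/= => y1; have [] := dF y y1.
    - move=> y; rewrite in_itv/= => y1; have [_ ->] := dF y y1.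
      by rewrite mulr_ge0 ?pge0 ?gegenbauer_weight_ge0//; lra.
    - by rewrite in_itv/=; lra.
    - by rewrite in_itv/=; lra.
  move=> x1; have FE (u : R) : -1 <= u <= 1 -> F u = 0.
    move=> u1; apply/eqP; rewrite eq_le; apply/andP; split.
      by rewrite F1 Fm//; lra.
    by rewrite -F0 Fm//; lra.
  have : is_derive x 1 F 0.
    apply: (@derive1_at_max R F (-1) 1); first by lra.
    - by move=> y; rewrite in_itv/= => y1; have [] := dF y y1.
    - by rewrite in_itv.
    - by move=> t; rewrite in_itv/= => t1; rewrite !FE//; lra.
  move=> /@derive_val; rewrite -derive1E; have [_ ->] := dF x x1.
  move=> /eqP; rewrite mulf_eq0 => /orP[/eqP//|].
  by rewrite gt_eqF ?gegenbauer_weight_gt0.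
apply: (@roots_geq_poly_eq0 _ _ [seq (i.+2%:R)^-1 | i <- iota 0 (size p)]).
- apply/allP => _ /mapP[i _ ->]; rewrite /root dF0//.
  have : 0 < (i.+2%:R : R)^-1 by rewrite invr_gt0 ltr0n.
  have : (i.+2%:R : R)^-1 < 1 by rewrite invf_lt1 ?ltr0n// ltr1n.
  move: (i.+2%:R^-1) => e; lra.
- rewrite map_inj_uniq ?iota_uniq// => i j /invr_inj/eqP.
  by rewrite eqr_nat => /eqP[].
- by rewrite size_map size_iota.
Qed.

(** The dimension is n = d + 2, so that n >= 2 needs no side condition. Once [gegenbauer_coef_gmean]
    is proved, integrals disappear: only linearity, [gmean_gt0], [gmean1] and [gmean_pearson] are
    used. *)
HB.lock Definition gmean (R : realType) (d : nat) (p : {poly R}) : R :=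
  gegenbauer_coef d.+2 0 (horner p).

Lemma gegenbauer_coef_integral (R : realType) (n i : nat) (p : {poly R}) :
  gegenbauer_coef n i (horner p) =
  \int[lebesgue_measure]_(t in `[-1, 1])
    ((p * gegenbauer R n i).[t] * gegenbauer_weight n t) /
  \int[lebesgue_measure]_(t in `[-1, 1])
    ((gegenbauer R n i ^+ 2).[t] * gegenbauer_weight n t).
Proof.
rewrite /gegenbauer_coef; congr (_ / _); apply: eq_Rintegral => t _;
  by rewrite !hornerE.
Qed.

Lemma gmeanE (R : realType) (d : nat) (p : {poly R}) :
  gmean d p =
  (\int[lebesgue_measure]_(t in `[-1, 1]) gegenbauer_weight d.+2 t)^-1 *
  \int[lebesgue_measure]_(t in `[-1, 1]) (p.[t] * gegenbauer_weight d.+2 t).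
Proof.
rewrite gmean.unlock gegenbauer_coef_integral mulrC; congr (_^-1 * _);
  by apply: eq_Rintegral => t _; rewrite !hornerE ?expr1n ?mul1r.
Qed.

Lemma gmean_is_linear (R : realType) (d : nat) : scalar (@gmean R d).
Proof.
move=> a p q; rewrite !gmeanE mulrCA -mulrDr; congr (_ * _).
rewrite -RintegralZl//; last exact: integrable_horner_weight.
have -> : \int[lebesgue_measure]_(t in `[-1, 1])
      (a * (p.[t] * gegenbauer_weight d.+2 t)) =
    \int[lebesgue_measure]_(t in `[-1, 1])
      ((a *: p).[t] * gegenbauer_weight d.+2 t).
  by apply: eq_Rintegral => t _; rewrite hornerZ mulrA.
rewrite -RintegralD//; try exact: integrable_horner_weight.
by apply: eq_Rintegral => t _; rewrite hornerD mulrDl.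
Qed.

HB.instance Definition _ (R : realType) (d : nat) :=
  GRing.isLinear.Build R {poly R} R *%R (@gmean R d) (@gmean_is_linear R d).

Section GMeanLinear.
Variables (R : realType) (d : nat).
Implicit Types p q : {poly R}.

Lemma gmean0 : gmean d (0 : {poly R}) = 0. Proof. exact: raddf0. Qed.

Lemma gmeanD p q : gmean d (p + q) = gmean d p + gmean d q.
Proof. exact: raddfD. Qed.

Lemma gmeanB p q : gmean d (p - q) = gmean d p - gmean d q.
Proof. exact: raddfB. Qed.

Lemma gmeanZ a p : gmean d (a *: p) = a * gmean d p.
Proof. exact: linearZ. Qed.

Lemma gmean_sum (I : Type) (s : seq I) (P : pred I) (F : I -> {poly R}) :
  gmean d (\sum_(i <- s | P i) F i) = \sum_(i <- s | P i) gmean d (F i).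
Proof. exact: raddf_sum. Qed.

End GMeanLinear.

Lemma integral_weight_gt0 (R : realType) (d : nat) :
  0 < \int[lebesgue_measure]_(t in `[-1, 1]) (gegenbauer_weight d.+2 t : R).
Proof.
have := @weighted_integral_gt0 R d.+2 1 isT (oner_neq0 _).
have -> : \int[lebesgue_measure]_(t in `[-1, 1])
      ((1 : {poly R}).[t] * gegenbauer_weight d.+2 t) =
    \int[lebesgue_measure]_(t in `[-1, 1]) (gegenbauer_weight d.+2 t : R).
  by apply: eq_Rintegral => t _; rewrite hornerC mul1r.
by apply=> t _; rewrite hornerC.
Qed.

Lemma gmean_gt0 (R : realType) (d : nat) (p : {poly R}) :
  p != 0 -> (forall t : R, -1 <= t <= 1 -> 0 <= p.[t]) -> 0 < gmean d p.
Proof.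
move=> p0 pge0.
by rewrite gmeanE mulr_gt0 ?weighted_integral_gt0// invr_gt0 integral_weight_gt0.
Qed.

Lemma gmean1 (R : realType) (d : nat) : gmean d (1 : {poly R}) = 1.
Proof.
rewrite gmeanE; apply: (canLR (mulKf _)); first by rewrite gt_eqF ?integral_weight_gt0.
by rewrite mulr1; apply: eq_Rintegral => t _; rewrite hornerC mul1r.
Qed.

Lemma gmean_pearson (R : realType) (d : nat) (p : {poly R}) :
  gmean d (p^`() * (1 - 'X^2)) = d.+1%:R * gmean d ('X * p).
Proof.
have : gmean d (p^`() * (1 - 'X^2) - d.+1%:R *: ('X * p)) = 0.
  by have /= H := @weighted_integral_pearson R d.+2 p isT; rewrite gmeanE H mulr0.
by rewrite gmeanB gmeanZ => /subr0_eq.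
Qed.

(* Locked: otherwise unification keeps unfolding the recursion. *)
HB.lock Definition geg (R : realType) (d i : nat) : {poly R} :=
  gegenbauer R d.+2 i.

Lemma gegenbauer_coef_gmean (R : realType) (d i : nat) (p : {poly R}) :
  gegenbauer_coef d.+2 i (horner p) = gmean d (p * geg R d i) / gmean d (geg R d i ^+ 2).
Proof.
rewrite gegenbauer_coef_integral geg.unlock !gmeanE -mulf_div divff ?mul1r//.
by rewrite invr_neq0// gt_eqF// integral_weight_gt0.
Qed.

(** * Gegenbauer polynomials and positive definiteness *)

(* In ['X * P i = (1 - geg_low i) P i.+1 + geg_low i P i.-1]; the junk value
   0 / 0 = 0 gives the right coefficient at i = 0 even when d = 0. *)
HB.lock Definition geg_low (R : realType) (d i : nat) : R :=
  i%:R / (2 * i + d)%N%:R.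

Section GegenbauerAlgebra.
Variables (R : realType) (d : nat).
Local Notation P := (geg R d).
Local Notation a := (geg_low R d).

Lemma geg_low0 : a 0 = 0. Proof. by rewrite geg_low.unlock mul0r. Qed.

Lemma geg_low_gt0 i : (0 < i)%N -> 0 < a i.
Proof. by move=> i0; rewrite geg_low.unlock divr_gt0 ?ltr0n//; lia. Qed.

Lemma geg_low_ge0 i : 0 <= a i.
Proof. by rewrite geg_low.unlock divr_ge0. Qed.

(** Together with [geg_low_le], this makes the coefficients in [V_triangle] nonnegative. It also
    keeps [1 - geg_low R d i] away from 0, so that the recurrence determines the next polynomial. *)
Lemma geg_low_le_half i : a i <= 2^-1.
Proof.
have [->|i0] := posnP i; first by rewrite geg_low0; lra.
rewrite geg_low.unlock ler_pdivrMr ?ltr0n; last lia.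
by rewrite mulrC ler_pdivlMr// -natrM ler_nat; lia.
Qed.

Lemma geg_low_le i j : (i <= j)%N -> a i <= a j.
Proof.
have [->|i0] := posnP i; first by rewrite geg_low0 geg_low_ge0.
move=> ij; rewrite geg_low.unlock ler_pdivrMr ?ltr0n; last lia.
rewrite mulrAC ler_pdivlMr ?ltr0n; last lia.
by rewrite -!natrM ler_nat; nia.
Qed.

Lemma geg0 : P 0 = 1. Proof. by rewrite geg.unlock. Qed.

Lemma geg1 : P 1 = 'X. Proof. by rewrite geg.unlock. Qed.

Lemma geg_rec i : 'X * P i = (1 - a i) *: P i.+1 + a i *: P i.-1.
Proof.
case: i => [|i]; first by rewrite geg0 geg1 geg_low0 subr0 scale1r scale0r addr0 mulr1.
have i0 : (2 * i.+1 + d)%N%:R != 0 :> R by rewrite pnatr_eq0; lia.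
have i1 : (i.+1 + d)%N%:R != 0 :> R by rewrite pnatr_eq0; lia.
have aE : 1 - a i.+1 = (i.+1 + d)%N%:R / (2 * i.+1 + d)%N%:R.
  by rewrite geg_low.unlock; field: (natrD R (2 * i.+1) d) (natrD R i.+1 d); rewrite ?natrD ?natrM in i0 i1 *.
rewrite aE geg.unlock geg_low.unlock /=.
have -> : (i.+1 + d.+2 - 2 = i.+1 + d)%N by lia.
have -> : (2 * i.+1 + d.+2 - 2 = 2 * i.+1 + d)%N by lia.
rewrite scalerA mulrAC divff// mul1r scalerBr !scalerA mulVf// scale1r.
by rewrite [_ * i.+1%:R]mulrC subrK.
Qed.


Lemma size_geg_lead i : size (P i) = i.+1 /\ 0 < lead_coef (P i).
Proof.
have [m im] := ubnP i; elim: m i im => // m IH [|[|i]] im.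
- by rewrite geg0 size_poly1 lead_coef1.
- by rewrite geg1 size_polyX lead_coefX.
have [s1 l1] := IH i.+1 ltac:(lia); have [s0 _] := IH i ltac:(lia).
have a1 : 1 - a i.+1 != 0 by have := geg_low_le_half i.+1; lra.
have sX : size ('X * P i.+1) = i.+3.
  by rewrite mulrC size_mulX ?s1// -size_poly_eq0 s1.
have lX : lead_coef ('X * P i.+1) = lead_coef (P i.+1).
  by rewrite lead_coefM lead_coefX mul1r.
have E : (1 - a i.+1) *: P i.+2 = 'X * P i.+1 - a i.+1 *: P i.
  by rewrite geg_rec addrK.
have sa : (size (a i.+1 *: P i)%R < size ('X * P i.+1)%R)%N.
  by rewrite sX (leq_ltn_trans (size_scale_leq _ _))// s0.
split.
  by rewrite -(size_scale _ a1) E size_polyDl ?size_polyN// sX.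
have : 0 < lead_coef ((1 - a i.+1) *: P i.+2).
  by rewrite E lead_coefDl ?size_polyN// lX.
rewrite lead_coefZ pmulr_rgt0//; have := geg_low_le_half i.+1; lra.
Qed.

Lemma size_geg i : size (P i) = i.+1.
Proof. by have [] := size_geg_lead i. Qed.

Lemma lead_geg_gt0 i : 0 < lead_coef (P i).
Proof. by have [] := size_geg_lead i. Qed.

Lemma geg_neq0 i : P i != 0.
Proof. by rewrite -size_poly_eq0 size_geg. Qed.

Lemma geg_at1 i : (P i).[1] = 1.
Proof.
have [m im] := ubnP i; elim: m i im => // m IH [|[|i]] im.
- by rewrite geg0 hornerC.
- by rewrite geg1 hornerX.
have /(congr1 (fun p => p.[1])) := geg_rec i.+1.
rewrite !hornerE/= (IH i.+1) ?(IH i); [|lia|lia].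
have := geg_low_le_half i.+1; nra.
Qed.

Lemma geg_atN1 i : (P i).[-1] = (-1) ^+ i.
Proof.
have [m im] := ubnP i; elim: m i im => // m IH [|[|i]] im.
- by rewrite geg0 hornerC.
- by rewrite geg1 hornerX.
have /(congr1 (fun p => p.[-1])) := geg_rec i.+1.
rewrite !hornerE/= (IH i.+1) ?(IH i); [|lia|lia].
rewrite !exprS; set e := _ ^+ i; have := geg_low_le_half i.+1 => ah E.
apply: (@mulfI _ (1 - a i.+1)); first lra.
lra.
Qed.

Lemma geg_deriv i :
  (1 - 'X^2) * (P i)^`() = i%:R *: (P i.-1 - 'X * P i).
Proof.
have [m im] := ubnP i; elim: m i im => // m IH [|[|i]] im.
- by rewrite geg0 derivC mulr0 scale0r.
- by rewrite geg1 geg0 derivX mulr1 scale1r expr2.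
have a1 : 1 - a i.+1 != 0 by have := geg_low_le_half i.+1; lra.
have E1 := IH i.+1 ltac:(lia); have E0 := IH i ltac:(lia).
have E : (1 - a i.+1) *: P i.+2 = 'X * P i.+1 - a i.+1 *: P i.
  by rewrite geg_rec addrK.
have aE : a i.+1 * (2 * i%:R + 2 + d%:R) = i%:R + 1.
  have -> : 2 * i%:R + 2 + d%:R = (2 * i.+1 + d)%N%:R :> R by rewrite natrD natrM; ring.
  by rewrite geg_low.unlock divfK ?natr1// pnatr_eq0; lia.
(* The recurrence at [i] cleared of denominators; i = 0 is set apart because the denominator
   vanishes there when d = 0. *)
have r0 : i%:R *: P i.-1 = (2 * i%:R + d%:R) *: ('X * P i) - (i%:R + d%:R) *: P i.+1.
  have [->|i0] := posnP i; first by rewrite geg1 geg0 mulr0 !add0r scale0r mulr1 subrr.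
  have c0 : 2 * i%:R + d%:R = (2 * i + d)%N%:R :> R by rewrite natrD natrM.
  have c1 : (2 * i + d)%N%:R != 0 :> R by rewrite pnatr_eq0; lia.
  rewrite geg_rec scalerDr !scalerA addrAC -scalerBl mulrBr mulr1 c0 geg_low.unlock.
  rewrite mulrCA divff// mulr1 -c0 (_ : _ - _ - _ = 0) ?scale0r ?add0r//; ring.
apply: (scalerI a1); move: E0 E1 E r0 aE.
have -> : i.+2%:R = i%:R + 1 + 1 :> R by rewrite !natr1.
have -> : i.+1%:R = i%:R + 1 :> R by rewrite natr1.
rewrite -[i.+2.-1]/i.+1 -[i.+1.-1]/i.
move: (a i.+1) (P i.+2) (P i.+1) (P i) (P i.-1) => u p2 p1 p0 pm.
move=> E0 E1 E2 E4 /(congr1 polyC) E5; have E3 := congr1 (@deriv R) E2.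
move: E0 E1 E2 E3 E4 E5; rewrite derivB derivM derivX !derivZ mul1r.
rewrite -!mul_polyC !(polyCD, polyCM, polyCN) !polyC1.
move: p2^`() p1^`() p0^`() u%:P i%:R%:P d%:R%:P 'X.
move=> p2' p1' p0' A N D X E0 E1 E2 E3 E4 E5.
apply: subr0_eq.
(* A certificate: every summand vanishes by one of [E0] to [E5], and [ring] checks that they add up
   to the difference of the two sides. *)
transitivity ((1 - X ^+ 2) * ((1 - A) * p2' - (p1 + X * p1' - A * p0')) +
  (N + 1 + 1) * X * ((1 - A) * p2 - (X * p1 - A * p0)) +
  X * ((1 - X ^+ 2) * p1' - (N + 1) * (p0 - X * p1)) -
  A * ((1 - X ^+ 2) * p0' - N * (pm - X * p0)) -
  A * (N * pm - ((2 * N + D) * (X * p0) - (N + D) * p1)) +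
  (p1 - X * p0) * (A * (2 * N + 2 + D) - (N + 1))); first by ring.
by rewrite E0 E1 E2 E3 E4 E5 !subrr !mulr0 !addr0 !subr0.
Qed.

(** Pearson's identity for P_{i+1} becomes, by [geg_deriv] and the recurrence, a relation between
    the means of P_{i+2} and P_i; the latter comes with the factor i, which disposes of i = 0. *)
Lemma gmean_geg i : (0 < i)%N -> gmean d (P i) = 0.
Proof.
have [m im] := ubnP i; elim: m i im => // m IH [|[|i]] im // _.
- have := gmean_pearson d (1 : {poly R}).
  rewrite derivC mul0r gmean0 mulr1 -geg1 => /esym/eqP.
  by rewrite mulf_eq0 pnatr_eq0 => /eqP.
- have P0 : i%:R * gmean d (P i) = 0.
    by case: i im => [|i] im; rewrite ?mul0r// IH ?mulr0//; lia.
  have := gmean_pearson d (P i.+1).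
  rewrite mulrC geg_deriv -[i.+1.-1]/i geg_rec -[i.+1.-1]/i.
  have := geg_low_le_half i.+1.
  have : a i.+1 * (2 * i%:R + 2 + d%:R) = i%:R + 1.
    have -> : 2 * i%:R + 2 + d%:R = (2 * i.+1 + d)%N%:R :> R by rewrite natrD natrM; ring.
    by rewrite geg_low.unlock divfK ?natr1// pnatr_eq0; lia.
  move: P0; rewrite -[d.+1%:R]natr1 -[i.+1%:R]natr1.
  have : 0 <= d%:R :> R by []. have : 0 <= i%:R :> R by [].
  move: (P i.+2) (P i) (a _) (i%:R) (d%:R : R) => p2 p0 A N D N0 D0 P0 aE A2.
  rewrite !(gmeanZ, gmeanB, gmeanD); move: (gmean d p2) (gmean d p0) P0 => u v P0 E.
  apply/eqP; have : (1 - A) * (N + D + 2) * u == 0.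
    have h1 : A * (N * v) = 0 by rewrite P0 mulr0.
    have h2 := congr1 ( *%R v) aE.
    by apply/eqP; lra.
  have A1 : 0 < 1 - A by lra.
  rewrite !mulf_eq0 (gt_eqF A1)/=.
  have -> : (N + D + 2 == 0) = false by rewrite gt_eqF//; lra.
  by rewrite orFb.
Qed.

(** Multiplication by X is symmetric: expanding X P_j shows that X P_i P_j has mean zero, and
    expanding X P_i instead isolates P_{i+1} P_j. *)
Lemma gmean_geg_lt i j : (i < j)%N -> gmean d (P i * P j) = 0.
Proof.
have [m im] := ubnP i; elim: m i im j => // m IH [|i] im j ij.
  by rewrite geg0 mul1r gmean_geg.
have H : gmean d ('X * P i * P j) = 0.
  rewrite -mulrA mulrCA geg_rec mulrDr -!scalerAr gmeanD !gmeanZ.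
  by rewrite !IH ?mulr0 ?addr0//; lia.
move: H; rewrite geg_rec mulrDl -!scalerAl gmeanD !gmeanZ.
rewrite [X in _ + _ * X]IH ?mulr0 ?addr0; [|lia|lia].
move=> /eqP; rewrite mulf_eq0 gt_eqF; last by have := geg_low_le_half i; lra.
by move=> /eqP.
Qed.

Lemma gmean_geg_neq i j : i != j -> gmean d (P i * P j) = 0.
Proof.
by rewrite neq_ltn => /orP[ij|ji]; [|rewrite mulrC]; exact: gmean_geg_lt.
Qed.

Definition geg_norm (i : nat) : R := gmean d (P i ^+ 2).
Local Notation h := geg_norm.

Lemma geg_norm_gt0 i : 0 < h i.
Proof.
apply: gmean_gt0; first by rewrite expf_neq0// geg_neq0.
by move=> t _; rewrite hornerE sqr_ge0.
Qed.

Lemma geg_norm_neq0 i : h i != 0.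
Proof. by rewrite gt_eqF// geg_norm_gt0. Qed.

Lemma geg_norm_rec i : (1 - a i) * h i.+1 = a i.+1 * h i.
Proof.
have : gmean d ('X * P i * P i.+1) = gmean d (P i * ('X * P i.+1)).
  by congr (gmean d _); ring.
rewrite !geg_rec -[i.+1.-1]/i mulrDl mulrDr.
rewrite -!(scalerAl, scalerAr). rewrite !gmeanD !gmeanZ.
rewrite (gmean_geg_neq (i := i.-1)); last lia.
by rewrite (gmean_geg_neq (j := i.+2)) ?mulr0 ?addr0 ?add0r -?expr2//; lia.
Qed.

Lemma geg_expand (p : {poly R}) (N : nat) : (size p <= N)%N ->
  p = \sum_(i < N) (gmean d (p * P i) / h i) *: P i.
Proof.
elim: N p => [|N IH] p sp.
  by rewrite big_ord0; apply/eqP; rewrite -size_poly_eq0 -leqn0.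
pose c := p`_N / lead_coef (P N).
have lN : lead_coef (P N) != 0 by rewrite gt_eqF// lead_geg_gt0.
have lE : lead_coef (P N) = (P N)`_N by rewrite lead_coefE size_geg.
have sq : (size (p - c *: P N)%R <= N)%N.
  apply/leq_sizeP => j; rewrite leq_eqVlt => /orP[/eqP <-|Nj].
    by rewrite coefB coefZ -lE divfK// subrr.
  by rewrite coefB coefZ !nth_default ?mulr0 ?subr0// ?size_geg// (leq_trans sp).
have cE : gmean d (p * P N) / h N = c.
  have : gmean d ((p - c *: P N) * P N) = 0.
    rewrite (IH _ sq) mulr_suml gmean_sum big1// => i _.
    by rewrite -scalerAl gmeanZ gmean_geg_lt ?mulr0.
  rewrite mulrBl gmeanB -scalerAl gmeanZ -expr2 => /subr0_eq ->.
  by rewrite mulfK// geg_norm_neq0.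
rewrite big_ord_recr/= cE -[LHS](subrK (c *: P N)); congr (_ + _).
rewrite {1}(IH _ sq); apply: eq_bigr => i _; congr (_ / _ *: _).
rewrite mulrBl gmeanB -scalerAl gmeanZ (gmean_geg_neq (i := N)) ?mulr0 ?subr0//.
by rewrite gtn_eqF.
Qed.

Lemma gmean_geg_lead (p : {poly R}) (N : nat) : size p = N.+1 ->
  0 < lead_coef p -> 0 < gmean d (p * P N).
Proof.
move=> sp lp; have /(congr1 (fun q : {poly R} => q`_N)) := @geg_expand p N.+1 ltac:(lia).
rewrite big_ord_recr/= coefD coefZ coef_sum big1 => [|i _]; last first.
  by rewrite coefZ nth_default ?mulr0// size_geg.
rewrite add0r; have := lead_geg_gt0 N; rewrite lead_coefE size_geg/=.
move: lp; rewrite lead_coefE sp/= => lp lN E.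
move: lp; rewrite E pmulr_lgt0// pmulr_lgt0// invr_gt0; exact: geg_norm_gt0.
Qed.

Lemma gmean_geg_high (p : {poly R}) (N : nat) : (size p <= N)%N ->
  gmean d (p * P N) = 0.
Proof.
move=> sp; rewrite (geg_expand sp) mulr_suml gmean_sum big1// => i _.
by rewrite -scalerAl gmeanZ gmean_geg_lt ?mulr0.
Qed.

(** Coefficients are left unnormalized, to avoid division by the norms. *)
Definition pd (p : {poly R}) : Prop := forall i, 0 <= gmean d (p * P i).

Lemma pdD p q : pd p -> pd q -> pd (p + q).
Proof. by move=> pp qp i; rewrite mulrDl gmeanD addr_ge0. Qed.

Lemma pdZ c p : 0 <= c -> pd p -> pd (c *: p).
Proof. by move=> c0 pp i; rewrite -scalerAl gmeanZ mulr_ge0. Qed.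

Lemma pd_sum (I : Type) (s : seq I) (Q : pred I) (F : I -> {poly R}) :
  (forall i, Q i -> pd (F i)) -> pd (\sum_(i <- s | Q i) F i).
Proof.
move=> FP; apply: (big_ind pd) => //; last exact: pdD.
by move=> i; rewrite mul0r gmean0.
Qed.

Lemma pd_geg j : pd (P j).
Proof.
move=> i; have [->|ij] := eqVneq j i; last by rewrite gmean_geg_neq.
by rewrite -expr2 ltW// geg_norm_gt0.
Qed.

(* The orthogonal system rescaled so that the roles of the two recurrence
   coefficients are exchanged, which is what makes the interior terms of the
   telescoping below cancel. *)
Let V i := (h i)^-1 *: P i.

Let V_rec0 : 'X * V 0 = a 1 *: V 1.
Proof.
rewrite /V -scalerAr geg_rec geg_low0 subr0 scale1r scale0r addr0 scalerA.
have := geg_norm_rec 0; rewrite geg_low0 subr0 mul1r => ->.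
by rewrite invfM mulrA mulfV ?mul1r// gt_eqF// geg_low_gt0.
Qed.

Let V_rec i : 'X * V i.+1 = a i.+2 *: V i.+2 + (1 - a i) *: V i.
Proof.
have h0 := geg_norm_neq0.
rewrite /V -scalerAr geg_rec -[i.+1.-1]/i scalerDr !scalerA; congr (_ *: _ + _ *: _).
  apply: (mulfI (h0 i.+1)); rewrite mulrA mulfV// mul1r.
  by apply: (mulIf (h0 i.+2)); rewrite geg_norm_rec; field; rewrite h0.
by apply: (mulfI (h0 i.+1)); apply: (mulIf (h0 i)); rewrite mulrA mulfV// mul1r
  -geg_norm_rec; field; rewrite h0.
Qed.

Let left_edge c m := \sum_(l < m) (1 - a (c + l) - a l) *: (V (c + l) * V l).
Let right_edge e m := \sum_(l < m) (a (e - l) - a l) *: (V (e - l) * V l).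

(* Szwarc's discrete boundary value problem: the two ways of writing
   'X * V n * V m are summed over the triangle below (n, m). *)
Let V_triangle m c : a m *: (V (m + c) * V m) = left_edge c m + right_edge (2 * m + c) m.
Proof.
have [b mb] := ubnP m; elim: b m mb c => // b IH [|[|m]] mb c.
- by rewrite geg_low0 scale0r /left_edge /right_edge !big_ord0 addr0.
- rewrite /left_edge /right_edge !big_ord1 geg_low0 !subr0 addn0.
  have -> : (2 * 1 + c - 0 = c.+2)%N by lia.
  have -> : (1 + c = c.+1)%N by lia.
  have := congr1 ( *%R (V 0)) (V_rec c).
  rewrite mulrA [V 0 * 'X]mulrC V_rec0 -!mul_polyC.
  move: (V 0) (V 1) (V c) (V c.+1) (V c.+2) => v0 v1 vc vc1 vc2 E.
  transitivity ((a 1)%:P * v1 * vc1); [by ring|rewrite E; by ring].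
have := IH m.+1 ltac:(lia) c.+2; have := IH m.+1 ltac:(lia) c.
have := IH m ltac:(lia) c.+2.
rewrite /left_edge /right_edge !big_ord_recr/=.
rewrite -/(left_edge c m) -/(left_edge c.+2 m).
have -> : (2 * m + c.+2 = 2 * m.+1 + c)%N by lia.
have -> : (2 * m.+1 + c.+2 = 2 * m.+2 + c)%N by lia.
rewrite -/(right_edge (2 * m.+1 + c) m) -/(right_edge (2 * m.+2 + c) m).
have -> : (2 * m.+2 + c - m.+1 = m.+3 + c)%N by lia.
have -> : (2 * m.+1 + c - m = m.+2 + c)%N by lia.
have -> : (m + c.+2 = m.+2 + c)%N by lia.
have -> : (m.+1 + c.+2 = m.+3 + c)%N by lia.
have -> : (c.+2 + m = m.+2 + c)%N by lia.
have -> : (c + m.+1 = m.+1 + c)%N by lia.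
have := V_rec (m.+1 + c); have := V_rec m.
rewrite -[(m.+1 + c).+2]/(m.+3 + c)%N -[(m.+1 + c).+1]/(m.+2 + c)%N.
have -> : (2 * m.+2 + c - m = m.+4 + c)%N by lia.
move: (left_edge c m) (left_edge c.+2 m) (right_edge (2 * m.+1 + c) m)
  (right_edge (2 * m.+2 + c) m) => Lc L2 Ra Rb.
rewrite -!mul_polyC !(polyCB, polyC1).
move: (V m) (V m.+1) (V m.+2) (V (m.+1 + c)) (V (m.+2 + c)) (V (m.+3 + c))
  (V (m.+4 + c)) (V (c + m)) => v0 v1 v2 w1 w2 w3 w4 wc.
move: (a m)%:P (a m.+1)%:P (a m.+2)%:P (a (m.+1 + c))%:P (a (m.+2 + c))%:P
  (a (m.+3 + c))%:P (a (m.+4 + c))%:P (a (c + m))%:P 'X.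
move=> a0 a1 a2 b1 b2 b3 b4 bc X H1 H2 H3 H4 H5.
apply: subr0_eq.
(* Inclusion-exclusion: the triangle is covered by two triangles one level down, which overlap in
   one triangle two levels down. The first two summands are [V_rec] applied to either factor of
   [v1 * w2]. *)
transitivity (w2 * (X * v1 - (a2 * v2 + (1 - a0) * v0)) * (-1) +
  v1 * (X * w2 - (b3 * w3 + (1 - b1) * w1)) +
  (a1 * (w1 * v1) - (Lc + (1 - bc - a0) * (wc * v0) + (Ra + (b2 - a0) * (w2 * v0)))) +
  (a1 * (w3 * v1) - (L2 + (1 - b2 - a0) * (w2 * v0) + (Rb + (b4 - a0) * (w4 * v0)))) -
  (a0 * (w2 * v0) - (L2 + Ra))); first by ring.
by rewrite H1 H2 H3 H4 H5 !subrr !mulr0 mul0r !addr0 subr0.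
Qed.

(** Induction on the smaller index, which drops along both edges of [V_triangle]; the left
    coefficients are nonnegative because [geg_low] is at most 1/2, the right ones because it is
    nondecreasing. *)
Let pd_V_mul m n : (m <= n)%N -> pd (V n * V m).
Proof.
have [b mb] := ubnP m; elim: b m mb n => // b IH [|m] mb n mn.
  rewrite /V -scalerAl -scalerAr geg0 mulr1 scalerA; apply: pdZ; last exact: pd_geg.
  by rewrite mulr_ge0// invr_ge0 ltW// geg_norm_gt0.
have am : 0 < a m.+1 by rewrite geg_low_gt0.
rewrite -[V n * _]scale1r -(mulVf (lt0r_neq0 am)) -scalerA.
apply: pdZ; first by rewrite invr_ge0 ltW.
rewrite -{1}(subnKC mn) V_triangle; apply: pdD.
  apply: pd_sum => l _; have lm := ltn_ord l; apply: pdZ; last by apply: IH; lia.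
  have := geg_low_le_half (n - m.+1 + l); have := geg_low_le_half l; lra.
apply: pd_sum => l _; have lm := ltn_ord l; apply: pdZ; last by apply: IH; lia.
by rewrite subr_ge0 geg_low_le//; lia.
Qed.

Lemma pd_geg_mul m n : pd (P m * P n).
Proof.
wlog mn : m n / (m <= n)%N.
  by move=> H; have [/H//|/ltnW/H] := leqP m n; rewrite mulrC.
have -> : P m * P n = (h m * h n) *: (V n * V m).
  rewrite /V -scalerAl -scalerAr !scalerA mulrC.
  have hm := geg_norm_neq0 m; have hn := geg_norm_neq0 n.
  by rewrite (_ : h m * h n / h n / h m = 1) ?scale1r//; field; rewrite hm.
apply: pdZ; last exact: pd_V_mul.
by rewrite mulr_ge0// ltW// geg_norm_gt0.
Qed.

Lemma pdM p q : pd p -> pd q -> pd (p * q).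
Proof.
move=> pp pq; rewrite (geg_expand (leqnn (size p))) (geg_expand (leqnn (size q))).
rewrite mulr_suml; apply: pd_sum => i _; rewrite mulr_sumr; apply: pd_sum => j _.
rewrite -scalerAl -scalerAr; apply: pdZ.
  by rewrite divr_ge0// ltW// geg_norm_gt0.
apply: pdZ; last exact: pd_geg_mul.
by rewrite divr_ge0// ltW// geg_norm_gt0.
Qed.

End GegenbauerAlgebra.

(** * The Fischer inner product *)

Section Fischer.
Variables (R : realFieldType) (n : nat).
Local Notation M := (mpoly n R).
Implicit Types p q : M.

Let wt (m : multinom n) : R := (\prod_(i < n) (m i)`!)%:R.

(** The factorial weights are those for which multiplication by a variable is adjoint to
    differentiation. *)
Definition fischer p q : R := \sum_(m <- msupp p) wt m * mcoeff m p * mcoeff m q.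

(** A common index set for several polynomials: additivity on the left is not visible when the range
    is the support of [p]. *)
Lemma fischer_bounded k p q : (mmeasure mdeg p <= k)%N ->
  fischer p q = \sum_(m : bmultinom n k) wt m * mcoeff m p * mcoeff m q.
Proof.
move=> pk; pose I : subFinType _ := bmultinom n k.
rewrite /fischer (ssrcomplements.big_mksub I) ?msupp_uniq //=; first last.
  by move=> x /msize_mdeg_lt /leq_trans; apply.
by rewrite big_rmcond //= => j /memN_msupp_eq0 ->; rewrite mulr0 mul0r.
Qed.

Lemma fischer_linear_l a p p' q :
  fischer (a *: p + p') q = a * fischer p q + fischer p' q.
Proof.
pose k := maxn (mmeasure mdeg (a *: p + p')) (maxn (mmeasure mdeg p) (mmeasure mdeg p')).
rewrite !(@fischer_bounded k) ?leq_max ?leqnn ?orbT// mulr_sumr -big_split/=.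
by apply: eq_bigr => m _; rewrite mcoeffD mcoeffZ; ring.
Qed.

Lemma fischer_linear_r a p q q' :
  fischer p (a *: q + q') = a * fischer p q + fischer p q'.
Proof.
rewrite /fischer mulr_sumr -big_split/=.
by apply: eq_bigr => m _; rewrite mcoeffD mcoeffZ; ring.
Qed.

Lemma fischer_ge0 p : 0 <= fischer p p.
Proof.
apply: sumr_ge0 => m _; rewrite -mulrA -expr2 mulr_ge0 ?sqr_ge0//.
Qed.

Lemma fischerDl q : {morph fischer^~ q : p p' / p + p'}.
Proof. by move=> p p'; rewrite -[p]scale1r fischer_linear_l mul1r scale1r. Qed.

Lemma fischerDr p : {morph fischer p : q q' / q + q'}.
Proof. by move=> q q'; rewrite -[q]scale1r fischer_linear_r mul1r scale1r. Qed.

Lemma fischer0l q : fischer 0 q = 0.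
Proof. by apply: (@addrI _ (fischer 0 q)); rewrite -fischerDl !addr0. Qed.

Lemma fischer0r p : fischer p 0 = 0.
Proof. by apply: (@addrI _ (fischer p 0)); rewrite -fischerDr !addr0. Qed.

Lemma fischerZl a p q : fischer (a *: p) q = a * fischer p q.
Proof. by rewrite -[a *: p]addr0 fischer_linear_l fischer0l addr0. Qed.

Lemma fischerZr a p q : fischer p (a *: q) = a * fischer p q.
Proof. by rewrite -[a *: q]addr0 fischer_linear_r fischer0r addr0. Qed.

Lemma fischer_suml (I : Type) (s : seq I) (P : pred I) (F : I -> M) q :
  fischer (\sum_(i <- s | P i) F i) q = \sum_(i <- s | P i) fischer (F i) q.
Proof. by rewrite (big_morph _ (fischerDl q) (fischer0l q)). Qed.

Lemma fischer_sumr (I : Type) (s : seq I) (P : pred I) (F : I -> M) p :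
  fischer p (\sum_(i <- s | P i) F i) = \sum_(i <- s | P i) fischer p (F i).
Proof. by rewrite (big_morph _ (fischerDr p) (fischer0r p)). Qed.

Lemma fischerX u q : fischer (mpolyX R u) q = wt u * mcoeff u q.
Proof. by rewrite /fischer msuppX big_seq1 mcoeffX eqxx mulr1. Qed.

Local Notation X i := (mpolyX R (mnm1 i) : M).

Lemma fischer_mderiv i p q : fischer (X i * p) q = fischer p (mderiv i q).
Proof.
have wtS u : wt (mnm_add (mnm1 i) u) = wt u * (u i).+1%:R.
  rewrite /wt -natrM; congr _%:R.
  rewrite (bigD1 i)//= [in RHS](bigD1 i)//= mnmE mnm1E eqxx add1n factS.
  rewrite -mulnA [LHS]mulnC; congr (_ * _ * _)%N.
  apply: eq_bigr => j ji; rewrite mnmE mnm1E.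
  by rewrite eq_sym (negbTE ji) add0n.
have E u : fischer (X i * mpolyX R u) q = fischer (mpolyX R u) (mderiv i q).
  rewrite -mpolyXD !fischerX mcoeff_deriv wtS addmC -mulrA.
  by rewrite mulr_natl.
rewrite [p]mpolyE mulr_sumr !fischer_suml.
by apply: eq_bigr => u _; rewrite -scalerAr !fischerZl E.
Qed.

Definition lap p : M := \sum_i mderiv i (mderiv i p).
Definition sqnorm : M := \sum_i X i ^+ 2.
Definition dirder (x : 'rV[R]_n) p : M := \sum_i x 0 i *: mderiv i p.
Definition linform (x : 'rV[R]_n) : M := \sum_i x 0 i *: X i.
Definition euler p : M := \sum_i X i * mderiv i p.

Lemma fischer_sqnorm p q : fischer (sqnorm * p) q = fischer p (lap q).
Proof.
rewrite /sqnorm mulr_suml fischer_suml fischer_sumr.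
by apply: eq_bigr => i _; rewrite expr2 -mulrA !fischer_mderiv.
Qed.

Lemma fischer_linform x p q : fischer (linform x * p) q = fischer p (dirder x q).
Proof.
rewrite /linform mulr_suml fischer_suml fischer_sumr.
apply: eq_bigr => i _.
by rewrite -scalerAl fischerZl fischerZr fischer_mderiv.
Qed.

Lemma mderivX1 i j : mderiv i (X j) = (i == j)%:R :> M.
Proof.
rewrite mderivX mnm1E eq_sym; case: eqVneq => [->|_]; last by rewrite scale0r.
rewrite scale1r (_ : mnm_sub _ _ = mnm0) ?mpolyX0//.
by apply/mnmP => l; rewrite mnmBE subnn mnm0E.
Qed.

Lemma mderiv1 i : mderiv i (1 : M) = 0.
Proof. by rewrite (_ : 1 = mpolyC n 1)// mderivC. Qed.

Lemma mderiv_linform i x : mderiv i (linform x) = (x 0 i)%:A :> M.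
Proof.
rewrite /linform raddf_sum/= (bigD1 i)//= big1 => [|j ji].
  by rewrite mderivZ mderivX1 eqxx addr0.
by rewrite mderivZ mderivX1 eq_sym (negbTE ji) scaler0.
Qed.

Lemma mderiv_sqnorm i : mderiv i sqnorm = 2 *: X i :> M.
Proof.
rewrite /sqnorm raddf_sum/= (bigD1 i)//= big1 => [|j ji].
  by rewrite expr2 mderivM mderivX1 eqxx mul1r mulr1 addr0 scaler_nat mulr2n.
by rewrite expr2 mderivM mderivX1 eq_sym (negbTE ji) mul0r mulr0 addr0.
Qed.

Lemma dirderM x p q : dirder x (p * q) = dirder x p * q + p * dirder x q.
Proof.
rewrite /dirder mulr_suml mulr_sumr -big_split; apply: eq_bigr => i _ /=.
by rewrite mderivM scalerDr scalerAl scalerAr.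
Qed.

Lemma dirderB x p q : dirder x (p - q) = dirder x p - dirder x q.
Proof.
rewrite /dirder -sumrB; apply: eq_bigr => i _.
by rewrite mderivB scalerBr.
Qed.

Lemma dirderZ x a p : dirder x (a *: p) = a *: dirder x p.
Proof.
rewrite /dirder scaler_sumr; apply: eq_bigr => i _.
by rewrite mderivZ !scalerA mulrC.
Qed.

Lemma dirder1 x : dirder x 1 = 0.
Proof.
rewrite /dirder big1// => i _.
by rewrite mderiv1 scaler0.
Qed.

Lemma dirder_linform x y : dirder x (linform y) = (\sum_i x 0 i * y 0 i)%:A.
Proof.
rewrite /dirder scaler_suml; apply: eq_bigr => i _.
by rewrite mderiv_linform scalerA.
Qed.

Lemma dirder_sqnorm x : dirder x sqnorm = 2 *: linform x.
Proof.
rewrite /dirder /linform scaler_sumr; apply: eq_bigr => i _.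
by rewrite mderiv_sqnorm !scalerA mulrC.
Qed.

Lemma lap_linformM x p : lap (linform x * p) = linform x * lap p + 2 *: dirder x p.
Proof.
rewrite /lap /dirder mulr_sumr scaler_sumr -big_split; apply: eq_bigr => i _ /=.
rewrite mderivM mderivD !mderivM mderiv_linform mderivZ.
rewrite mderiv1 scaler0 mul0r add0r mulr_algl -!mul_mpolyC; ring.
Qed.

Lemma lap_sqnormM p :
  lap (sqnorm * p) = sqnorm * lap p + 4 *: euler p + (2 * n%:R) *: p.
Proof.
have -> : (2 * n%:R) *: p = \sum_(i < n) 2 *: p.
  by rewrite sumr_const card_ord scalerMnl mulr_natr.
rewrite /lap /euler mulr_sumr scaler_sumr -!big_split; apply: eq_bigr => i _ /=.
rewrite mderivM mderivD !mderivM mderiv_sqnorm mderivZ mderivX1 eqxx/=.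
rewrite -!mul_mpolyC; ring.
Qed.

Lemma lapB p q : lap (p - q) = lap p - lap q.
Proof. by rewrite /lap -sumrB; apply: eq_bigr => i _; rewrite !mderivB. Qed.

Lemma lapZ a p : lap (a *: p) = a *: lap p.
Proof. by rewrite /lap scaler_sumr; apply: eq_bigr => i _; rewrite !mderivZ. Qed.

Lemma eulerM p q : euler (p * q) = euler p * q + p * euler q.
Proof.
rewrite /euler mulr_suml mulr_sumr -big_split; apply: eq_bigr => i _ /=.
by rewrite mderivM; ring.
Qed.

Lemma eulerB p q : euler (p - q) = euler p - euler q.
Proof. by rewrite /euler -sumrB; apply: eq_bigr => i _; rewrite !mderivB mulrBr. Qed.

Lemma eulerZ a p : euler (a *: p) = a *: euler p.
Proof.
by rewrite /euler scaler_sumr; apply: eq_bigr => i _; rewrite !mderivZ scalerAr.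
Qed.

Lemma euler_linform x : euler (linform x) = linform x.
Proof.
apply: eq_bigr => i _; rewrite mderiv_linform.
by rewrite mulr_algr.
Qed.

Lemma euler_sqnorm : euler sqnorm = 2 *: sqnorm.
Proof.
rewrite /euler /sqnorm scaler_sumr; apply: eq_bigr => i _.
by rewrite -/sqnorm mderiv_sqnorm -scalerAr expr2.
Qed.

Lemma euler_dirder x p : euler (dirder x p) = dirder x (euler p) - dirder x p.
Proof.
rewrite {1}/euler.
have -> : dirder x (euler p) = \sum_j dirder x (X j * mderiv j p).
  rewrite /dirder /euler exchange_big/=; apply: eq_bigr => i _.
  by rewrite (raddf_sum (mderiv i)) scaler_sumr.
under [Y in _ = Y - _]eq_bigr => j _ do rewrite dirderM.
rewrite big_split/= [Y in _ = Y + _ - _](_ : _ = dirder x p).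
  rewrite [RHS]addrAC subrr add0r; apply: eq_bigr => i _; congr (_ * _).
  rewrite /dirder raddf_sum; apply: eq_bigr => j _/=.
  by rewrite mderivZ mderiv_comm.
apply: eq_bigr => i _; rewrite /dirder (bigD1 i)//= big1 => [|j ji].
  by rewrite mderivX1 eqxx addr0 mulr_algl.
by rewrite mderivX1 (negbTE ji) scaler0.
Qed.

Lemma mcoeff_euler p m : mcoeff m (euler p) = (mdeg m)%:R * mcoeff m p.
Proof.
have E u : euler (mpolyX R u) = (mdeg u)%:R *: mpolyX R u.
  rewrite /euler mdegE natr_sum scaler_suml; apply: eq_bigr => i _.
  rewrite mderivX -scalerAr -mpolyXD.
  have [->|ui] := eqVneq (u i) 0%N; first by rewrite !scale0r.
  congr (_ *: mpolyX R _); apply/mnmP => j; rewrite mnmDE mnmBE mnm1E.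
  by case: eqVneq => [<-|_] /=; lia.
have eulerS (s : seq (multinom n)) (F : multinom n -> M) :
    euler (\sum_(u <- s) F u) = \sum_(u <- s) euler (F u).
  rewrite /euler exchange_big/=; apply: eq_bigr => i _.
  by rewrite raddf_sum mulr_sumr.
rewrite [in LHS](mpolyE p) eulerS [in RHS](mpolyE p) !(raddf_sum (mcoeff m)) mulr_sumr.
apply: eq_bigr => u _ /=; rewrite eulerZ E !mcoeffZ mcoeffX.
by case: eqVneq => [->|_]; rewrite ?mulr0 ?mulr1 // mulrC.
Qed.

Lemma fischer_powM x i q : fischer (linform x ^+ i) q = fischer 1 (iter i (dirder x) q).
Proof.
elim: i q => [|i IH] q; first by rewrite expr0.
by rewrite exprS fischer_linform IH iterSr.
Qed.

(** The reproducing property. Adjointness turns the power into i derivatives in the direction x, and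
    at the point x the directional derivative equals the Euler operator, whose eigenvalues i, i - 1,
    ... multiply to i!. *)
Lemma fischer_linform_pow x i q : euler q = i%:R *: q ->
  fischer (linform x ^+ i) q = i`!%:R * meval (fun j => x 0 j) q.
Proof.
rewrite fischer_powM.
elim: i q => [|i IH] q Eq.
  rewrite /= mul1r; have q0 : q = mpolyC n (mcoeff mnm0 q).
    apply/mpolyP => m; rewrite mcoeffC.
    have /(congr1 (mcoeff m)) := Eq; rewrite scale0r mcoeff0 mcoeff_euler => /eqP.
    rewrite mulf_eq0 pnatr_eq0 mdeg_eq0; case: eqVneq => [->|_] /=.
      by rewrite mulr1.
    by move=> /eqP ->; rewrite mulr0.
  rewrite q0 mevalC -mpolyX0 fischerX.
  rewrite mcoeffC eqxx mulr1 /wt big1 ?mul1r// => j _.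
  by rewrite mnm0E.
rewrite iterSr IH; last first.
  rewrite euler_dirder Eq dirderZ -[Y in _ - Y]scale1r -scalerBl; congr (_ *: _).
  by rewrite -natr1 addrK.
have -> : meval (fun j => x 0 j) (dirder x q) =
    meval (fun j => x 0 j) (euler q).
  rewrite /dirder /euler !raddf_sum; apply: eq_bigr => j _ /=.
  by rewrite mevalZ mevalM mevalXU.
by rewrite Eq mevalZ mulrA -natrM mulnC -factS.
Qed.

End Fischer.

(** * Zonal harmonics: Gegenbauer polynomials are positive definite on the sphere *)

Section Zonal.
Variables (R : realType) (d : nat) (x : 'rV[R]_d.+2).
Hypothesis x1 : dot x x = 1.
Local Notation M := (mpoly d.+2 R).
Local Notation a := (geg_low R d).
Local Notation l := (linform x).
Local Notation s := (sqnorm R d.+2).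

(** The homogenization in y of P_i(<x, y>) for a unit vector x: the Gegenbauer recurrence with the
    squared norm inserted in its lower term. *)
Fixpoint zonal (i : nat) : M :=
  match i with
  | 0 => 1
  | i1.+1 =>
    match i1 with
    | 0 => l
    | i2.+1 => (1 - a i1)^-1 *: (l * zonal i1 - a i1 *: (s * zonal i2))
    end
  end.

Let zonalS i : (1 - a i.+1) *: zonal i.+2 =
  l * zonal i.+1 - a i.+1 *: (s * zonal i).
Proof.
rewrite [zonal i.+2]/= scalerA divff ?scale1r//.
by have := geg_low_le_half R d i.+1; lra.
Qed.

Let aE i : a i * (2 * i%:R + d%:R) = i%:R.
Proof.
have [->|i0] := posnP i; first by rewrite geg_low0 mul0r.
rewrite geg_low.unlock -natrM -natrD divfK// pnatr_eq0; lia.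
Qed.

Let a_neq1 i : 1 - a i != 0.
Proof. by have := geg_low_le_half R d i; lra. Qed.

(** Supplies the cross term when the Laplacian is applied to [l * zonal x i] in [zonal_lap]. *)
Lemma zonal_dirder i : dirder x (zonal i.+1) = i.+1%:R *: zonal i.
Proof.
have ll : dirder x l = 1 by rewrite dirder_linform -/(dot x x) x1 scale1r.
have [m im] := ubnP i; elim: m i im => // m IH [|i] im.
  by rewrite [zonal 1]/= ll scale1r.
apply: (scalerI (a_neq1 i.+1)); rewrite -dirderZ zonalS.
rewrite dirderB dirderZ !dirderM ll dirder_sqnorm mul1r IH; last lia.
have E : s * dirder x (zonal i) =
    (2 * i%:R + d%:R) *: (l * zonal i) - (i%:R + d%:R) *: zonal i.+1.
  case: i im => [|i] im.
    by rewrite [zonal 0]/= [zonal 1]/= dirder1 !mulr0 mulr1 !add0r subrr.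
  rewrite IH; last lia.
  have := zonalS i; move: (zonal i.+2) (zonal i.+1) (zonal i) (aE i.+1) => z2 z1 z0.
  move=> A Z.
  have -> : s * (i.+1%:R *: z0) = (2 * i.+1%:R + d%:R) *: (a i.+1 *: (s * z0)).
    by rewrite scalerA [_ * a _]mulrC A -scalerAr.
  rewrite (_ : a i.+1 *: (s * z0) = l * z1 - (1 - a i.+1) *: z2); last first.
    by rewrite Z opprB addrC subrK.
  rewrite scalerBr scalerA; congr (_ - _ *: _).
  rewrite mulrBr mulr1 [X in _ - X]mulrC A -natr1; ring.
rewrite E; move: (zonal i.+1) (zonal i) => z1 z0.
have A := aE i.+1.
have N2 : i.+2%:R = i%:R + 2 :> R by rewrite -addn2 natrD.
have N1 : i.+1%:R = i%:R + 1 :> R by rewrite natr1.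
rewrite !N1 N2 in A *.
move: (a i.+1) (i%:R : R) (d%:R : R) A => u N D A.
have -> : (1 - u) *: ((N + 2) *: z1) = (1 + u * (N + D)) *: z1 + 0 *: (l * z0).
  rewrite scale0r addr0 scalerA; congr (_ *: _); lra.
have <- : (N + 1) - u * (2 + 2 * N + D) = 0 by lra.
rewrite -!mul_mpolyC; ring.
Qed.

Lemma zonal_euler i : euler (zonal i) = i%:R *: zonal i.
Proof.
have E0 : euler (1 : M) = 0 by rewrite /euler big1// => j _; rewrite mderiv1 mulr0.
have [m im] := ubnP i; elim: m i im => // m IH [|[|i]] im.
- by rewrite E0 scale0r.
- by rewrite [zonal 1]/= euler_linform scale1r.
apply: (scalerI (a_neq1 i.+1)); rewrite -eulerZ zonalS.
rewrite eulerB eulerZ !eulerM euler_linform euler_sqnorm !IH; [|lia|lia].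
rewrite scalerA [_ * i.+2%:R]mulrC -scalerA zonalS.
rewrite -(natr1 i.+1) -(natr1 i) -!mul_mpolyC; ring.
Qed.

(** The value of [geg_low] is exactly the one for which the contributions of [l * zonal] and
    [s * zonal] cancel: 2 (i + 1) = a_{i+1} (4 i + 2 n). *)
Lemma zonal_lap i : lap (zonal i) = 0.
Proof.
have L0 : lap (1 : M) = 0 by rewrite /lap big1// => j _; rewrite mderiv1 mderiv0.
have [m im] := ubnP i; elim: m i im => // m IH [|[|i]] im.
- exact: L0.
- by rewrite -[zonal 1]mulr1 lap_linformM L0 dirder1 mulr0 scaler0 addr0.
apply: (scalerI (a_neq1 i.+1)); rewrite -lapZ zonalS scaler0.
rewrite lapB lapZ lap_linformM lap_sqnormM !IH; [|lia|lia].
rewrite !mulr0 !add0r zonal_dirder zonal_euler !scalerA -scalerDl scalerA -scalerBl.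
have A := aE i.+1.
rewrite (_ : _ - _ = 0) ?scale0r//.
move: A; rewrite -(natr1 d.+1) -(natr1 d) -(natr1 i) => A; lra.
Qed.

Lemma meval_linform (y z : 'rV[R]_d.+2) :
  meval (fun j => y 0 j) (linform z) = dot z y.
Proof.
rewrite /linform raddf_sum; apply: eq_bigr => j _ /=.
by rewrite mevalZ mevalXU.
Qed.

Lemma meval_zonal (y : 'rV[R]_d.+2) i : dot y y = 1 ->
  meval (fun j => y 0 j) (zonal i) = (geg R d i).[dot x y].
Proof.
move=> y1; set ev := meval _.
have evs : ev s = 1.
  rewrite -y1 /ev /sqnorm raddf_sum; apply: eq_bigr => j _ /=.
  by rewrite rmorphXn/= mevalXU expr2.
have [m im] := ubnP i; elim: m i im => // m IH [|[|i]] im.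
- by rewrite /ev meval1 geg0 hornerC.
- by rewrite /ev meval_linform geg1 hornerX.
apply: (mulfI (a_neq1 i.+1)).
rewrite -[LHS]mevalZ zonalS mevalB mevalZ !mevalM -/ev evs mul1r.
rewrite /ev meval_linform -/ev !IH; [|lia|lia].
have /(congr1 (fun p => p.[dot x y])) := geg_rec R d i.+1.
rewrite !hornerE => ->; ring.
Qed.

End Zonal.

Lemma zonal_split (R : realType) (d i : nat) : exists2 c : R, 0 < c &
  forall x : 'rV[R]_d.+2, exists g : mpoly d.+2 R,
    zonal x i = c *: linform x ^+ i + sqnorm R d.+2 * g.
Proof.
have [m im] := ubnP i; elim: m i im => // m IH [|[|i]] im.
- by exists 1 => // x; exists 0; rewrite scale1r mulr0 addr0.
- by exists 1 => // x; exists 0; rewrite scale1r mulr0 addr0.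
have [c c0 cE] := IH i.+1 ltac:(lia).
pose u := 1 - geg_low R d i.+1.
have u0 : 0 < u^-1 by rewrite invr_gt0 /u; have := geg_low_le_half R d i.+1; lra.
exists (u^-1 * c); first by rewrite mulr_gt0.
move=> x; have [g E] := cE x.
exists (u^-1 *: (linform x * g - geg_low R d i.+1 *: zonal x i)).
rewrite [zonal x i.+2]/= -/(zonal x i.+1) E -/u [linform x ^+ i.+2]exprS.
by rewrite -!mul_mpolyC mpolyCM; ring.
Qed.

(* Fischer adjointness makes the zonal polynomials a Gram system: [zonal y i]
   is harmonic, so only the leading term of [zonal x i] contributes. *)
Lemma fischer_zonal (R : realType) (d i : nat) : exists2 c : R, 0 < c &
  forall x y : 'rV[R]_d.+2, dot x x = 1 -> dot y y = 1 ->
    fischer (zonal x i) (zonal y i) = c * (geg R d i).[dot x y].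
Proof.
have [c c0 cE] := zonal_split R d i.
exists (c * i`!%:R); first by rewrite mulr_gt0// ltr0n fact_gt0.
move=> x y x1 y1; have [g ->] := cE x.
rewrite fischerDl fischerZl fischer_sqnorm (zonal_lap y1) fischer0r addr0.
rewrite (fischer_linform_pow _ (zonal_euler y i)) (meval_zonal y _ x1).
by rewrite mulrA /dot; under eq_bigr do rewrite mulrC.
Qed.

(** Up to a positive factor independent of the points, the double sum is the squared Fischer norm of
    the sum of the zonal polynomials. *)
Lemma geg_positive_definite (R : realType) (d i : nat)
    (s : seq 'rV[R]_d.+2) : (forall x, x \in s -> dot x x = 1) ->
  0 <= \sum_(x <- s) \sum_(y <- s) (geg R d i).[dot x y].
Proof.
move=> s1; have [c c0 cE] := fischer_zonal R d i.
rewrite -(pmulr_rge0 _ c0).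
suff <- : fischer (\sum_(x <- s) zonal x i) (\sum_(y <- s) zonal y i) =
    c * \sum_(x <- s) \sum_(y <- s) (geg R d i).[dot x y] by exact: fischer_ge0.
rewrite fischer_suml mulr_sumr big_seq [RHS]big_seq; apply: eq_bigr => x xs.
rewrite fischer_sumr mulr_sumr big_seq [RHS]big_seq; apply: eq_bigr => y ys.
by rewrite cE ?s1.
Qed.

(** * Jacobi polynomials *)

Section RisingFactorial.
Variable R : realType.
Implicit Types x : R.

Definition rising x (k : nat) : R := \prod_(l < k) (x + l%:R).

Lemma rising0 x : rising x 0 = 1. Proof. by rewrite /rising big_ord0. Qed.

Lemma risingSr x k : rising x k.+1 = rising x k * (x + k%:R).
Proof. by rewrite /rising big_ord_recr. Qed.

Lemma risingSl x k : rising x k.+1 = x * rising (x + 1) k.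
Proof.
rewrite /rising big_ord_recl addr0; congr (_ * _); apply: eq_bigr => l _.
by rewrite lift0 -natr1; ring.
Qed.

Lemma risingD x k l : rising x (k + l) = rising x k * rising (x + k%:R) l.
Proof.
elim: l => [|l IH]; first by rewrite addn0 rising0 mulr1.
by rewrite addnS !risingSr IH natrD; ring.
Qed.

Lemma rising_gt0 x k : 0 < x -> 0 < rising x k.
Proof. by move=> x0; apply: prodr_gt0 => l _; rewrite ltr_wpDr. Qed.

Lemma gbinom_rising x i j : (j <= i)%N ->
  gbinom (i%:R + x) j * j`!%:R * rising (x + 1) (i - j) = rising (x + 1) i.
Proof.
move=> ji; rewrite divfK ?pnatr_eq0 -?lt0n ?fact_gt0//.
elim: j ji => [|j IH] ji; first by rewrite big_ord0 mul1r subn0.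
rewrite -IH; last lia.
rewrite big_ord_recr/= -mulrA; congr (_ * _).
have -> : (i - j = (i - j.+1).+1)%N by lia.
rewrite risingSr mulrC; congr (_ * _).
by rewrite natrB// -natr1; ring.
Qed.

(** An i-th finite difference of a polynomial of degree l < i; each difference lowers the length of
    the rising factorial by one. *)
Lemma sum_sign_bin_rising i l x : (l < i)%N ->
  \sum_(j < i.+1) (-1) ^+ j * 'C(i, j)%:R * rising (x + (i - j)%N%:R) l = 0.
Proof.
elim: i l x => [//|i IH] l x li.
have rS y : rising (y + 1) l - rising y l = l%:R * rising (y + 1) l.-1.
  case: l {li} => [|l]; first by rewrite !rising0 subrr mul0r.
  by rewrite risingSr risingSl -natr1; ring.
transitivity (\sum_(j < i.+1) (-1) ^+ j * 'C(i, j)%:R *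
    (rising (x + (i - j)%N%:R + 1) l - rising (x + (i - j)%N%:R) l)).
  under [RHS]eq_bigr do rewrite mulrBr.
  rewrite sumrB [in RHS]big_ord_recl [in X in _ = _ - X]big_ord_recr/=.
  rewrite big_ord_recl big_ord_recr/= !bin0 !binn !subn0 !subnn.
  under eq_bigr => j _.
    rewrite /bump leq0n add1n binS natrD mulrDr mulrDl subSS exprS.
    rewrite [X in _ + X](_ : _ = - ((-1) ^+ j * 'C(i, j)%:R *
      rising (x + (i - j)%N%:R) l)); last by ring.
    over.
  rewrite big_split/= sumrN exprS.
  under [in RHS]eq_bigr => j _.
    rewrite /bump leq0n add1n.
    rewrite (_ : x + (i - j.+1)%N%:R + 1 = x + (i - j)%N%:R); last first.
      by rewrite -addrA natr1 -subSn ?subSS.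
    over.
  rewrite -[x + i%:R + 1]addrA natr1 addr0.
  rewrite (eq_bigr (fun j : 'I_i => (-1) ^+ j.+1 * 'C(i, j.+1)%:R *
    rising (x + (i - j)%N%:R) l)) => [|j _]; last by rewrite exprS.
  ring.
under eq_bigr do rewrite rS mulrCA.
rewrite -mulr_sumr; case: l li rS => [|l] li rS; first by rewrite mul0r.
under eq_bigr do rewrite -addrA [_ + 1]addrC addrA.
by rewrite IH ?mulr0.
Qed.

End RisingFactorial.

Section JacobiMoments.
Variables (R : realType) (d : nat).
Local Notation c := (d.+1%:R / 2 : R).

Let c_gt0 : 0 < c. Proof. by rewrite divr_gt0. Qed.

Definition bmoment (u v : nat) : R := gmean d ((1 - 'X) ^+ u * (1 + 'X) ^+ v).

Lemma bmoment_rec u v : (v%:R + c) * bmoment u.+1 v = (u%:R + c) * bmoment u v.+1.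
Proof.
set f : {poly R} := (1 - 'X) ^+ u * (1 + 'X) ^+ v.
have df : f^`() * (1 - 'X^2) = v%:R *: ((1 - 'X) ^+ u.+1 * (1 + 'X) ^+ v)
    - u%:R *: ((1 - 'X) ^+ u * (1 + 'X) ^+ v.+1).
  have E (g : {poly R}) m : g ^+ m.-1 *+ m * g = m%:R *: g ^+ m.
    case: m => [|m]; first by rewrite mulr0n mul0r scale0r.
    by rewrite mulrnAl -exprSr scaler_nat.
  rewrite /f derivM !deriv_exp derivB derivD derivX derivC sub0r add0r mul1r mulN1r.
  have -> : 1 - 'X^2 = (1 - 'X) * (1 + 'X) :> {poly R} by ring.
  transitivity ((1 - 'X) ^+ u * (1 - 'X) * ((1 + 'X) ^+ v.-1 *+ v * (1 + 'X))
     - (1 + 'X) ^+ v * (1 + 'X) * ((1 - 'X) ^+ u.-1 *+ u * (1 - 'X)) : {poly R}).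
    rewrite mulNrn; ring.
  rewrite !E -!exprSr -!scalerAr; congr (_ *: _ - _ *: _); exact: mulrC.
have Xf : 'X * f = 2^-1 *: ((1 - 'X) ^+ u * (1 + 'X) ^+ v.+1
    - (1 - 'X) ^+ u.+1 * (1 + 'X) ^+ v).
  rewrite (_ : _ - _ = 2 *: ('X * f)) ?scalerA ?mulVf ?scale1r//.
  by rewrite /f !exprS scaler_nat; ring.
have := gmean_pearson d f.
rewrite df Xf gmeanB !gmeanZ gmeanB -!/(bmoment _ _); lra.
Qed.

(** Up to normalization these are Beta integrals. For u + v fixed they factor into a function of u
    and one of v, which is what makes the Jacobi sum computable. *)
Lemma bmoment_rising u v :
  bmoment u v = rising c u * rising c v * (bmoment 0 (u + v) / rising c (u + v)).
Proof.
elim: u v => [|u IH] v.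
  by rewrite rising0 mul1r mulrCA mulfV ?mulr1// gt_eqF// rising_gt0.
have c0 := c_gt0; have v0 : 0 < v%:R + c by rewrite ltr_wpDl.
apply: (mulfI (lt0r_neq0 v0)); rewrite bmoment_rec IH addnS addSn (risingSr c u) (risingSr c v).
ring.
Qed.

(** Since c - 1 = (n - 3)/2, the orthogonality weight is (1 - X)^p (1 + X)^q times the Gegenbauer
    weight. *)
Definition jac (p q : nat) (i : nat) : {poly R} := jacobi (c - 1 + p%:R) (c - 1 + q%:R) i.

Lemma jac_orth_basis p q i l : (l < i)%N ->
  gmean d ((1 - 'X) ^+ p * (1 + 'X) ^+ q * jac p q i * (1 + 'X) ^+ l) = 0.
Proof.
move=> li; rewrite /jac /jacobi mulr_sumr mulr_suml gmean_sum.
(* Everything that does not depend on the summation index [j]; what remains is an alternating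
   binomial sum. *)
pose K : R := rising c p * rising c q * rising (c + p%:R) i * rising (c + q%:R) i
  * (bmoment 0 (p + q + i + l) / rising c (p + q + i + l)) / 2 ^+ i / i`!%:R.
transitivity (K * \sum_(j < i.+1) (-1) ^+ j * 'C(i, j)%:R *
   rising (c + q%:R + (i - j)%N%:R) l); last by rewrite sum_sign_bin_rising ?mulr0.
rewrite mulr_sumr; apply: eq_bigr => j _; have ji : (j <= i)%N by rewrite -ltnS.
rewrite -scalerAr -scalerAl gmeanZ !exprZn.
have -> : (1 - 'X) ^+ p * (1 + 'X) ^+ q *
    (2^-1 ^+ j *: ('X - 1) ^+ j * (2^-1 ^+ (i - j) *: ('X + 1) ^+ (i - j))) *
    (1 + 'X) ^+ l = ((-1) ^+ j / 2 ^+ i) *: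
    ((1 - 'X) ^+ (p + j) * (1 + 'X) ^+ (q + (i - j) + l)) :> {poly R}.
  rewrite (_ : 'X - 1 = (-1) *: (1 - 'X)); last by rewrite scaleN1r opprB.
  have E2 : 2^-1 ^+ i = 2^-1 ^+ j * 2^-1 ^+ (i - j) :> R by rewrite -exprD subnKC.
  rewrite exprZn ['X + 1]addrC -exprVn E2 !exprD.
  by rewrite -!mul_polyC !polyCM; ring.
rewrite gmeanZ -/(bmoment _ _) bmoment_rising.
have -> : (p + j + (q + (i - j) + l) = p + q + i + l)%N by lia.
have e1 := @gbinom_rising R (c - 1 + p%:R) i (i - j) ltac:(lia).
have e2 := @gbinom_rising R (c - 1 + q%:R) i j ji.
have x1 (m : nat) : c - 1 + m%:R + 1 = c + m%:R by ring.
rewrite subKn// !x1 in e1 e2.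
rewrite (risingD c p j) -addnA (risingD c q) (risingD (c + q%:R)).
have fj : (j`!%:R : R) != 0 by rewrite pnatr_eq0 -lt0n fact_gt0.
have fij : ((i - j)`!%:R : R) != 0 by rewrite pnatr_eq0 -lt0n fact_gt0.
have bj : ('C(i, j)%:R : R) != 0 by rewrite pnatr_eq0 -lt0n bin_gt0.
rewrite /K -(bin_fact ji) !natrM -e1 -e2.
have r1 : rising (c + p%:R) j != 0 by rewrite gt_eqF// rising_gt0// ltr_wpDr.
have r2 : rising (c + q%:R) (i - j) != 0 by rewrite gt_eqF// rising_gt0// ltr_wpDr.
have r0 : rising c (p + q + i + l) != 0 by rewrite gt_eqF// rising_gt0.
have t0 : (2 ^+ i : R) != 0 by rewrite expf_neq0.
move: fj fij bj r0 t0.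
move: (rising c (p + q + i + l)) (rising c p) (rising c q)
  (rising (c + p%:R) j) (rising (c + q%:R) (i - j)) (rising _ l) (gbinom _ _)
  (gbinom _ _) (j`!%:R) ((i - j)`!%:R) ('C(i, j)%:R) (bmoment _ _) (2 ^+ i)
  ((-1) ^+ j).
move=> u1 u2 u3 u4 u5 u6 u7 u8 u9 v1 v2 v3 v4 v5 h1 h2 h3 h4 h5.
by field; rewrite h1 h2 h3 h4 h5.
Qed.

Lemma jac_orth p q i (f : {poly R}) : (size f <= i)%N ->
  gmean d ((1 - 'X) ^+ p * (1 + 'X) ^+ q * jac p q i * f) = 0.
Proof.
move=> sf; rewrite -[f](comp_polyXaddC_K _ (-1)).
set g := f \Po _; have sg : (size g <= i)%N.
  by rewrite /g size_comp_poly2 ?size_XaddC.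
have -> : 'X - (-1)%:P = 1 + 'X :> {poly R} by rewrite polyCN opprK addrC.
rewrite comp_polyE mulr_sumr gmean_sum big1// => l _.
by rewrite -scalerAr gmeanZ jac_orth_basis ?mulr0// (leq_trans (ltn_ord l)).
Qed.

Lemma gbinom_pos p i j : (j <= i)%N -> 0 < gbinom (i%:R + (c - 1 + p%:R)) j.
Proof.
move=> ji; rewrite divr_gt0 ?ltr0n ?fact_gt0//.
apply: prodr_gt0 => l _; have : (l.+1 <= i)%N by rewrite (leq_trans _ ji).
rewrite -(ler_nat R) -natr1; have : 0 <= p%:R :> R by [].
by have := c_gt0; lra.
Qed.

(** To the right of 1 all terms of the defining sum are nonnegative; to the left of -1 they share
    the sign (-1)^i. This confines the zeros to ]-1, 1[. *)
Lemma jac_gt0 p q i t : 1 <= t -> 0 < (jac p q i).[t].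
Proof.
move=> t1; have gg j : (j <= i)%N ->
    0 < gbinom (i%:R + (c - 1 + p%:R)) (i - j) * gbinom (i%:R + (c - 1 + q%:R)) j.
  by move=> ji; apply: mulr_gt0; apply: gbinom_pos => //; lia.
have E (j : nat) : ((2^-1 *: ('X - 1)) ^+ j * (2^-1 *: ('X + 1)) ^+ (i - j)).[t]
   = (2^-1 * (t - 1)) ^+ j * (2^-1 * (t + 1)) ^+ (i - j).
  by rewrite !hornerE.
rewrite /jac /jacobi horner_sum big_ord_recl ltr_pwDl//.
  rewrite hornerZ E mulr_gt0 ?gg// expr0 mul1r exprn_gt0//; lra.
apply: sumr_ge0 => j _; rewrite hornerZ E.
have ji := ltn_ord (lift ord0 j).
by rewrite mulr_ge0 ?(ltW (gg _ _))// mulr_ge0// exprn_ge0//; lra.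
Qed.

Lemma jac_sign p q i t : t <= -1 -> 0 < (-1) ^+ i * (jac p q i).[t].
Proof.
move=> t1; rewrite /jac /jacobi horner_sum mulr_sumr.
have E (j : 'I_i.+1) : (-1) ^+ i * ((gbinom (i%:R + (c - 1 + p%:R)) (i - j) *
    gbinom (i%:R + (c - 1 + q%:R)) j) *: ((2^-1 *: ('X - 1)) ^+ j *
    (2^-1 *: ('X + 1)) ^+ (i - j))).[t] =
    (gbinom (i%:R + (c - 1 + p%:R)) (i - j) * gbinom (i%:R + (c - 1 + q%:R)) j) *
    ((2^-1 * (1 - t)) ^+ j * (2^-1 * (- 1 - t)) ^+ (i - j)).
  have ji : (j <= i)%N by rewrite -ltnS.
  have -> : (-1) ^+ i = (-1) ^+ j * (-1) ^+ (i - j) :> R by rewrite -exprD subnKC.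
  have -> : 2^-1 * (1 - t) = -1 * (2^-1 * (t - 1)) by ring.
  have -> : 2^-1 * (- 1 - t) = -1 * (2^-1 * (t + 1)) by ring.
  rewrite [(-1 * _) ^+ j]exprMn [(-1 * _) ^+ (i - j)]exprMn hornerZ hornerM.
  by rewrite !horner_exp !hornerZ !hornerD hornerN !hornerX hornerC; ring.
have gg j : (j <= i)%N ->
    0 < gbinom (i%:R + (c - 1 + p%:R)) (i - j) * gbinom (i%:R + (c - 1 + q%:R)) j.
  by move=> ji; apply: mulr_gt0; apply: gbinom_pos => //; lia.
under eq_bigr do rewrite E.
rewrite big_ord_recr ltr_wpDl//=.
  apply: sumr_ge0 => j _; have ji := ltn_ord j.
  rewrite mulr_ge0 ?(ltW (gg _ _))//; first lia.
  by rewrite mulr_ge0// exprn_ge0//; lra.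
by rewrite mulr_gt0 ?gg// subnn mulr1 exprn_gt0//; lra.
Qed.

Lemma size_lead_jac p q i : size (jac p q i) = i.+1 /\ 0 < lead_coef (jac p q i).
Proof.
have co : 0 < (jac p q i)`_i /\ (size (jac p q i) <= i.+1)%N.
  rewrite /jac /jacobi.
  have m (j : 'I_i.+1) : (2^-1 *: ('X - 1)) ^+ j * (2^-1 *: ('X + 1)) ^+ (i - j)
      = 2 ^- i *: (('X - 1%:P) ^+ j * ('X - (-1)%:P) ^+ (i - j)) :> {poly R}.
    have ji : (j <= i)%N by rewrite -ltnS.
    have E2 : 2^-1 ^+ i = 2^-1 ^+ j * 2^-1 ^+ (i - j) :> R by rewrite -exprD subnKC.
    rewrite !exprZn -exprVn E2 polyCN opprK -scalerAl -scalerAr scalerA.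
    by [].
  have mon (j : 'I_i.+1) : ('X - 1%:P) ^+ j * ('X - (-1)%:P) ^+ (i - j) \is @monic R.
    by rewrite monicMl monic_exp ?monicXsubC.
  have sz (j : 'I_i.+1) : size (('X - 1%:P) ^+ j * ('X - (-1)%:P) ^+ (i - j) : {poly R}) = i.+1.
    have ji : (j <= i)%N by rewrite -ltnS.
    rewrite size_monicM ?monic_exp ?monicXsubC ?expf_neq0 ?polyXsubC_eq0//.
    by rewrite !size_exp_XsubC addSn addnS/= subnKC.
  split.
    have pos (j : 'I_i.+1) : 0 < ((gbinom (i%:R + (c - 1 + p%:R)) (i - j) *
        gbinom (i%:R + (c - 1 + q%:R)) j) *: ((2^-1 *: ('X - 1)) ^+ j *
        (2^-1 *: ('X + 1)) ^+ (i - j)))`_i.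
      have ji : (j <= i)%N by rewrite -ltnS.
      rewrite coefZ; apply: mulr_gt0; first by apply: mulr_gt0; apply: gbinom_pos => //; lia.
      have /monicP := mon j; rewrite lead_coefE sz m coefZ => ->.
      by rewrite mulr1 invr_gt0 exprn_gt0.
    rewrite coef_sum big_ord_recl ltr_pwDl ?pos// sumr_ge0// => j _.
    by rewrite ltW ?pos.
  apply: (leq_trans (size_sum _ _ _)); apply/bigmax_leqP => j _.
  by rewrite m; apply: (leq_trans (size_scale_leq _ _)); apply: (leq_trans (size_scale_leq _ _)); rewrite sz.
have [c0 sl] := co.
have s : size (jac p q i) = i.+1.
  apply/eqP; rewrite eqn_leq sl ltnNge; apply/negP => /leq_sizeP/(_ i (leqnn i)) E.
  by rewrite E ltxx in c0.
by rewrite s lead_coefE s.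
Qed.
End JacobiMoments.

Lemma poly_pos_right (R : realType) (f : {poly R}) (u v : R) : u <= v ->
  0 < f.[v] -> (forall z, u <= z <= v -> ~~ root f z) -> 0 < f.[u].
Proof.
move=> uv fv nr; rewrite ltNge; apply/negP => fu.
have [|z zuv zr] := @poly_ivt R f u v uv; first by rewrite fu ltW.
by have := nr z zuv; rewrite zr.
Qed.

Section JacobiRoots.
Variables (R : realType) (d p q i : nat).
Hypothesis i_gt0 : (0 < i)%N.
Local Notation J := (jac R d p q i).

Lemma size_jac : size J = i.+1. Proof. by have [] := size_lead_jac R d p q i. Qed.

Lemma lead_jac_gt0 : 0 < lead_coef J.
Proof. by have [] := size_lead_jac R d p q i. Qed.

Lemma root_jac_bounds z : root J z -> -1 < z < 1.
Proof.
move=> /rootP zr; apply/andP; split; rewrite ltNge; apply/negP => z1.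
  by have := @jac_sign R d p q i z z1; rewrite zr mulr0 ltxx.
by have := @jac_gt0 R d p q i z z1; rewrite zr ltxx.
Qed.

(** Without a root the polynomial would be positive on [-1, 1], contradicting its orthogonality to
    1. *)
Lemma jac_has_root : exists z, root J z.
Proof.
have [//|nr] := pselect (exists z, root J z).
have pos t : -1 <= t <= 1 -> 0 < J.[t].
  move=> t1; apply: (@poly_pos_right R J t 1); [lra|exact: jac_gt0|].
  by move=> z _; apply/negP => zr; apply: nr; exists z.
have := @jac_orth R d p q i 1; rewrite size_poly1 => /(_ i_gt0).
rewrite mulr1 => E; have : 0 < gmean d ((1 - 'X) ^+ p * (1 + 'X) ^+ q * J).
  apply: gmean_gt0.
    rewrite !mulf_neq0// ?expf_neq0//.
    - by rewrite -opprB oppr_eq0 polyXsubC_eq0.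
    - by rewrite addrC -[1]opprK -polyC1 -polyCN polyXsubC_eq0.
    - by rewrite -size_poly_eq0 size_jac.
  move=> t t1; rewrite !hornerE/= mulr_ge0 ?(ltW (pos _ _))//.
  by rewrite mulr_ge0// exprn_ge0//; lra.
by rewrite E ltxx.
Qed.

Lemma has_sup_jac_roots : has_sup [set x | root J x].
Proof.
split; first by have [z zr] := jac_has_root; exists z.
by exists 1 => z /root_jac_bounds; lra.
Qed.

Lemma root_le_greatest_zero z : root J z -> z <= greatest_zero J.
Proof. by move=> zr; apply: sup_upper_bound => //; exact: has_sup_jac_roots. Qed.

Lemma root_greatest_zero : root J (greatest_zero J).
Proof.
have [ne ub] := has_sup_jac_roots.
have : closed [set x | root J x].
  rewrite (_ : [set x | root J x] = horner J @^-1` [set 0]); last first.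
    by apply/seteqP; split => x /= /rootP.
  apply: preimage_closed; last exact: closed_eq.
  by move=> x _; exact: continuous_horner.
by move=> /closure_id E; have := closure_sup ne ub; rewrite -E.
Qed.

Lemma greatest_zero_bounds : -1 < greatest_zero J < 1.
Proof. exact: root_jac_bounds root_greatest_zero. Qed.

Lemma jac_ge0_right s : greatest_zero J <= s -> 0 <= J.[s].
Proof.
move=> gs; have [s1|s1] := leP 1 s; first by rewrite ltW ?jac_gt0.
have [/rootP->//|nr] := boolP (root J s).
rewrite ltW//; apply: (@poly_pos_right R J s 1); [lra|exact: jac_gt0|].
move=> z zs; apply/negP => zr; have := root_le_greatest_zero zr => zg.
have zE : z = s by lra.
by rewrite zE in zr; rewrite zr in nr.
Qed.

End JacobiRoots.

Lemma lev_QE (R : realType) (d i : nat) (eps : bool) :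
  lev_Q R d.+2 eps i = jac R d 1 eps i.
Proof.
rewrite /lev_Q /jac; congr (jacobi _ _ _).
  by rewrite -(natr1 d.+1); field.
by rewrite -(natr1 d.+1) -(natr1 d); field.
Qed.

Lemma lev_tE (R : realType) (d i : nat) (a b : bool) : (0 < i)%N ->
  lev_t R d.+2 a b i = greatest_zero (jac R d a b i).
Proof.
rewrite /lev_t lt0n => /negbTE ->; congr greatest_zero.
rewrite /jac; congr (jacobi _ _ _).
  by rewrite -(natr1 d.+1) -(natr1 d); field.
by rewrite -(natr1 d.+1) -(natr1 d); field.
Qed.

(** * Orthogonal polynomials of a discrete measure *)

Section DiscreteMeasure.
Variable R : realType.
Implicit Types (f q : {poly R}) (x w : nat -> R) (N : nat).

Definition dsum N w x f : R := \sum_(j < N) w j * f.[x j].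

Lemma dsumD N w x f q : dsum N w x (f + q) = dsum N w x f + dsum N w x q.
Proof. by rewrite /dsum -big_split; apply: eq_bigr => j _; rewrite hornerD mulrDr. Qed.

Lemma dsumZ N w x c f : dsum N w x (c *: f) = c * dsum N w x f.
Proof. by rewrite /dsum mulr_sumr; apply: eq_bigr => j _; rewrite hornerZ mulrCA. Qed.

Lemma dsum_sum N w x (I : Type) (r : seq I) (F : I -> {poly R}) :
  dsum N w x (\sum_(l <- r) F l) = \sum_(l <- r) dsum N w x (F l).
Proof.
rewrite /dsum exchange_big/=; apply: eq_bigr => j _.
by rewrite horner_sum mulr_sumr.
Qed.

Definition orth_system N w x (q : nat -> {poly R}) : Prop :=
  [/\ forall l, (l < N)%N -> size (q l) = l.+1 /\ 0 < lead_coef (q l)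
    & forall l e, (e < l)%N -> (l < N)%N -> dsum N w x (q l * q e) = 0].

Definition pos_measure N w x : Prop :=
  (forall j, (j < N)%N -> 0 < w j) /\
  (forall i j, (i < j)%N -> (j < N)%N -> x i < x j).

Lemma poly_eq0_nodes N x f : (forall i j, (i < j)%N -> (j < N)%N -> x i < x j) ->
  (size f <= N)%N -> (forall j, (j < N)%N -> f.[x j] = 0) -> f = 0.
Proof.
move=> xi sf fx; apply: (@roots_geq_poly_eq0 _ _ [seq x j | j <- iota 0 N]).
- by apply/allP => _ /mapP[j + ->]; rewrite mem_iota => /andP[_ jN]; apply/rootP/fx.
- rewrite map_inj_in_uniq ?iota_uniq// => i j; rewrite !mem_iota !add0n => /andP[_ iN] /andP[_ jN] E.
  have [ij|ij|//] := ltngtP i j.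
    by have := xi _ _ ij jN; rewrite E ltxx.
  by have := xi _ _ ij iN; rewrite E ltxx.
- by rewrite size_map size_iota.
Qed.

Lemma dsum_sqr_gt0 N w x f : pos_measure N w x -> (size f <= N)%N -> f != 0 ->
  0 < dsum N w x (f ^+ 2).
Proof.
move=> [w0 xi] sf f0; rewrite lt_neqAle; apply/andP; split; last first.
  by apply: sumr_ge0 => j _; rewrite hornerE mulr_ge0 ?sqr_ge0// ltW ?w0.
apply: contra f0 => /eqP/esym S0; apply/eqP/(poly_eq0_nodes xi sf) => j jN.
have ge0 (l : 'I_N) : true -> 0 <= w l * (f ^+ 2).[x l].
  by move=> _; rewrite hornerE mulr_ge0 ?sqr_ge0// ltW ?w0.
have /eqP := psumr_eq0P ge0 S0 (i := Ordinal jN) isT.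
by rewrite hornerE mulf_eq0 gt_eqF ?w0//= sqrf_eq0 => /eqP.
Qed.

Section System.
Variables (N : nat) (w x : nat -> R) (q : nat -> {poly R}).
Hypotheses (wx : pos_measure N w x) (qs : orth_system N w x q).
Local Notation S := (dsum N w x).

Lemma orth_norm_gt0 l : (l < N)%N -> 0 < S (q l ^+ 2).
Proof.
move=> lN; have [/(_ l lN)[sl _] _] := qs.
by apply: dsum_sqr_gt0; rewrite ?sl// -size_poly_eq0 sl.
Qed.

Lemma orth_sym l e : (l < N)%N -> (e < N)%N -> l != e -> S (q l * q e) = 0.
Proof.
move=> lN eN; rewrite neq_ltn => /orP[le|el].
  by rewrite mulrC; have [_ ->] := qs.
by have [_ ->] := qs.
Qed.

Lemma orth_expand n f : (n <= N)%N -> (size f <= n)%N ->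
  f = \sum_(l < n) (S (f * q l) / S (q l ^+ 2)) *: q l.
Proof.
elim: n f => [|n IH] f nN sf.
  by rewrite big_ord0; apply/eqP; rewrite -size_poly_eq0 -leqn0.
have [/(_ n nN)[sn ln] _] := qs.
pose c := f`_n / lead_coef (q n).
have lE : lead_coef (q n) = (q n)`_n by rewrite lead_coefE sn.
have sq : (size (f - c *: q n)%R <= n)%N.
  apply/leq_sizeP => j; rewrite leq_eqVlt => /orP[/eqP <-|nj].
    by rewrite coefB coefZ -lE divfK ?subrr// gt_eqF.
  by rewrite coefB coefZ !nth_default ?mulr0 ?subr0// ?sn// (leq_trans sf).
have E (l : 'I_n) : S (f * q l) = S ((f - c *: q n) * q l).
  rewrite mulrBl dsumD -scaleN1r dsumZ -scalerAl dsumZ.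
  by rewrite orth_sym ?mulr0 ?addr0 ?(ltn_trans (ltn_ord l))// gtn_eqF.
have En : S (f * q n) = c * S (q n ^+ 2).
  rewrite -[f in LHS](subrK (c *: q n)) mulrDl dsumD -scalerAl dsumZ -expr2.
  rewrite {1}(IH _ (ltnW nN) sq) mulr_suml.
  rewrite dsum_sum big1 ?add0r// => l _; rewrite -scalerAl dsumZ.
  by rewrite (@orth_sym l n) ?mulr0// ?ltn_eqF// (ltn_trans (ltn_ord l)).
rewrite big_ord_recr/= En mulfK; last by rewrite gt_eqF// orth_norm_gt0.
rewrite -[LHS](subrK (c *: q n)) {1}(IH _ (ltnW nN) sq); congr (_ + _).
by apply: eq_bigr => l _; rewrite E.
Qed.

(** Otherwise q_l = g (X - c) with c at or beyond the last node, and orthogonality of q_l to g is a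
    vanishing sum of terms of one sign. So g vanishes at every node except possibly the last one,
    where c may sit; these are still too many zeros for its degree l - 1. *)
Lemma orth_at_last_gt0 l : (l < N)%N -> 0 < (q l).[x N.-1].
Proof.
move=> lN; have [/(_ l lN)[sl ll] orth] := qs; have [w0 xi] := wx.
rewrite ltNge; apply/negP => ql.
have [c xc rc] : exists2 c, x N.-1 <= c & root (q l) c.
  have [M Mq] := polyrcf.poly_pinfty_gt_lc ll.
  pose b := Num.max M (x N.-1); have xb : x N.-1 <= b by rewrite le_max lexx orbT.
  have [|z zx zr] := @poly_ivt R (q l) (x N.-1) b xb.
    by rewrite ql (le_trans (ltW ll))// Mq// le_max lexx.
  by exists z => //; have /andP[] := zx.
have [g gE] : exists g, q l = g * ('X - c%:P) by apply/factor_theorem.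
have q0 : q l != 0 by rewrite -size_poly_eq0 sl.
have g0 : g != 0 by apply: contra_neq q0 => g0; rewrite gE g0 mul0r.
have sg : size g = l.
  by move: sl; rewrite gE size_Mmonic ?monicXsubC// size_XsubC addn2 => -[].
have : S (q l * g) = 0.
  rewrite (orth_expand (ltnW lN) (eq_leq sg)) mulr_sumr dsum_sum big1// => e _.
  by rewrite -scalerAr dsumZ (orth l e) ?mulr0.
have SN : S (q l * g) = \sum_(j < N) w j * ((x j - c) * g.[x j] ^+ 2).
  by apply: eq_bigr => j _; rewrite gE !hornerM hornerXsubC; ring.
have le0 j : (j < N)%N -> x j <= c.
  move=> jN; rewrite (le_trans _ xc)//; have [->//|jl] := eqVneq j N.-1.
  by apply: ltW; apply: xi; lia.
rewrite SN => S0.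
have ge0 (j : 'I_N) : true -> 0 <= - (w j * ((x j - c) * g.[x j] ^+ 2)).
  move=> _; rewrite -mulrN -mulNr mulr_ge0 ?(ltW (w0 _ _))// mulr_ge0 ?sqr_ge0//.
  by rewrite opprB subr_ge0 le0.
have gx j : (j < N.-1)%N -> g.[x j] = 0.
  move=> jN1; have jN : (j < N)%N by lia.
  have S0' : \sum_(j < N) - (w j * ((x j - c) * g.[x j] ^+ 2)) = 0.
    by rewrite sumrN S0 oppr0.
  have /eqP := psumr_eq0P ge0 S0' (i := Ordinal jN) isT.
  rewrite oppr_eq0 mulf_eq0 gt_eqF ?w0//= mulf_eq0 sqrf_eq0 subr_eq0.
  rewrite lt_eqF ?orFb; last by apply: (lt_le_trans _ xc); apply: xi; lia.
  by move=> /eqP.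
move/eqP: g0; apply; apply: (@poly_eq0_nodes N.-1 x) => //.
  by move=> i j ij jN; apply: xi; lia.
by rewrite sg; lia.
Qed.

End System.

(* One removes the largest node X: the kernel polynomials at X are orthogonal
   for the reweighted measure on the remaining nodes, and they are nonnegative
   combinations of the original system because it is positive at X. *)
Lemma node_products_in_cone N w x (q : nat -> {poly R}) (P : {poly R} -> Prop) :
  (forall f g, P f -> P g -> P (f + g)) ->
  (forall c f, 0 <= c -> P f -> P (c *: f)) ->
  pos_measure N w x -> orth_system N w x q ->
  (forall l, (l < N)%N -> P (q l)) ->
  forall i, (i < N)%N -> P (\prod_(j < i) ('X - (x j)%:P)).
Proof.
move=> PD PZ.
have Psum n (F : nat -> {poly R}) : (forall l, (l < n.+1)%N -> P (F l)) ->
    P (\sum_(l < n.+1) F l).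
  elim: n => [|n IH] FP; first by rewrite big_ord1; exact: FP.
  by rewrite big_ord_recr/=; apply: PD; [apply: IH => l ln; apply: FP; lia|exact: FP].
elim: N w q => [//|N IH] w q wx qs Pq i.
have [w0 xi] := wx; have [qsz qo] := qs.
have xl l : (l < N.+1)%N -> 0 < (q l).[x N] by exact: orth_at_last_gt0 wx qs _.
have n0 l : (l < N.+1)%N -> 0 < dsum N.+1 w x (q l ^+ 2) by exact: orth_norm_gt0 wx qs _.
rewrite ltnS leq_eqVlt => /orP[/eqP ->|iN].
  set f := \prod_(j < N) _.
  have sf : size f = N.+1 by rewrite /f -big_enum size_prod_XsubC size_enum_ord.
  have fN : 0 < f.[x N].
    by rewrite horner_prod prodr_gt0// => j _; rewrite !hornerE subr_gt0 xi.
  rewrite (orth_expand wx qs (leqnn _) (eq_leq sf)).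
  apply: (Psum N (fun l => (dsum N.+1 w x (f * q l) / dsum N.+1 w x (q l ^+ 2)) *: q l)).
  move=> l lN; apply: PZ; last exact: Pq.
  rewrite divr_ge0 ?(ltW (n0 _ lN))//.
  (* [f] vanishes at all nodes but the last, which alone determines the sign of the coefficient. *)
  rewrite /dsum big_ord_recr/= big1 => [|j _].
    by rewrite add0r hornerM !mulr_ge0 ?ltW ?w0 ?xl.
  by rewrite hornerM horner_prod (bigD1 j)//= hornerXsubC subrr !mul0r mulr0.
pose q' l := \sum_(e < l.+1) ((q e).[x N] / dsum N.+1 w x (q e ^+ 2)) *: q e.
have q's l : (l < N)%N -> size (q' l) = l.+1 /\ 0 < lead_coef (q' l).
  move=> lN; have [sl ll] := qsz l ltac:(lia).
  have lc : 0 < (q l).[x N] / dsum N.+1 w x (q l ^+ 2).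
    by rewrite divr_gt0 ?xl ?n0//; lia.
  have sr : (size (\sum_(e < l) ((q e).[x N] / dsum N.+1 w x (q e ^+ 2)) *: q e)%R
      < size (((q l).[x N] / dsum N.+1 w x (q l ^+ 2)) *: q l)%R)%N.
    rewrite size_scale ?gt_eqF// sl ltnS (leq_trans (size_sum _ _ _))//.
    apply/bigmax_leqP => e _; rewrite (leq_trans (size_scale_leq _ _))//.
    by have [->] := qsz e ltac:(have := ltn_ord e; lia).
  rewrite /q' big_ord_recr/= addrC size_polyDl// lead_coefDl// lead_coefZ.
  by rewrite size_scale ?gt_eqF// mulr_gt0.
apply: (IH (fun j => w j * (x N - x j)) q') => //.
- split=> [j jN|j l jl lN]; last by apply: xi => //; lia.
  by rewrite mulr_gt0 ?w0 ?subr_gt0 ?xi//; lia.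
- split=> [//|l e el lN].
  (* The new weight factor is moved into the polynomial; the sum may then include the last node,
     where [u] vanishes. *)
  pose u := ((x N)%:P - 'X) * q' e.
  have su : (size u <= l.+1)%N.
    rewrite (leq_trans (size_polyMleq _ _))// (q's e _).1; last lia.
    by rewrite -opprB size_polyN size_XsubC; lia.
  have -> : dsum N (fun j => w j * (x N - x j)) x (q' l * q' e) = dsum N.+1 w x (q' l * u).
    have uE t : u.[t] = (x N - t) * (q' e).[t].
      by rewrite /u hornerM hornerD hornerN hornerX hornerC.
    rewrite /dsum big_ord_recr/= [in X in _ + X]hornerM uE subrr mul0r !mulr0 addr0.
    by apply: eq_bigr => j _; rewrite hornerM [in RHS]hornerM uE; ring.
  (* The kernel polynomial [q' l] reproduces evaluation at [x N] on polynomials of degree at most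
     l. *)
  transitivity (u.[x N]); last by rewrite /u hornerM hornerD hornerN hornerX hornerC subrr mul0r.
  rewrite [in RHS](orth_expand wx qs (n := l.+1) _ su) ?horner_sum; last lia.
  rewrite /q' mulr_suml dsum_sum; apply: eq_bigr => m _.
  by rewrite -scalerAl dsumZ hornerZ [q m * u]mulrC; ring.
- move=> l lN; apply: (Psum l (fun e => ((q e).[x N] / dsum N.+1 w x (q e ^+ 2)) *: q e)) => e el.
  apply: PZ; last by apply: Pq; lia.
  by rewrite divr_ge0// ltW ?xl ?n0//; lia.
Qed.
End DiscreteMeasure.

(** * Levenshtein nodes *)

(* [A], [rho]: the nodes and weights, as functions on nat; [iL] is 1 / L. *)
Record lev_data (R : realType) (d k : nat) (eps : bool) (s iL : R)
    (A rho : nat -> R) : Prop := LevData {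
  ld_k : (0 < k)%N;
  ld_incr : forall i j, (i < j)%N -> (j < k + eps)%N -> A i < A j;
  ld_last : A (k.-1 + eps)%N = s;
  ld_m1 : eps -> exists2 j, (j < k + eps)%N & A j = -1;
  ld_bnd : -1 <= s < 1;
  ld_lower : (0 < k.-1 + eps)%N -> greatest_zero (jac R d 1 (~~ eps) (k.-1 + eps)) <= s;
  ld_upper : s <= greatest_zero (jac R d 1 eps k);
  ld_root : forall i, (i < k + eps)%N ->
    root (('X + 1) ^+ eps * ((jac R d 1 eps k.-1).[s] *: jac R d 1 eps k
      - (jac R d 1 eps k).[s] *: jac R d 1 eps k.-1)) (A i);
  ld_quad : forall f : {poly R}, (size f <= 2 * k + eps)%N ->
    gmean d f = f.[1] * iL + \sum_(i < k + eps) rho i * f.[A i] }.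

Lemma size_sub_lead (R : idomainType) (f g : {poly R}) n : size f = n.+1 ->
  size g = n.+1 -> lead_coef f = lead_coef g -> (size (f - g)%R <= n)%N.
Proof.
move=> sf sg; rewrite !lead_coefE sf sg => E; apply/leq_sizeP => j.
rewrite leq_eqVlt => /orP[/eqP <-|nj]; rewrite coefB ?E ?subrr//.
by rewrite !nth_default ?subrr// ?sf ?sg.
Qed.

Section LevenshteinNodes.
Variables (R : realType) (d k : nat) (eps : bool) (s iL : R) (A rho : nat -> R).
Hypothesis ld : lev_data d k eps s iL A rho.
Local Notation L := (k.-1 + eps)%N.

Let k0 : (0 < k)%N. Proof. by case: ld. Qed.
Let NE : (k + eps = L.+1)%N. Proof. lia. Qed.
Let s1 : s < 1. Proof. by have /andP[] := ld_bnd ld. Qed.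

Let A_le_s i : (i < k + eps)%N -> A i <= s.
Proof.
rewrite NE ltnS leq_eqVlt => /orP[/eqP ->|iL']; first by rewrite (ld_last ld).
by rewrite -(ld_last ld) ltW// (ld_incr ld)// NE.
Qed.

Let A_lt1 i : (i < k + eps)%N -> A i < 1.
Proof. by move=> iN; apply: le_lt_trans (A_le_s iN) s1. Qed.

Let A_inj i j : (i < k + eps)%N -> (j < k + eps)%N -> A i = A j -> i = j.
Proof.
move=> iN jN E; have [ij|ij|//] := ltngtP i j.
  by have := ld_incr ld ij jN; rewrite E ltxx.
by have := ld_incr ld ij iN; rewrite E ltxx.
Qed.

Let quad1 i (f : {poly R}) : (i < k + eps)%N -> (size f <= 2 * k + eps)%N ->
  f.[1] = 0 -> (forall j, (j < k + eps)%N -> j != i -> f.[A j] = 0) ->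
  gmean d f = rho i * f.[A i].
Proof.
move=> iN sf f1 fA; rewrite (ld_quad ld sf) f1 mul0r add0r.
rewrite (bigD1 (Ordinal iN))//= big1 ?addr0// => j ji.
by rewrite fA ?mulr0.
Qed.

Let jac_weight_neq0 (p q : nat) : (1 - 'X) ^+ p * (1 + 'X) ^+ q != 0 :> {poly R}.
Proof.
rewrite mulf_neq0// expf_neq0//.
  by rewrite -opprB oppr_eq0 polyXsubC_eq0.
by rewrite addrC -[1]opprK -polyC1 -polyCN polyXsubC_eq0.
Qed.

Let size_jac_weight (p q : nat) : size ((1 - 'X) ^+ p * (1 + 'X) ^+ q : {poly R}) = (p + q).+1.
Proof.
have -> : (1 - 'X) ^+ p * (1 + 'X) ^+ q =
    (-1) ^+ p *: (('X - 1%:P) ^+ p * ('X - (-1)%:P) ^+ q) :> {poly R}.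
  rewrite -[1 - 'X]opprB -scaleN1r exprZn -scalerAl; congr (_ *: (_ * _ ^+ q)).
  by rewrite polyCN opprK addrC.
rewrite size_scale ?expf_neq0 ?oppr_eq0 ?oner_eq0//.
rewrite size_monicM ?monic_exp ?monicXsubC ?expf_neq0 ?polyXsubC_eq0//.
by rewrite !size_exp_XsubC addSn addnS.
Qed.

(** The quadrature is tested on (1 - X)(1 + X)^eps G^2, with G vanishing at the other nodes apart
    from -1; its degree is exactly m. The factor in [A i] stays because nodes below -1 are not yet
    excluded. *)
Let rho_sign i : (i < k + eps)%N -> (eps -> A i != -1) ->
  0 < rho i * (1 + A i) ^+ eps.
Proof.
move=> iN Ai; have [j0 j0N j0E] : exists2 j0, eps -> (j0 < k + eps)%N & eps -> A j0 = -1.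
  have [e|e] : eps \/ ~~ eps by apply/orP; exact: orbN.
    by have [j jN jE] := ld_m1 ld e; exists j.
  by exists 0%N => e'; rewrite e' in e.
have ij0 : eps -> i != j0 by move=> e; apply: contraNneq (Ai e) => ->; rewrite j0E.
pose o := if eps then rem j0 (rem i (iota 0 (k + eps))) else rem i (iota 0 (k + eps)).
have im : i \in iota 0 (k + eps) by rewrite mem_iota add0n.
have oP j : j \in o = [&& (j < k + eps)%N, j != i & ~~ (eps && (j == j0))].
  rewrite /o; have u := iota_uniq 0 (k + eps); case: ifP => e.
    rewrite (mem_rem_uniq _ (rem_uniq _ u)) inE (mem_rem_uniq _ u) inE mem_iota.
    by rewrite add0n /= e /=; case: (j < _)%N (j == i) (j == j0) => [] [] [].
  by rewrite (mem_rem_uniq _ u) inE mem_iota add0n /= e /= andbT andbC.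
have so : size o = k.-1.
  rewrite /o; have u := iota_uniq 0 (k + eps); case: ifP => e.
    rewrite size_rem; last first.
      by rewrite (mem_rem_uniq _ u) inE mem_iota eq_sym ij0//= add0n j0N.
    by rewrite size_rem// size_iota e; lia.
  by rewrite size_rem// size_iota e; lia.
pose G : {poly R} := \prod_(j <- o) ('X - (A j)%:P).
have sG : size G = k by rewrite size_prod_XsubC so prednK.
have G0 : G != 0 by rewrite -size_poly_eq0 sG -lt0n.
have Gi : G.[A i] != 0.
  rewrite horner_prod prodf_seq_neq0; apply/allP => j; rewrite oP => /and3P[jN ji _] /=.
  by rewrite hornerXsubC subr_eq0; apply: contraNneq ji => /A_inj ->.
pose F := (1 - 'X) ^+ 1 * (1 + 'X) ^+ eps * G ^+ 2.
have FE t : F.[t] = (1 - t) * (1 + t) ^+ eps * G.[t] ^+ 2.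
  rewrite /F !hornerM !horner_exp !(hornerD, hornerN, hornerX, hornerC).
  by rewrite expr1 expr2.
have F0 : 0 < gmean d F.
  apply: gmean_gt0; first by rewrite /F mulf_neq0 ?jac_weight_neq0// expf_neq0.
  move=> t t1; rewrite FE; apply: mulr_ge0; last exact: sqr_ge0.
  by apply: mulr_ge0; last apply: exprn_ge0; lra.
move: F0; rewrite (quad1 iN).
- rewrite FE -!mulrA mulrCA pmulr_rgt0 ?subr_gt0 ?A_lt1// mulrA pmulr_lgt0//.
  by rewrite lt_neqAle sqr_ge0 eq_sym sqrf_eq0 Gi.
- rewrite /F size_mul ?jac_weight_neq0 ?expf_neq0// size_jac_weight expr2 size_mul// sG.
  by have := k0; lia.
- by rewrite FE subrr !mul0r.
move=> j jN ji; rewrite FE.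
have [/andP[e /eqP jj]|n] := boolP (eps && (j == j0)).
  by rewrite jj j0E// subrr e expr1 mulr0 mul0r.
rewrite (_ : G.[A j] = 0) ?expr0n ?mulr0//.
have jo : j \in o by rewrite oP jN ji.
by rewrite horner_prod (big_rem j)//= hornerXsubC subrr mul0r.
Qed.

Let prod_at_last_gt0 m n : (n <= L)%N ->
  0 < (\prod_(m <= j < n) ('X - (A j)%:P)).[s].
Proof.
move=> nL; rewrite horner_prod big_nat_cond prodr_gt0// => j /andP[/andP[_ jn] _].
by rewrite hornerXsubC subr_gt0 -(ld_last ld) (ld_incr ld)//; lia.
Qed.

(** If the first node were below -1, test the quadrature on a polynomial that vanishes at 1 and at
    the intermediate nodes and has mean zero by Jacobi orthogonality. The term of the last node is
    nonnegative because s is at least the lower end of I_m, and a count of signs makes that of the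
    first node positive: a contradiction. *)
Lemma node_ge_m1 : -1 <= A 0.
Proof.
have [L0|L0] := posnP L.
  by have := ld_last ld; rewrite L0 => ->; have /andP[] := ld_bnd ld.
rewrite leNgt; apply/negP => A0.
have NE0 : (0 < k + eps)%N by lia.
have r0 : 0 < rho 0 * (1 + A 0) ^+ eps by apply: rho_sign => // _; rewrite lt_eqF.
set J := jac R d 1 (~~ eps) L.
have gz := greatest_zero_bounds R d 1 (~~ eps) L0.
have sJ : 0 <= J.[s] by apply: (jac_ge0_right L0); exact: (ld_lower ld L0).
have sm1 : -1 < s by have := ld_lower ld L0; lra.
have rL : 0 < rho L.
  have : 0 < rho L * (1 + A L) ^+ eps.
    by apply: rho_sign; [rewrite NE|rewrite (ld_last ld) gt_eqF].
  by rewrite (ld_last ld) pmulr_lgt0// exprn_gt0//; lra.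
pose q : {poly R} := \prod_(1 <= j < L) ('X - (A j)%:P).
have sq : size q = L.
  by rewrite size_prod_XsubC size_iota subn1 prednK.
(* The exponent of 1 + X is opposite to that of Q_k, as for the lower end of I_m; the degree is
   exactly m. *)
pose F := (1 - 'X) ^+ 1 * (1 + 'X) ^+ (~~ eps) * J * q.
have FE t : F.[t] = (1 - t) * (1 + t) ^+ (~~ eps) * J.[t] * q.[t].
  by rewrite /F !hornerM !horner_exp !(hornerD, hornerN, hornerX, hornerC) expr1.
have sF : (size F <= 2 * k + eps)%N.
  have q0 : q != 0 by rewrite -size_poly_eq0 sq -lt0n.
  have J0 : J != 0 by rewrite -size_poly_eq0 size_jac.
  have W0 := jac_weight_neq0 1 (~~ eps).
  rewrite /F size_mul ?(mulf_neq0 W0 J0)// (size_mul W0 J0).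
  rewrite size_jac_weight sq size_jac.
  by clear -k0; case: k k0 => [//|m] _; case: eps => /=; lia.
have := ld_quad ld sF; rewrite FE subrr !mul0r add0r.
rewrite jac_orth ?sq// (_ : (k + eps)%N = L.-1.+2); last by rewrite NE prednK.
rewrite big_ord_recl big_ord_recr/= big1 => [|j _]; last first.
  have jq : q.[A j.+1] = 0.
    rewrite horner_prod (big_rem j.+1)/=; last first.
      by rewrite mem_index_iota /= -ltn_predRL ltn_ord.
    by rewrite hornerXsubC subrr mul0r.
  by rewrite FE jq !mulr0.
rewrite add0r /bump leq0n add1n prednK// (ld_last ld) => E.
have Fs : 0 <= rho L * F.[s].
  rewrite mulr_ge0 ?(ltW rL)// FE mulr_ge0 ?(ltW (prod_at_last_gt0 _ _))//.
  apply: mulr_ge0 => //; apply: mulr_ge0; first by rewrite subr_ge0 ltW.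
  by apply: exprn_ge0; rewrite -lerBlDl sub0r ltW.
have Jq : J.[A 0] * q.[A 0] < 0.
  have j0 : 0 < (-1) ^+ L * J.[A 0] by apply: jac_sign; exact: ltW.
  have q0 : 0 < (-1) ^+ L.-1 * q.[A 0].
    have <- : \prod_(1 <= j < L) (A j - A 0) = (-1) ^+ L.-1 * q.[A 0].
      have -> : (-1) ^+ L.-1 = \prod_(1 <= j < L) (-1 : R).
        by rewrite prodr_const_nat subn1.
      rewrite horner_prod -big_split/=.
      by apply: eq_bigr => j _; rewrite hornerXsubC mulN1r opprB.
    rewrite big_nat_cond prodr_gt0// => j /andP[/andP[j1 jL] _].
    by rewrite subr_gt0 (ld_incr ld)// NE ltnW.
  have := mulr_gt0 j0 q0; rewrite mulrACA -exprD.
  have -> : (L + L.-1 = (L.-1 + L.-1).+1)%N by rewrite -addSn prednK.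
  by rewrite exprS -signr_odd oddD addbb expr0 mulr1 mulN1r oppr_gt0.
have u0 : rho 0 * (1 + A 0) ^+ (~~ eps) < 0.
  move: r0; case: (eps) => /=; rewrite ?expr0 ?expr1 ?mulr1.
    by rewrite nmulr_lgt0//; lra.
  by move=> r0; rewrite pmulr_rlt0//; lra.
have : 0 < rho 0 * F.[A 0].
  rewrite FE.
  have -> : rho 0 * ((1 - A 0) * (1 + A 0) ^+ (~~ eps) * J.[A 0] * q.[A 0]) =
    (1 - A 0) * ((rho 0 * (1 + A 0) ^+ (~~ eps)) * (J.[A 0] * q.[A 0])) by ring.
  by rewrite mulr_gt0 ?nmulr_rgt0//; lra.
lra.
Qed.

(** The nodes other than -1; [lev_w] absorbs the factors (1 - X)(1 + X)^eps of the Jacobi weight. *)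
Definition lev_beta (j : nat) : R := A (j + eps).
Definition lev_w (j : nat) : R :=
  rho (j + eps) * (1 - lev_beta j) * (1 + lev_beta j) ^+ eps.
Local Notation beta := lev_beta.
Local Notation w := lev_w.

Lemma first_node_m1 : eps -> A 0 = -1.
Proof.
move=> e; have [[|j] // jN jE] := ld_m1 ld e.
have := ld_incr ld (ltn0Sn j) jN; have := node_ge_m1; rewrite jE; lra.
Qed.

Lemma lev_pos_measure : pos_measure k w beta.
Proof.
split=> [j jk|i j ij jk]; last by apply: (ld_incr ld); lia.
rewrite /w /beta mulrAC mulr_gt0 ?subr_gt0 ?A_lt1//; last lia.
apply: rho_sign; first lia.
move=> e; rewrite gt_eqF// -(first_node_m1 e) (ld_incr ld)//; lia.
Qed.

Lemma lev_quad (f : {poly R}) : (size f <= 2 * k - 1)%N ->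
  gmean d ((1 - 'X) ^+ 1 * (1 + 'X) ^+ eps * f) = dsum k w beta f.
Proof.
move=> sf; set F := _ * f.
have FE t : F.[t] = (1 - t) * (1 + t) ^+ eps * f.[t].
  by rewrite /F !hornerM !horner_exp !(hornerD, hornerN, hornerX, hornerC) expr1.
have sF : (size F <= 2 * k + eps)%N.
  by rewrite (leq_trans (size_polyMleq _ _))// size_jac_weight; have := k0; lia.
rewrite (ld_quad ld sF) FE subrr !mul0r add0r /dsum addnC big_split_ord/=.
rewrite big1 ?add0r => [|j _].
  by apply: eq_bigr => j _; rewrite FE /w /beta [(eps + j)%N]addnC; ring.
have ltb (b : bool) (i : nat) : (i < b)%N -> b /\ i = 0%N by case: b i => [] [].
have [e j0] := ltb _ _ (ltn_ord j).
by rewrite FE j0 first_node_m1// e subrr expr1 mulr0 mul0r mulr0.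
Qed.

(** Products of two different members have degree below 2k - 1, where the discrete sum agrees with
    the mean. *)
Lemma lev_orth_system : orth_system k w beta (jac R d 1 eps).
Proof.
split=> [l _|l e el lk]; first exact: size_lead_jac.
rewrite -lev_quad; last by rewrite (leq_trans (size_polyMleq _ _))// !size_jac; lia.
by rewrite mulrA jac_orth// size_jac.
Qed.

Let beta_last : beta k.-1 = s. Proof. exact: ld_last ld. Qed.

Lemma jac_pred_gt0 : 0 < (jac R d 1 eps k.-1).[s].
Proof.
rewrite -beta_last; apply: (orth_at_last_gt0 lev_pos_measure lev_orth_system).
by rewrite prednK.
Qed.

(** The Levenshtein polynomial is [('X + 1) ^+ eps * lev_core * lev_core'], as shown in
    [lev_poly_T]. *)
Definition lev_core : {poly R} := \prod_(j < k) ('X - (beta j)%:P).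
Definition lev_core' : {poly R} := \prod_(j < k.-1) ('X - (beta j)%:P).

Lemma lev_coreE : lev_core = lev_core' * ('X - s%:P).
Proof.
rewrite /lev_core /lev_core' -(big_mkord xpredT (fun j => 'X - (beta j)%:P)).
by rewrite -{1}(prednK k0) big_nat_recr// beta_last big_mkord.
Qed.

Let size_core : size lev_core = k.+1.
Proof. by rewrite /lev_core -big_enum size_prod_XsubC size_enum_ord. Qed.

Let size_core' : size lev_core' = k.
Proof. by rewrite /lev_core' -big_enum size_prod_XsubC size_enum_ord prednK. Qed.

Let core_at j : (j < k)%N -> lev_core.[beta j] = 0.
Proof.
by move=> jk; rewrite horner_prod (bigD1 (Ordinal jk))//= hornerXsubC subrr mul0r.
Qed.

Let core'_at j : (j < k.-1)%N -> lev_core'.[beta j] = 0.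
Proof.
by move=> jk; rewrite horner_prod (bigD1 (Ordinal jk))//= hornerXsubC subrr mul0r.
Qed.

Let core'_last : 0 < lev_core'.[s].
Proof.
rewrite horner_prod prodr_gt0// => j _.
rewrite hornerXsubC subr_gt0 -beta_last; apply: (lev_pos_measure).2; have := ltn_ord j; lia.
Qed.

Local Notation Q := (jac R d 1 eps).
Local Notation wmean f := (gmean d ((1 - 'X) ^+ 1 * (1 + 'X) ^+ eps * f)).

Lemma lev_core_jac : exists2 c, 0 < c &
  (Q k.-1).[s] *: Q k - (Q k).[s] *: Q k.-1 = c *: lev_core.
Proof.
set f := _ - _; have q1 := jac_pred_gt0.
have sz : (size ((Q k).[s] *: Q k.-1)%R < size ((Q k.-1).[s] *: Q k)%R)%N.
  rewrite (leq_ltn_trans (size_scale_leq _ _))//.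
  by rewrite (size_scale _ (lt0r_neq0 q1)) !size_jac prednK.
have sf : size f = k.+1.
  by rewrite /f size_polyDl ?size_polyN// (size_scale _ (lt0r_neq0 q1)) size_jac.
have lf : lead_coef f = (Q k.-1).[s] * lead_coef (Q k).
  by rewrite /f lead_coefDl ?size_polyN// lead_coefZ.
exists (lead_coef f); first by rewrite lf mulr_gt0// lead_jac_gt0.
have bE : lev_core = \prod_(z <- [seq beta j | j <- iota 0 k]) ('X - z%:P).
  by rewrite big_map /lev_core -(big_mkord xpredT (fun j => 'X - (beta j)%:P)) /index_iota subn0.
rewrite bE; apply: all_roots_prod_XsubC.
- by rewrite sf size_map size_iota.
- apply/allP => _ /mapP[j + ->]; rewrite mem_iota add0n => /andP[_ jk].
  have := ld_root ld (i := j + eps) ltac:(lia).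
  (* A root of the factor (X + 1)^eps would make the weight [w j] zero. *)
  rewrite rootM => /orP[|//]; rewrite /root horner_exp !hornerE expf_eq0 => /andP[e].
  have [w0 _] := lev_pos_measure; have := w0 _ jk; rewrite /w -/(beta j).
  rewrite /beta (addrC 1 (A _)) => + /eqP b0.
  by rewrite b0 expr0n eqn0Ngt e mulr0 ltxx.
- rewrite uniq_rootsE map_inj_in_uniq ?iota_uniq// => i j; rewrite !mem_iota !add0n.
  move=> /andP[_ ik] /andP[_ jk] /A_inj E.
  by have := E ltac:(lia) ltac:(lia); lia.
Qed.

(** Otherwise all nodes lie strictly left of the greatest zero z of Q_k = g (X - z). The discrete
    sum of g^2 (X - z) is then negative while its Jacobi mean is zero, which forces
    [lev_core * lev_core'] to have positive Jacobi mean; by [lev_core_jac] that mean is a negative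
    multiple of Q_k(s). *)
Lemma jac_le0 : (Q k).[s] <= 0.
Proof.
rewrite leNgt; apply/negP => q0; have zr := root_greatest_zero R d 1 eps k0.
move: (ld_upper ld) zr; set z := greatest_zero _ => sz zr.
have {}sz : s < z.
  rewrite lt_neqAle sz andbT; apply/negP => /eqP E.
  by move: q0; rewrite E (rootP zr) ltxx.
have [g gE] : exists g, Q k = g * ('X - z%:P) by apply/factor_theorem.
have Q0 : Q k != 0 by rewrite -size_poly_eq0 size_jac.
have g0 : g != 0 by apply: contra_neq Q0 => g0; rewrite gE g0 mul0r.
have sg : size g = k.
  have := size_jac R d 1 eps k.
  by rewrite gE size_Mmonic ?monicXsubC// size_XsubC addn2 => -[].
have [c c0 cE] := lev_core_jac.
have core0 : 0 < wmean (lev_core * lev_core').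
  have m0 : wmean (g * g * ('X - z%:P)) = 0.
    rewrite (_ : g * g * ('X - z%:P) = Q k * g); last by rewrite gE; ring.
    by rewrite mulrA jac_orth// sg.
  pose l := lead_coef g; have l0 : l != 0 by rewrite lead_coef_eq0.
  (* Both terms have degree 2k - 1, one too many for [lev_quad]; their leading terms cancel, and the
     second one vanishes at all nodes. *)
  pose f := g * g * ('X - z%:P) - l ^+ 2 *: (lev_core * lev_core').
  have sf : (size f <= 2 * k - 1)%N.
    have kE : (2 * k - 1 = (k.-1 + k.-1).+1)%N by move: k0; clear; lia.
    rewrite kE; apply: size_sub_lead.
    - rewrite size_Mmonic ?mulf_neq0 ?monicXsubC// size_XsubC size_mul// sg.
      by move: k0; clear; lia.
    - rewrite size_scale ?expf_neq0// size_mul -?size_poly_eq0 ?size_core ?size_core'//.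
        by move: k0; clear; lia.
      by rewrite -lt0n.
    - rewrite lead_coefZ !lead_coefM lead_coefXsubC /lev_core /lev_core'.
      by rewrite !(monicP (monic_prod_XsubC _ _ _)) !mulr1 expr2.
  have : wmean f < 0.
    rewrite lev_quad// -oppr_gt0.
    have -> : - dsum k w beta f = dsum k (fun j => w j * (z - beta j)) beta (g ^+ 2).
      rewrite -mulN1r -dsumZ; apply: eq_bigr => j _.
      rewrite hornerZ /f hornerD hornerN hornerZ !hornerM core_at ?ltn_ord//.
      by rewrite hornerXsubC; ring.
    have [w0 bi] := lev_pos_measure.
    apply: dsum_sqr_gt0 => //; last by rewrite sg.
    split=> // j jk; rewrite mulr_gt0 ?w0// subr_gt0 (le_lt_trans _ sz)//.
    by apply: A_le_s; rewrite ltn_add2r.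
  rewrite /f mulrBr gmeanB m0 sub0r oppr_lt0 -scalerAr gmeanZ pmulr_rgt0//.
  by rewrite lt_neqAle sqr_ge0 eq_sym sqrf_eq0 l0.
have : 0 < wmean ((c *: lev_core) * lev_core').
  by rewrite -scalerAl -scalerAr gmeanZ mulr_gt0.
rewrite -cE (mulrBl lev_core') (mulrBr ((1 - 'X) ^+ 1 * (1 + 'X) ^+ eps)) gmeanB -scalerAl -scalerAr gmeanZ.
rewrite mulrA jac_orth ?size_core'// mulr0 sub0r -scalerAl -scalerAr gmeanZ.
rewrite oppr_gt0 pmulr_rlt0//.
rewrite lev_quad; last first.
  rewrite (leq_trans (size_polyMleq _ _))// size_jac size_core'.
  by move: k0; clear; lia.
have -> : dsum k w beta (Q k.-1 * lev_core') = w k.-1 * ((Q k.-1).[s] * lev_core'.[s]).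
  rewrite /dsum (bigD1 (Ordinal (n := k) (m := k.-1) ltac:(by rewrite prednK)))//=.
  rewrite big1 ?addr0 => [|j jk]; first by rewrite beta_last hornerM.
  rewrite hornerM core'_at ?mulr0//.
  have := ltn_ord j; rewrite -[X in (_ < X)%N -> _](prednK k0) ltnS leq_eqVlt.
  by move/orP => [/eqP jE|//]; move/negP: jk; case; apply/eqP/val_inj.
have w0 : 0 < w k.-1 by apply: (lev_pos_measure).1; rewrite prednK.
by rewrite ltNge ltW// mulr_gt0// mulr_gt0 ?core'_last// jac_pred_gt0.
Qed.

End LevenshteinNodes.

(** * Positivity of node products *)

Section StrictlyPositiveDefinite.
Variables (R : realType) (d : nat).
Local Notation P := (geg R d).

(** Strict positivity up to degree [n], required of the denominators in lambda. *)
Definition spd (n : nat) (f : {poly R}) : Prop :=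
  (size f <= n.+1)%N /\ forall j, (j <= n)%N -> 0 < gmean d (f * P j).

Lemma spd_pd n f : spd n f -> pd d f.
Proof.
move=> [sf fj] j; have [/fj/ltW//|nj] := leqP j n.
by rewrite gmean_geg_high// (leq_trans sf).
Qed.

(** For j = a + b, split a positive multiple of P_a off f and of P_b off g: the rest is positive
    definite, and P_a P_b contributes strictly to P_{a+b} through its leading term. *)
Lemma spdM m n f g : spd m f -> spd n g -> spd (m + n) (f * g).
Proof.
move=> sf sg; split.
  rewrite (leq_trans (size_polyMleq _ _))//.
  by move: sf.1 sg.1; clear; lia.
move=> j jmn; have [a [b [am bn ->]]] : exists a b, [/\ a <= m, b <= n & j = a + b]%N.
  have [jm|mj] := leqP j m; first by exists j, 0%N; rewrite addn0.
  by exists m, (j - m)%N; split=> //; move: jmn mj; clear; lia.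
have split_off c h (i : nat) : spd c h -> (i <= c)%N ->
    exists2 u, 0 < u & pd d (h - u *: P i).
  move=> sh ic; exists (gmean d (h * P i) / geg_norm R d i).
    by rewrite divr_gt0 ?geg_norm_gt0//; exact: sh.2.
  move=> e; rewrite mulrBl gmeanB -scalerAl gmeanZ.
  have [<-|ie] := eqVneq i e.
    by rewrite -expr2 divfK ?subrr// geg_norm_neq0.
  by rewrite (gmean_geg_neq R d ie) mulr0 subr0; exact: spd_pd sh _.
have [u u0 pu] := split_off _ _ _ sf am; have [v v0 pv] := split_off _ _ _ sg bn.
have -> : f * g = (f - u *: P a) * g + u *: (P a * (g - v *: P b)) + (u * v) *: (P a * P b).
  by rewrite -!mul_polyC polyCM; ring.
have p1 : pd d ((f - u *: P a) * g + u *: (P a * (g - v *: P b))).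
  apply: pdD; first exact: pdM pu (spd_pd sg).
  by apply: pdZ (ltW u0) _; exact: pdM (pd_geg R d a) pv.
rewrite mulrDl gmeanD ltr_wpDl//.
rewrite -scalerAl gmeanZ mulr_gt0 ?mulr_gt0// gmean_geg_lead//.
  by rewrite size_mul ?geg_neq0// !size_geg addSn addnS.
by rewrite lead_coefM mulr_gt0 ?lead_geg_gt0.
Qed.

End StrictlyPositiveDefinite.

Section JacobiPositiveDefinite.
Variables (R : realType) (d : nat) (eps : bool).
Local Notation P := (geg R d).
Local Notation Q := (jac R d 1 eps).

Let jac_geg_eq0 i (f : {poly R}) : f.[1] = 0 -> (eps -> f.[-1] = 0) ->
  (size f <= i.+1 + eps)%N -> gmean d (Q i * f) = 0.
Proof.
move=> f1 fm sf.
have [g fE sg] : exists2 g : {poly R}, f = (1 - 'X) ^+ 1 * (1 + 'X) ^+ eps * g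
    & (size g <= i)%N.
  have [f0|f0] := eqVneq f 0.
    by exists 0; rewrite ?mulr0// size_poly0.
  have [g gE] : exists g, f = g * ('X - 1%:P) by apply/factor_theorem/rootP.
  have g0 : g != 0 by apply: contra_neq f0 => g0; rewrite gE g0 mul0r.
  have sg : size f = (size g).+1.
    by rewrite gE size_Mmonic ?monicXsubC// size_XsubC addn2.
  case: eps fm sf => fm sf.
    have gm : g.[-1] = 0.
      have /eqP := fm isT; rewrite gE hornerM hornerXsubC mulf_eq0 => /orP[/eqP//|].
      by move=> /eqP; lra.
    have [u uE] : exists u, g = u * ('X - (-1)%:P) by apply/factor_theorem/rootP.
    have u0 : u != 0 by apply: contra_neq g0 => u0; rewrite uE u0 mul0r.
    have su : size g = (size u).+1.
      by rewrite uE size_Mmonic ?monicXsubC// size_XsubC addn2.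
    exists (- u); last by rewrite size_polyN; move: sf; rewrite sg su addn1 !ltnS.
    by rewrite gE uE polyCN; ring.
  exists (- g); last by rewrite size_polyN; move: sf; rewrite sg addn0 ltnS.
  by rewrite gE; ring.
by rewrite fE mulrC mulrAC jac_orth.
Qed.

(** P_j - P_i vanishes at 1, and at -1 when the parities agree, so Q_i is orthogonal to it; hence
    the mean of Q_i P_j equals that of Q_i P_i, positive by leading coefficients. *)
Lemma gmean_jac_geg i j : (j <= i)%N -> (eps -> odd i = odd j) ->
  0 < gmean d (Q i * P j).
Proof.
move=> ji ij; have [-> |] : gmean d (Q i * P j) = gmean d (Q i * P i) \/ False.
- left; apply: subr0_eq; rewrite -gmeanB -mulrBr; apply: jac_geg_eq0.
  + by rewrite hornerD hornerN !geg_at1 subrr.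
  + move=> e; rewrite hornerD hornerN !geg_atN1 -signr_odd -[in X in _ - X]signr_odd.
    by rewrite ij// subrr.
  + rewrite (leq_trans (size_polyD _ _))// size_polyN !size_geg geq_max.
    by move: ji; clear; lia.
- by apply: gmean_geg_lead; [exact: size_jac|exact: lead_jac_gt0].
- by [].
Qed.

(** If eps holds and the parities differ, P_j is compared with P_{i+1} instead, and the coefficient
    is zero. *)
Lemma pd_jac i : pd d (Q i).
Proof.
move=> j; have [ji|ij] := leqP j i; last first.
  by rewrite gmean_geg_high// size_jac.
have [/eqP oij|oij] := boolP (odd i == odd j); first by rewrite ltW ?gmean_jac_geg.
have [e|e] : eps \/ ~~ eps by apply/orP; exact: orbN.
  rewrite (_ : gmean d (Q i * P j) = gmean d (Q i * P i.+1)).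
    by rewrite gmean_geg_high// size_jac.
  apply: subr0_eq; rewrite -gmeanB -mulrBr; apply: jac_geg_eq0.
  + by rewrite hornerD hornerN !geg_at1 subrr.
  + move=> _; rewrite hornerD hornerN !geg_atN1 -signr_odd -[in X in _ - X]signr_odd/=.
    by move: oij; case: (odd i); case: (odd j) => //; rewrite subrr.
  + rewrite (leq_trans (size_polyD _ _))// size_polyN !size_geg geq_max e.
    by move: ji; clear; lia.
by rewrite ltW// gmean_jac_geg// => e'; rewrite e' in e.
Qed.

End JacobiPositiveDefinite.

Section LevenshteinPositiveDefinite.
Variables (R : realType) (d k : nat) (eps : bool) (s iL : R) (A rho : nat -> R).
Hypothesis ld : lev_data d k eps s iL A rho.
Local Notation beta := (lev_beta eps A).
Local Notation w := (lev_w eps A rho).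
Local Notation P := (geg R d).
Local Notation Q := (jac R d 1 eps).
Local Notation core := (lev_core k eps A).
Local Notation core' := (lev_core' k eps A).

Let k0 : (0 < k)%N. Proof. by case: ld. Qed.

Lemma pd_core : pd d core.
Proof.
have [c c0 cE] := lev_core_jac ld; move=> j; rewrite -(pmulr_rge0 _ c0) -gmeanZ.
rewrite scalerAl -cE -scaleNr; apply: pdD; apply: pdZ; try exact: pd_jac.
  by rewrite ltW// (jac_pred_gt0 ld).
by rewrite oppr_ge0 (jac_le0 ld).
Qed.

(** The cone argument covers at most k - 1 nodes; the product of all k vanishes on the whole measure
    and rests on the sign of Q_k(s). *)
Lemma pd_node_prefix i : (i <= k)%N -> pd d (\prod_(j < i) ('X - (beta j)%:P)).
Proof.
rewrite leq_eqVlt => /orP[/eqP ->|ik]; first exact: pd_core.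
apply: (node_products_in_cone (@pdD R d) (@pdZ R d) (lev_pos_measure ld)
  (lev_orth_system ld)) => // l _.
exact: pd_jac.
Qed.

(** Among the nodes, [core'] is nonzero only at s, so all its coefficients on Q_0, ..., Q_{k-1} are
    positive, and Q_j contributes strictly to P_j. *)
Lemma spd_core' : spd d k.-1 core'.
Proof.
have sc : size core' = k.
  by rewrite /lev_core' -big_enum size_prod_XsubC size_enum_ord prednK.
split; first by rewrite sc prednK.
move=> j jk.
have pm := lev_pos_measure ld; have os := lev_orth_system ld.
have bl : beta k.-1 = s by exact: ld_last ld.
have cl l : (l < k)%N ->
    0 < dsum k w beta (core' * Q l) / dsum k w beta (Q l ^+ 2).
  move=> lk; rewrite divr_gt0 ?(orth_norm_gt0 pm os lk)//.
  rewrite /dsum (bigD1 (Ordinal (n := k) (m := k.-1) ltac:(by rewrite prednK)))//=.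
  rewrite big1 ?addr0 => [|i ik].
    rewrite hornerM; apply: mulr_gt0; first by apply: pm.1; rewrite prednK.
    apply: mulr_gt0; last exact: (orth_at_last_gt0 pm os lk).
    rewrite horner_prod prodr_gt0// => i _.
    by rewrite hornerXsubC subr_gt0; apply: pm.2; have := ltn_ord i; move: k0; clear; lia.
  rewrite hornerM horner_prod.
  have ik1 : (i < k.-1)%N.
    have := ltn_ord i; rewrite -[X in (_ < X)%N -> _](prednK k0) ltnS leq_eqVlt.
    by move/orP => [/eqP iE|//]; move/negP: ik; case; apply/eqP/val_inj.
  by rewrite (bigD1 (Ordinal ik1))//= hornerXsubC subrr !mul0r mulr0.
rewrite (orth_expand pm os (leqnn k) (eq_leq sc)) mulr_suml gmean_sum.
have jk' : (j < k)%N by rewrite -(prednK k0).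
rewrite (bigD1 (Ordinal jk'))//= ltr_pwDl//.
  by rewrite -scalerAl gmeanZ mulr_gt0 ?cl// gmean_jac_geg.
apply: sumr_ge0 => l _; rewrite -scalerAl gmeanZ mulr_ge0 ?(ltW (cl _ _))//.
exact: pd_jac.
Qed.

Lemma spd_core : spd d (k + eps) (('X + 1) ^+ eps * core).
Proof.
have sc : size core = k.+1.
  by rewrite /lev_core -big_enum size_prod_XsubC size_enum_ord.
have [c c0 cE] := lev_core_jac ld.
have q1 := jac_pred_gt0 ld; have q0 := jac_le0 ld.
split.
  rewrite (leq_trans (size_polyMleq _ _))// sc -[1]opprK -polyC1 -polyCN.
  by rewrite size_exp_XsubC addSn addnS addnC.
move=> j jk.
(* If eps holds, the coefficients of Q_k of parity opposite to k vanish; the factor X + 1 fills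
   these gaps through the recurrence. *)
have key : 0 < gmean d (('X + 1) ^+ eps * Q k * P j).
  have [e|e] : eps \/ eps = false by case: (eps); [left|right].
    have -> : ('X + 1) ^+ eps * Q k * P j = Q k * P j + (1 - geg_low R d j) *: (Q k * P j.+1)
        + geg_low R d j *: (Q k * P j.-1).
      transitivity (Q k * P j + Q k * ('X * P j)); first by rewrite e expr1; ring.
      by rewrite geg_rec mulrDr -!scalerAr addrA.
    have a0 := geg_low_ge0 R d j; have a1 := geg_low_le_half R d j.
    have q3 (i : nat) : 0 <= gmean d (Q k * P i) by exact: pd_jac.
    rewrite !gmeanD !gmeanZ.
    (* The strictly positive term has index j - 1 if j = k + 1, and otherwise j or j + 1 according
       to parity. *)
    have [jk1|kj] := leqP j k; last first.
      have jE : j = k.+1 by move: jk kj; rewrite e; clear; lia.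
      rewrite jE ltr_wpDl ?addr_ge0 ?mulr_ge0//; first by rewrite jE in a1; lra.
      by rewrite mulr_gt0 ?geg_low_gt0// gmean_jac_geg.
    have [/eqP o|o] := boolP (odd k == odd j).
      by rewrite -addrA ltr_pwDl ?addr_ge0 ?mulr_ge0// ?gmean_jac_geg//; lra.
    rewrite -addrA addrCA ltr_pwDl ?addr_ge0 ?mulr_ge0//.
    rewrite mulr_gt0//; first lra.
    apply: gmean_jac_geg => [|_] /=.
      by rewrite ltn_neqAle jk1 andbT; apply: contraNneq o => ->.
    by move: o; case: (odd k); case: (odd j).
  by rewrite e mul1r gmean_jac_geg ?e//; move: jk; rewrite e addn0.
have pX : pd d (('X + 1) ^+ eps : {poly R}).
  case: (eps) => /=; last by rewrite expr0 -(geg0 R d); exact: pd_geg.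
  by rewrite expr1 -(geg1 R d) -(geg0 R d); apply: pdD; exact: pd_geg.
rewrite -(pmulr_rgt0 _ c0) -gmeanZ scalerAl [c *: _]scalerAr -cE mulrBr mulrBl gmeanB.
rewrite -!scalerAr -!scalerAl !gmeanZ ltr_pwDl ?mulr_gt0//.
rewrite -mulNr mulr_ge0 ?oppr_ge0//.
by apply: pdM => //; exact: pd_jac.
Qed.

Lemma spd_lev : spd d (2 * k - 1 + eps) (('X + 1) ^+ eps * core * core').
Proof.
have -> : (2 * k - 1 + eps = k + eps + k.-1)%N by move: k0; clear; lia.
by apply: spdM; [exact: spd_core|exact: spd_core'].
Qed.

End LevenshteinPositiveDefinite.

(** * Rolle's theorem for relative derivatives *)

Section RelativeDerivative.
Variable R : realType.
Implicit Types (f g : R -> R) (x y l : R).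

Definition inD x : bool := -1 <= x < 1.

(** The relative derivative in epsilon form: two-sided inside, one-sided at -1. *)
Definition dq_lim f x l : Prop := forall e, 0 < e -> exists2 r, 0 < r &
  forall y, inD y -> y != x -> `|y - x| < r -> `|l - diff_quotient f x y| <= e.

Lemma dq_limP f x l :
  diff_quotient f x y @[y --> within `[-1, 1[ x^'] --> l -> dq_lim f x l.
Proof.
move=> /cvgrPdist_le fl e e0; have := fl e e0.
rewrite /within/= => /nbhs_ballP[r r0 rP]; exists r => // y yD yx yr.
have := rP y; rewrite /ball/= distrC => /(_ yr yx); apply.
by rewrite in_itv.
Qed.

Lemma dq_lim_poly (p : {poly R}) x : dq_lim (horner p) x p^`().[x].
Proof.
have : root (p - p.[x]%:P) x by rewrite /root hornerD hornerN hornerC subrr.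
move=> /factor_theorem[q pE].
have qE : p^`() = q^`() * ('X - x%:P) + q.
  have -> : p = q * ('X - x%:P) + p.[x]%:P by rewrite -pE subrK.
  by rewrite derivD derivC addr0 derivM derivXsubC mulr1.
have -> : p^`().[x] = q.[x] by rewrite qE hornerD hornerM hornerXsubC subrr mulr0 add0r.
move=> e e0; have := @continuous_horner R q x => /cvgrPdist_le/(_ e e0).
move=> /nbhs_ballP[r r0 rP]; exists r => // y _ yx yr.
have := rP y; rewrite /ball/= distrC => /(_ yr).
suff -> : diff_quotient (horner p) x y = q.[y] by [].
have := congr1 (horner^~ y) pE; rewrite hornerD hornerN hornerC hornerM hornerXsubC.
by rewrite /diff_quotient => ->; rewrite mulfK// subr_eq0.
Qed.

Lemma dq_limB f g x l l' : dq_lim f x l -> dq_lim g x l' ->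
  dq_lim (fun y => f y - g y) x (l - l').
Proof.
move=> fl gl e e0; have e2 : 0 < e / 2 by rewrite divr_gt0.
have [r r0 rP] := fl _ e2; have [r' r'0 rP'] := gl _ e2.
exists (Num.min r r'); first by rewrite lt_min r0.
move=> y yD yx; rewrite lt_min => /andP[yr yr'].
have -> : l - l' - diff_quotient (fun y => f y - g y) x y =
    (l - diff_quotient f x y) - (l' - diff_quotient g x y).
  by rewrite /diff_quotient; ring.
rewrite (le_trans (ler_normB _ _))// [leRHS]splitr lerD//; [exact: rP|exact: rP'].
Qed.

Lemma dq_lim_continuous f x l : dq_lim f x l -> forall e, 0 < e ->
  exists2 r, 0 < r & forall y, inD y -> `|y - x| < r -> `|f x - f y| <= e.
Proof.
move=> fl e e0; have [r r0 rP] := fl _ ltr01.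
have L0 : 0 < `|l| + 1 by rewrite ltr_wpDl.
exists (Num.min r (e / (`|l| + 1))); first by rewrite lt_min r0 divr_gt0.
move=> y yD; rewrite lt_min => /andP[yr ye].
have [->|yx] := eqVneq y x; first by rewrite subrr normr0 ltW.
have := rP y yD yx yr => dq.
have -> : f x - f y = - (diff_quotient f x y * (y - x)).
  by rewrite /diff_quotient divfK ?subr_eq0// opprB.
rewrite normrN normrM (@le_trans _ _ ((`|l| + 1) * `|y - x|))//; last first.
  by rewrite mulrC -ler_pdivlMr// ltW.
rewrite ler_wpM2r// -[X in `|X|](subrK l) addrC (le_trans (ler_normD _ _))//.
by rewrite lerD// distrC.
Qed.

Lemma dq_lim_derive f x l : -1 < x < 1 -> dq_lim f x l -> is_derive x (1 : R) f l.
Proof.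
move=> /andP[x0 x1] fl.
have cv : h^-1 *: ((f \o shift x) (h *: (1 : R)) - f x) @[h --> 0^'] --> l.
  apply/cvgrPdist_le => e e0; have [r r0 rP] := fl e e0.
  rewrite /within/=; apply/nbhs_ballP.
  exists (Num.min r (Num.min (x + 1) (1 - x))).
    by rewrite /= !lt_min r0 !subr_gt0 x1 -ltrBlDr sub0r x0.
  move=> h /=; rewrite /ball/= sub0r normrN !lt_min => /and3P[hr h1 h2] h0.
  have hD : inD (h + x).
    by move: h1 h2; rewrite /inD !ltr_norml => /andP[? ?] /andP[? ?]; lra.
  have := rP _ hD; rewrite addrK /diff_quotient addrK => /(_ _ hr).
  rewrite -subr_eq0 addrK => /(_ h0).
  by rewrite /GRing.scale/= mulr1 mulrC.
split; first by apply/cvg_ex; exists l.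
by rewrite /derive; apply/cvg_lim.
Qed.

(** The points strictly between a and b lie in ]-1, 1[, where the derivative is the ordinary one; at
    a = -1 only continuity from the right is needed. *)
Lemma dq_rolle f f' a b : (forall x, inD x -> dq_lim f x (f' x)) ->
  inD a -> inD b -> a < b -> f a = 0 -> f b = 0 -> exists2 c, a < c < b & f' c = 0.
Proof.
move=> fD /andP[a0 a1] /andP[b0 b1] ab fa fb.
have abD x : x \in `]a, b[ -> is_derive x (1 : R) f (f' x).
  rewrite in_itv/= => /andP[ax xb]; apply: dq_lim_derive.
    by rewrite (le_lt_trans a0 ax) (lt_trans xb b1).
  by apply: fD; rewrite /inD (le_trans a0 (ltW ax)) (lt_trans xb b1).
have fc : {within `[a, b], continuous f}%classic.
  apply/subspace_continuousP => x; rewrite /= in_itv/= => /andP[ax xb].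
  have xD : inD x by rewrite /inD (le_trans a0 ax) (le_lt_trans xb b1).
  apply/cvgrPdist_le => e e0; have [r r0 rP] := dq_lim_continuous (fD x xD) e0.
  rewrite /within/=; apply/nbhs_ballP; exists r => // y.
  rewrite /ball/= distrC => yr; rewrite in_itv/= => /andP[ay yb]; apply: rP => //.
  by rewrite /inD (le_trans a0 ay) (le_lt_trans yb b1).
have fder x : x \in `]a, b[ -> derivable f x 1 by move=> /abD[].
have [c cab cD] := Rolle ab fder fc (etrans fa (esym fb)).
exists c; first by move: cab; rewrite in_itv.
by have [_ <-] := abD c cab; have [_ ->] := cD.
Qed.

(** The new zeros avoid the old ones because double points, also zeros of the derivative, are
    counted in addition to them in [dq_rolle_double]. *)
Lemma dq_rolle_path f f' z zs : (forall x, inD x -> dq_lim f x (f' x)) ->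
  path <%R z zs -> (forall x, x \in z :: zs -> inD x /\ f x = 0) ->
  exists ws, [/\ path <%R z ws, size ws = size zs &
    forall w, w \in ws -> [/\ inD w, f' w = 0 & w \notin z :: zs]].
Proof.
move=> fD; elim: zs z => [|z2 zs IH] z; first by move=> _ _; exists [::].
rewrite [path _ _ _]/= => /andP[zz2 pz] H.
have [|ws [pws sws wsP]] := IH z2 pz.
  by move=> x xz; apply: H; rewrite inE xz orbT.
have [zD fz] := H z (mem_head _ _).
have [z2D fz2] : inD z2 /\ f z2 = 0 by apply: H; rewrite !inE eqxx orbT.
have [c /andP[zc cz2] fc] := dq_rolle fD zD z2D zz2 fz fz2.
have z2ws := order_path_min lt_trans pws.
have z2zs := order_path_min lt_trans pz.
exists (c :: ws); split.
- rewrite /= zc /=; case: ws pws {sws wsP z2ws} => //= w ws /andP[z2w ->].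
  by rewrite (lt_trans cz2 z2w).
- by rewrite /= sws.
move=> w; rewrite inE => /orP[/eqP ->|wws].
  split=> //.
    move: zD z2D => /andP[z1 _] /andP[_ z21].
    by rewrite /inD (le_trans z1 (ltW zc)) (lt_trans cz2 z21).
  rewrite !inE gt_eqF// lt_eqF//=; apply/negP => /(allP z2zs) z2c.
  by have := lt_trans cz2 z2c; rewrite ltxx.
have [wD fw wz] := wsP w wws; split=> //.
by rewrite inE negb_or wz andbT gt_eqF// (lt_trans zz2)// (allP z2ws).
Qed.

Lemma dq_rolle_uniq f f' zs : (forall x, inD x -> dq_lim f x (f' x)) ->
  uniq zs -> (forall x, x \in zs -> inD x /\ f x = 0) ->
  exists ws, [/\ uniq ws, size ws = (size zs).-1 &
    forall w, w \in ws -> [/\ inD w, f' w = 0 & w \notin zs]].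
Proof.
move=> fD uz H; have : perm_eq (sort <=%R zs) zs by rewrite perm_sort.
have : sorted <%R (sort <=%R zs) by rewrite lt_sorted_uniq_le sort_uniq uz sort_le_sorted.
case: (sort _ _) => [|z zs'] sz pz.
  by exists [::]; split=> //; rewrite -(perm_size pz).
have [|ws [pws sws wsP]] := dq_rolle_path fD sz.
  by move=> x; rewrite (perm_mem pz); exact: H.
exists ws; split.
- by have /andP[] : uniq (z :: ws) by exact: lt_sorted_uniq.
- by rewrite -(perm_size pz) sws.
- by move=> w /wsP[? ? ?]; rewrite -(perm_mem pz).
Qed.

Lemma dq_rolle_iter (F : nat -> R -> R) n k zs :
  (forall j x, inD x -> dq_lim (F j) x (F j.+1 x)) ->
  uniq zs -> (forall x, x \in zs -> inD x /\ F k x = 0) -> size zs = n.+1 ->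
  exists2 c, inD c & F (k + n)%N c = 0.
Proof.
move=> FD; elim: n k zs => [|n IH] k zs uz H sz.
  case: zs sz {uz} H => [//|z zs] _ H; have [zD Fz] := H z (mem_head _ _).
  by exists z => //; rewrite addn0.
have [ws [uw sw wP]] := dq_rolle_uniq (FD k) uz H.
have [||c cD Fc] := IH k.+1 ws uw.
- by move=> x /wP[].
- by rewrite sw sz.
by exists c => //; rewrite addnS -addSn.
Qed.

Lemma size_double_undup (T : eqType) (s : seq T) :
  (forall z, (count_mem z s <= 2)%N) ->
  size s = (size (undup s) + count (fun z => 1 < count_mem z s)%N (undup s))%N.
Proof.
move=> c2; rewrite -{1}(perm_size (perm_count_undup s)) size_flatten /shape -map_comp.
have : all (fun z => z \in s) (undup s) by apply/allP => z; rewrite mem_undup.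
elim: (undup s) => //= z u IH /andP[zs us].
rewrite IH// size_nseq; have := c2 z.
by move: zs; rewrite -has_pred1 has_count; case: (count_mem z s) => [|[|[|]]]//=; lia.
Qed.

Lemma dq_rolle_double (F : nat -> R -> R) n (T : seq R) :
  (forall j x, inD x -> dq_lim (F j) x (F j.+1 x)) ->
  (forall x, (count_mem x T <= 2)%N) -> all inD T -> size T = n.+1 ->
  (forall x j, (j < count_mem x T)%N -> F j x = 0) ->
  exists2 c, inD c & F n c = 0.
Proof.
move=> FD c2 TD sT FT.
have T0 x : x \in undup T -> inD x /\ F 0 x = 0.
  rewrite mem_undup => xT; split; first exact: (allP TD).
  by apply: FT; rewrite -has_count has_pred1.
have [ws [uw sw wP]] := dq_rolle_uniq (FD 0) (undup_uniq T) T0.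
have sT2 := size_double_undup c2.
case: n sT => [|n] sT.
  case: T sT T0 {c2 TD FT wP sw sT2} => [|x [|]]//= _ T0.
  by have [xD Fx] := T0 x (mem_head _ _); exists x.
(* Zeros of the derivative: one between consecutive distinct points, and one at each double point;
   together one fewer than the points of [T]. *)
pose ds := [seq x <- undup T | (1 < count_mem x T)%N].
have [|||c cD Fc] := @dq_rolle_iter F n 1 (ws ++ ds) FD.
- rewrite cat_uniq uw filter_uniq ?undup_uniq// andbT.
  apply/hasPn => x; rewrite mem_filter => /andP[_ xT]; apply/negP => /wP[_ _].
  by rewrite xT.
- move=> x; rewrite mem_cat => /orP[/wP[]//|].
  rewrite mem_filter => /andP[x2 /T0[xD _]]; split=> //; exact: FT.
- rewrite size_cat size_filter sw.
  have : (0 < size (undup T))%N.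
    case: T sT {c2 TD FT T0 wP sw sT2 ds} => //= x T _.
    by case: ifP => // xT; rewrite -has_predT; apply/hasP; exists x; rewrite ?mem_undup.
  by move: sT2; rewrite sT; lia.
by exists c.
Qed.

End RelativeDerivative.

(** * Hermite interpolation *)

Section HermiteInterpolation.
Variables (R : realType) (F : nat -> R -> R).
Hypothesis FD : forall j x, inD x -> dq_lim (F j) x (F j.+1 x).
Hypothesis F_ge0 : forall j x, inD x -> 0 <= F j x.
Implicit Types (T : seq R) (g : {poly R}) (x z : R).

Definition hermite T g := forall x j, (j < count_mem x T)%N -> g^`(j).[x] = F j x.

Definition admissible T := all (@inD R) T /\ forall x, (count_mem x T <= 2)%N.

Lemma admissible_take T i : admissible T -> admissible (take i T).
Proof.
rewrite -{1}(cat_take_drop i T) => -[]; rewrite all_cat => /andP[TD _] c2.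
by split=> // x; have := c2 x; rewrite count_cat; exact/leq_trans/leq_addr.
Qed.

Lemma hermite_take T g i : hermite T g -> hermite (take i T) g.
Proof.
move=> H x j jc; apply: H; rewrite -(cat_take_drop i T) count_cat.
exact: leq_trans jc (leq_addr _ _).
Qed.

(** The difference F_0 - g has n + 1 zeros with multiplicity, so by Rolle g_n = F_n(c) / n! for some
    c. *)
Lemma hermite_lead T g n : admissible T -> hermite T g -> size T = n.+1 ->
  (size g <= n.+1)%N -> 0 <= g`_n.
Proof.
move=> [TD c2] H sT sg.
have GD j x : inD x ->
    dq_lim (fun y => F j y - (g^`(j)).[y]) x (F j.+1 x - (g^`(j.+1)).[x]).
  by move=> xD; rewrite derivnS; apply: dq_limB; [exact: FD|exact: dq_lim_poly].
have G0 x j : (j < count_mem x T)%N -> F j x - (g^`(j)).[x] = 0.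
  by move=> /H ->; rewrite subrr.
have [c cD /eqP] := dq_rolle_double (F := fun j y => F j y - (g^`(j)).[y]) GD c2 TD sT G0.
have -> : g^`(n) = (g`_n *+ n`!)%:P.
  apply/polyP => i; rewrite coef_derivn coefC; case: i => [|i].
    by rewrite addn0 ffactnn.
  by rewrite nth_default ?mul0rn// (leq_trans sg)// addnS ltnS leq_addr.
rewrite hornerC subr_eq0 => /eqP gF; have := F_ge0 n cD.
by rewrite gF pmulrn_lge0// fact_gt0.
Qed.

Lemma lev_poly_rem T x : x \in T -> lev_poly T = ('X - x%:P) * lev_poly (rem x T).
Proof. by move=> xT; rewrite /lev_poly (perm_big _ (perm_to_rem xT)) big_cons. Qed.

Lemma deriv_mulXsubC x (q : {poly R}) : (('X - x%:P) * q)^`().[x] = q.[x].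
Proof.
by rewrite derivM derivXsubC mul1r hornerD hornerM hornerXsubC subrr mul0r addr0.
Qed.

Lemma root_lev_poly T x : root (lev_poly T) x = (x \in T).
Proof. exact: root_prod_XsubC. Qed.

Lemma lev_poly_derivn T x j : (count_mem x T <= 2)%N -> (j < count_mem x T)%N ->
  (lev_poly T)^`(j).[x] = 0.
Proof.
move=> c2 jc; have xT : x \in T by rewrite -has_pred1 has_count (leq_ltn_trans _ jc).
case: j jc => [|[|j]] jc; last by move: (leq_trans jc c2).
  by apply/eqP; rewrite -/(root _ _) root_lev_poly.
rewrite derivn1 (lev_poly_rem xT) deriv_mulXsubC; apply/eqP.
rewrite -/(root _ _) root_lev_poly -has_pred1 has_count.
by move: jc; rewrite (permP (perm_to_rem xT)) /= eqxx.
Qed.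

Lemma lev_poly_derivn_neq0 T z : (count_mem z T < 2)%N ->
  (lev_poly T)^`(count_mem z T).[z] != 0.
Proof.
have [zT|zT _] := boolP (z \in T); last first.
  by rewrite (count_memPn zT) derivn0 -/(root _ _) root_lev_poly.
rewrite (permP (perm_to_rem zT)) /= eqxx add1n ltnS ltnS leqn0 => /eqP c0.
rewrite c0 derivn1 (lev_poly_rem zT) deriv_mulXsubC.
by rewrite -/(root _ _) root_lev_poly -has_pred1 has_count c0.
Qed.

Lemma size_lev_poly T : size (lev_poly T) = (size T).+1.
Proof. exact: size_prod_XsubC. Qed.

Lemma lead_lev_poly T : (lev_poly T)`_(size T) = 1.
Proof.
by have /monicP := monic_prod_XsubC T predT id; rewrite lead_coefE -/(lev_poly T) size_lev_poly.
Qed.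

(* Newton's form: passing from [T] to [rcons T z] adds a multiple of
   [lev_poly T], whose coefficient is a divided difference of [F 0], hence
   nonnegative. *)
Lemma hermite_rcons T z g : admissible (rcons T z) -> hermite T g ->
  (size g <= size T)%N -> exists2 a, 0 <= a & hermite (rcons T z) (g + a *: lev_poly T).
Proof.
move=> adm H sg; have [TD c2] := adm.
have cz : (count_mem z T < 2)%N.
  by have := c2 z; rewrite -cats1 count_cat /= eqxx addn0 addn1.
pose c := count_mem z T; pose w := lev_poly T.
pose a := (F c z - (g^`(c)).[z]) / (w^`(c)).[z].
have Hz : hermite (rcons T z) (g + a *: w).
  move=> x j; rewrite -cats1 count_cat /= addn0 derivnD derivnZ hornerD hornerZ => jc.
  have [jT|Tj] := ltnP j (count_mem x T).
    rewrite H// lev_poly_derivn ?mulr0 ?addr0//.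
    by have := c2 x; rewrite -cats1 count_cat; exact/leq_trans/leq_addr.
  have zx : z = x.
    by apply/eqP; move: jc; case: eqP => //; rewrite addn0 ltnNge Tj.
  have -> : j = c.
    by move: jc Tj; rewrite /c zx eqxx addn1 ltnS => jT Tj; apply/eqP; rewrite eqn_leq jT.
  by rewrite -zx /a divfK ?subrKC// lev_poly_derivn_neq0.
exists a => //; have := hermite_lead adm Hz (size_rcons _ _).
rewrite coefD coefZ lead_lev_poly nth_default// mulr1 add0r; apply.
rewrite (leq_trans (size_polyD _ _))// geq_max (leq_trans sg)//=.
by rewrite (leq_trans (size_scale_leq _ _))// size_lev_poly.
Qed.

Lemma hermite_in_cone (P : {poly R} -> Prop) T :
  P 0 -> (forall p q, P p -> P q -> P (p + q)) ->
  (forall c p, 0 <= c -> P p -> P (c *: p)) -> admissible T ->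
  (forall i, (i < size T)%N -> P (lev_poly (take i T))) ->
  exists g, [/\ hermite T g, (size g <= size T)%N & P g].
Proof.
move=> P0 PD PZ; elim/last_ind: T => [|T z IH] adm PT.
  by exists 0; split=> //; rewrite size_poly0.
have admT : admissible T.
  by have := @admissible_take _ (size T) adm; rewrite -cats1 take_size_cat.
have [|g [Hg sg Pg]] := IH admT.
  move=> i iT; have := PT i; rewrite size_rcons ltnS -cats1 takel_cat ?(ltnW iT)//.
  exact.
have [a a0 Ha] := hermite_rcons adm Hg sg; exists (g + a *: lev_poly T); split=> //.
  rewrite size_rcons (leq_trans (size_polyD _ _))// geq_max (leq_trans sg)//=.
  by rewrite (leq_trans (size_scale_leq _ _))// size_lev_poly.
apply: PD => //; apply: PZ => //.
by have := PT (size T); rewrite size_rcons -cats1 take_size_cat//; apply.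
Qed.

(** Append t to the points: the coefficient of the new Newton term is K. A point t already in [T] is
    treated apart, as its multiplicity could become 3. *)
Lemma hermite_error T g t : admissible T -> hermite T g -> (size g <= size T)%N ->
  inD t -> exists2 K, 0 <= K & F 0%N t - g.[t] = K * (lev_poly T).[t].
Proof.
move=> adm H sg tD; have [tT|tT] := boolP (t \in T).
  exists 0 => //; rewrite mul0r -[g]derivn0 H ?subrr//.
  by rewrite -has_count has_pred1.
have [|a a0 Ha] := @hermite_rcons T t g _ H sg.
  split; first by rewrite all_rcons tD; case: adm.
  move=> x; rewrite -cats1 count_cat /= addn0; case: eqP => [<-|_].
    by rewrite (count_memPn tT).
  by rewrite addn0; case: adm.
exists a => //; have := Ha t 0%N.
rewrite -cats1 count_cat /= eqxx addn0 addn1 => /(_ isT).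
by rewrite hornerD hornerZ => <-; rewrite addrAC subrr add0r.
Qed.

(** The degree may be lower than the number of points allows; [g] still interpolates at the first e
    + 1 of them. *)
Lemma hermite_lead_ge0 T g e : admissible T -> hermite T g ->
  size g = e.+1 -> (size g <= size T)%N -> 0 <= g`_e.
Proof.
move=> adm H sg sgT; apply: (@hermite_lead (take e.+1 T)).
- exact: admissible_take.
- exact: hermite_take.
- by rewrite size_takel// -sg.
- by rewrite sg.
Qed.

End HermiteInterpolation.

(** * Sums over codes *)

Section CodeSums.
Variables (R : realType).

Lemma dot_sub_sqr n (x y : 'rV[R]_n) :
  \sum_(i < n) (x 0 i - y 0 i) ^+ 2 = dot x x + dot y y - 2 * dot x y.
Proof.
rewrite /dot mulr_sumr -big_split/= -sumrB; apply: eq_bigr => i _; ring.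
Qed.

Lemma dot_lt1 n (x y : 'rV[R]_n) : dot x x = 1 -> dot y y = 1 -> x != y -> dot x y < 1.
Proof.
move=> x1 y1 xy; have : 0 < \sum_(i < n) (x 0 i - y 0 i) ^+ 2.
  rewrite lt_def sumr_ge0 ?andbT// => [|i _]; last exact: sqr_ge0.
  apply: contra xy; rewrite psumr_eq0 => [/allP xy|i _]; last exact: sqr_ge0.
  apply/eqP/rowP => i; have := xy i (mem_index_enum _).
  by rewrite sqrf_eq0 subr_eq0 => /eqP.
by rewrite dot_sub_sqr x1 y1; lra.
Qed.

Lemma dot_geN1 n (x y : 'rV[R]_n) : dot x x = 1 -> dot y y = 1 -> -1 <= dot x y.
Proof.
move=> x1 y1; have : 0 <= \sum_(i < n) (x 0 i + y 0 i) ^+ 2.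
  by apply: sumr_ge0 => i _; exact: sqr_ge0.
suff -> : \sum_(i < n) (x 0 i + y 0 i) ^+ 2 = dot x x + dot y y + 2 * dot x y.
  by rewrite x1 y1; lra.
by rewrite /dot mulr_sumr -!big_split/=; apply: eq_bigr => i _; ring.
Qed.

Lemma dot_le_max_inner n (C : {fset 'rV[R]_n}) x y : x \in C -> y \in C -> x != y ->
  dot x y <= max_inner C.
Proof.
move=> xC yC xy; rewrite /max_inner.
apply: (bigmax_sup_seq _ x) => //.
exact: le_bigmax_seq.
Qed.

Lemma sumr_const_fset (K : choiceType) (V : nmodType) (C : {fset K}) (a : V) :
  \sum_(x <- C) a = a *+ (#|` C|)%fset.
Proof. by rewrite big_const_seq count_predT iter_addr_0. Qed.

Definition pair_sum n (f : R -> R) (C : {fset 'rV[R]_n}) : R :=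
  \sum_(x <- C) \sum_(y <- C | x != y) f (dot x y).

Lemma pair_sum_le n (f g : R -> R) (C : {fset 'rV[R]_n}) : spherical_code C ->
  (forall t, -1 <= t < 1 -> t <= max_inner C -> f t <= g t) ->
  pair_sum f C <= pair_sum g C.
Proof.
move=> C1 fg; rewrite /pair_sum !big_seq; apply: ler_sum => x xC.
rewrite big_seq_cond [leRHS]big_seq_cond; apply: ler_sum => y /andP[yC xy].
apply: fg; last exact: dot_le_max_inner.
by rewrite dot_geN1 ?dot_lt1//; exact: C1.
Qed.

(** Inner products of distinct unit vectors are below 1, so a possibly infinite h(1) never
    occurs. *)
Lemma energyE n (h : R -> \bar R) (C : {fset 'rV[R]_n}) : spherical_code C ->
  (forall t, -1 <= t < 1 -> h t \is a fin_num) ->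
  energy h C = (pair_sum (fine \o h) C)%:E.
Proof.
move=> C1 hfin; rewrite /energy /pair_sum -sumEFin; apply: eq_big_seq => x xC.
rewrite -sumEFin big_seq_cond [in RHS]big_seq_cond; apply: eq_bigr => y /andP[yC xy].
rewrite /= fineK// hfin// dot_geN1 ?dot_lt1//; exact: C1.
Qed.

Lemma pair_sum_diag n (f : R -> R) (C : {fset 'rV[R]_n}) : spherical_code C ->
  \sum_(x <- C) \sum_(y <- C) f (dot x y) = pair_sum f C + (#|` C|)%fset%:R * f 1.
Proof.
move=> C1; rewrite mulr_natl -sumr_const_fset /pair_sum -big_split/=.
apply: eq_big_seq => x xC; rewrite (bigD1_seq x xC (fset_uniq _))/= C1// addrC; congr (_ + _).
by apply: eq_bigl => y; rewrite eq_sym.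
Qed.

Lemma code_sum_ge d (C : {fset 'rV[R]_d.+2}) (f : {poly R}) : spherical_code C ->
  (forall i, (0 < i)%N -> 0 <= gmean d (f * geg R d i)) ->
  (#|` C|)%fset%:R ^+ 2 * gmean d f <= \sum_(x <- C) \sum_(y <- C) f.[dot x y].
Proof.
(* One term more than [f] requires, so that the term i = 0 can be split off even when f = 0. *)
move=> C1 f0; have H := geg_expand d (leqnSn (size f)).
have -> : \sum_(x <- C) \sum_(y <- C) f.[dot x y] =
    \sum_(i < (size f).+1) gmean d (f * geg R d i) / geg_norm R d i *
      (\sum_(x <- C) \sum_(y <- C) (geg R d i).[dot x y]).
  under [RHS]eq_bigr do rewrite mulr_sumr.
  rewrite [RHS]exchange_big/=; apply: eq_bigr => x _.
  under [RHS]eq_bigr do rewrite mulr_sumr.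
  rewrite [RHS]exchange_big/=; apply: eq_bigr => y _.
  by rewrite {1}H horner_sum; apply: eq_bigr => i _; rewrite hornerZ.
rewrite big_ord_recl/= -[leLHS]addr0; apply: lerD; last first.
  apply: sumr_ge0 => i _; apply: mulr_ge0.
    by rewrite divr_ge0 ?f0// ltW// geg_norm_gt0.
  by apply: geg_positive_definite => x /C1.
rewrite /geg_norm geg0 mulr1 expr1n gmean1 divr1.
under eq_bigr do under eq_bigr do rewrite hornerC.
by rewrite !sumr_const_fset -[_ *+ #|` C|%fset]mulr_natr -expr2 mulrC.
Qed.

End CodeSums.

(** * The lower bound *)

Lemma lev_poly_cat (R : realType) (S T : seq R) :
  lev_poly (S ++ T) = lev_poly S * lev_poly T.
Proof. by rewrite /lev_poly big_cat. Qed.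

Lemma perm_flatten_double (I T : eqType) (f : I -> T) (s : seq I) :
  perm_eq (flatten [seq [:: f i; f i] | i <- s]) (map f s ++ map f s).
Proof.
apply/permP => p; rewrite count_cat; elim: s => //= i s ->.
by rewrite addnACA !addnA; lia.
Qed.

Section NodeMultisets.
Variables (R : realType) (d k : nat) (eps : bool) (s iL : R) (A rho : nat -> R).
Hypothesis ld : lev_data d k eps s iL A rho.
Local Notation beta := (lev_beta eps A).
Local Notation core := (lev_core k eps A).
Local Notation core' := (lev_core' k eps A).

Let k0 : (0 < k)%N. Proof. by case: ld. Qed.

Definition lev_betas n := [seq beta j | j <- iota 0 n].

Lemma lev_poly_betas n : lev_poly (lev_betas n) = \prod_(j < n) ('X - (beta j)%:P).
Proof.
rewrite /lev_poly /lev_betas big_map -(big_mkord xpredT (fun j => 'X - (beta j)%:P)).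
by rewrite /index_iota subn0.
Qed.

Lemma lev_poly_nseqN1 : lev_poly (nseq eps (-1)) = ('X + 1) ^+ eps :> {poly R}.
Proof.
rewrite /lev_poly; case: (eps); rewrite ?big_nil//= big_seq1 expr1.
by rewrite polyCN opprK.
Qed.

Lemma beta_inD j : (j < k)%N -> inD (beta j).
Proof.
move=> jk; have jN : (j + eps < k + eps)%N by rewrite ltn_add2r.
have A_le i i' : (i <= i')%N -> (i' < k + eps)%N -> A i <= A i'.
  rewrite leq_eqVlt => /orP[/eqP -> //|ii' i'N]; exact/ltW/(ld_incr ld).
have sA : beta j <= s.
  rewrite -(ld_last ld) A_le//; last by move: k0; clear; lia.
  by move: jk; clear; lia.
have /andP[_ s1] := ld_bnd ld.
by rewrite /inD (le_lt_trans sA s1) andbT (le_trans (node_ge_m1 ld))// A_le.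
Qed.

Lemma beta_inj i j : (i < k)%N -> (j < k)%N -> beta i = beta j -> i = j.
Proof.
move=> ik jk E; have [ij|ij|//] := ltngtP i j.
  by have := @ld_incr _ _ _ _ _ _ _ _ ld (i + eps) (j + eps);
     rewrite !ltn_add2r => /(_ ij jk); rewrite -/(beta i) E ltxx.
by have := @ld_incr _ _ _ _ _ _ _ _ ld (j + eps) (i + eps);
   rewrite !ltn_add2r => /(_ ij ik); rewrite -/(beta i) E ltxx.
Qed.

Lemma uniq_betas : uniq (lev_betas k).
Proof.
rewrite map_inj_in_uniq ?iota_uniq// => i j.
rewrite !mem_iota !add0n => /andP[_ ik] /andP[_ jk]; exact: beta_inj.
Qed.

Lemma betas_inD x : x \in lev_betas k -> inD x.
Proof.
by move=> /mapP[j]; rewrite mem_iota add0n => /andP[_ jk] ->; exact: beta_inD.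
Qed.

Lemma N1_notin_betas : eps -> -1 \notin lev_betas k.
Proof.
move=> e; apply/negP => /mapP[j]; rewrite mem_iota add0n => /andP[_ jk] E.
have := @ld_incr _ _ _ _ _ _ _ _ ld 0%N (j + eps)%N.
rewrite (first_node_m1 ld e) -/(beta j) -E ltxx ltn_add2r => /(_ _ jk).
by rewrite e addn1 => /(_ isT).
Qed.

Lemma admissible_double : admissible (nseq eps (-1) ++ lev_betas k ++ lev_betas k).
Proof.
split.
  rewrite !all_cat; apply/and3P; split; try by apply/allP => x /betas_inD.
  by case: (eps); rewrite //= /inD lexx; lra.
move=> x; rewrite !count_cat (count_uniq_mem _ uniq_betas) count_nseq /=.
have [xb|_] := boolP (x \in _); last by case: (-1 == x); case: (eps).
suff -> : ((-1 == x)%R * eps = 0)%N by [].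
case: eqP => // xE; suff /negbTE -> : ~~ eps by [].
by apply: contraL xb => e; rewrite -xE N1_notin_betas.
Qed.

Lemma betas_last : lev_betas k = rcons (lev_betas k.-1) s.
Proof.
rewrite /lev_betas -{1}(prednK k0) -addn1 iotaD map_cat add0n /= cats1.
by rewrite {2}/lev_beta (ld_last ld).
Qed.

Lemma node_mem i : (i < k + eps)%N -> A i \in nseq eps (-1) ++ lev_betas k.
Proof.
move=> iN; rewrite mem_cat; have [ie|ei] := ltnP i eps.
  have e : eps by move: ie; case: (eps).
  have -> : i = 0%N by move: ie; rewrite e ltnS leqn0 => /eqP.
  by rewrite (first_node_m1 ld e) e mem_head.
apply/orP; right; apply/mapP; exists (i - eps)%N; last by rewrite /lev_beta subnK.
by rewrite mem_iota add0n /= ltn_subLR// addnC.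
Qed.

Definition all_prefix_pd (T : seq R) := forall i, pd d (lev_poly (take i T)).

Lemma all_prefix_pd_cat S T : all_prefix_pd S -> all_prefix_pd T -> all_prefix_pd (S ++ T).
Proof.
move=> pS pT i; rewrite take_cat; case: ltnP => // _.
by rewrite lev_poly_cat; apply: pdM => //; have := pS (size S); rewrite take_size.
Qed.

(** Listing all nodes once and then once more makes each prefix a product of prefixes already known
    to be positive definite. *)
Lemma all_prefix_pd_double :
  all_prefix_pd (nseq eps (-1) ++ lev_betas k ++ lev_betas k).
Proof.
have pb : all_prefix_pd (lev_betas k).
  move=> i; rewrite /lev_betas -map_take take_iota -/(lev_betas _) lev_poly_betas.
  by apply: (pd_node_prefix ld); rewrite geq_minr.
apply: all_prefix_pd_cat; last exact: all_prefix_pd_cat.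
have pd1 : pd d (1 : {poly R}) by rewrite -(geg0 R d); exact: pd_geg.
have pdX1 : pd d ('X + 1 : {poly R}).
  by apply: pdD => //; rewrite -(geg1 R d); exact: pd_geg.
have lev0 : lev_poly [::] = 1 :> {poly R} by rewrite /lev_poly big_nil.
move: lev_poly_nseqN1; case: (eps) => /= E [|i] /=; rewrite ?lev0//.
by rewrite E expr1.
Qed.

Section UniversalLowerBound.
Variables (F : nat -> R -> R) (M : nat) (C : {fset 'rV[R]_d.+2}).
Hypothesis FD : forall j x, inD x -> dq_lim (F j) x (F j.+1 x).
Hypothesis F_ge0 : forall j x, inD x -> 0 <= F j x.
Hypothesis C1 : spherical_code C.
Hypothesis CM : (#|` C| = M)%fset.
Hypothesis M_gt0 : (0 < M)%N.

(** With L = M the quadrature term M^2 g(1) / L equals the diagonal contribution M g(1) and cancels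
    it; hence the choice of r. *)
Lemma pair_sum_lower_bound : iL = M%:R^-1 ->
  M%:R ^+ 2 * (\sum_(i < k + eps) rho i * F 0 (A i)) <= pair_sum (F 0) C.
Proof.
move=> iLE; set T := nseq eps (-1) ++ lev_betas k ++ lev_betas k.
have [g [Hg sg pg]] : exists g, [/\ hermite F T g, (size g <= size T)%N & pd d g].
  apply: (hermite_in_cone FD F_ge0) admissible_double _.
  - by move=> i; rewrite mul0r gmean0.
  - by move=> p q; exact: pdD.
  - by move=> c p; exact: pdZ.
  - by move=> i _; exact: all_prefix_pd_double.
have sT : size T = (2 * k + eps)%N.
  by rewrite !size_cat size_nseq /lev_betas size_map size_iota; lia.
have gA i : (i < k + eps)%N -> g.[A i] = F 0 (A i).
  move=> iN; rewrite -[g]derivn0 Hg// -has_count has_pred1 !mem_cat.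
  by have := node_mem iN; rewrite mem_cat => /orP[->|->]; rewrite ?orbT.
have gF t : inD t -> g.[t] <= F 0 t.
  move=> tD; have [K K0 KE] := hermite_error FD F_ge0 admissible_double Hg sg tD.
  rewrite -subr_ge0 KE mulr_ge0// !lev_poly_cat lev_poly_nseqN1 !hornerM -expr2.
  rewrite mulr_ge0 ?sqr_ge0// horner_exp exprn_ge0// hornerD hornerX hornerC.
  by move: tD => /andP[]; lra.
have q := ld_quad ld (f := g); rewrite -sT in q; have := q sg => {q} gm.
have le1 : pair_sum (horner g) C <= pair_sum (F 0) C.
  by apply: pair_sum_le => // t tD _; exact: gF.
have := code_sum_ge C1 (fun i _ => pg i).
rewrite pair_sum_diag// CM gm iLE.
have -> : \sum_(i < k + eps) rho i * g.[A i] = \sum_(i < k + eps) rho i * F 0 (A i).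
  by apply: eq_bigr => i _; rewrite gA.
rewrite mulrDr expr2 -mulrA [X in _ * X + _]mulrCA divff ?mulr1 ?pnatr_eq0 -?lt0n//.
by move: le1; lra.
Qed.

End UniversalLowerBound.

End NodeMultisets.

(** * The upper bound *)

Section UpperBound.
Variables (R : realType) (d k : nat) (eps : bool) (s iL : R) (alpha : (k + eps).-tuple R).
Variables (rho : nat -> R).
Local Notation A := (fun i => alpha`_i).
Hypothesis ld : lev_data d k eps s iL A rho.
Local Notation beta := (lev_beta eps A).
Local Notation core := (lev_core k eps A).
Local Notation core' := (lev_core' k eps A).
Local Notation T := (lev_T alpha).

Let k0 : (0 < k)%N. Proof. by case: ld. Qed.

Lemma perm_lev_T : perm_eq T
  (nseq eps (-1) ++ lev_betas eps A k.-1 ++ rcons (lev_betas eps A k.-1) s).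
Proof.
rewrite /lev_T; have -> : (if eps then [:: alpha`_0] else [::]) = nseq eps (-1).
  by move: (alpha`_0) (first_node_m1 ld) => a; case: (eps) => //= ->.
rewrite subn1 (ld_last ld) perm_cat2l -cats1 catA perm_cat2r.
suff -> : iota eps k.-1 = [seq (j + eps)%N | j <- iota 0 k.-1].
  by rewrite -map_comp; exact: (perm_flatten_double (fun j => alpha`_(j + eps))).
by rewrite -{1}[nat_of_bool eps]addn0 iotaDl; apply: eq_map => j; rewrite addnC.
Qed.

Lemma lev_poly_T : lev_poly T = ('X + 1) ^+ eps * core * core'.
Proof.
rewrite /lev_poly (perm_big _ perm_lev_T) -/(lev_poly _) -(betas_last ld).
by rewrite !lev_poly_cat lev_poly_nseqN1 !lev_poly_betas mulrA mulrAC.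
Qed.

Lemma admissible_T : admissible T.
Proof.
have [TD c2] := admissible_double ld; split.
  rewrite (perm_all _ perm_lev_T); move: TD.
  rewrite -(betas_last ld) !all_cat => /and3P[-> TD ->]; rewrite andbT /=.
  by move: TD; rewrite (betas_last ld) all_rcons => /andP[].
move=> x; apply: leq_trans (c2 x); rewrite (permP perm_lev_T).
rewrite -(betas_last ld) !count_cat leq_add2l leq_add2r (betas_last ld).
by rewrite -cats1 count_cat leq_addr.
Qed.

Lemma size_T : size T = (2 * k - 1 + eps)%N.
Proof.
rewrite (perm_size perm_lev_T) !size_cat size_rcons size_nseq /lev_betas size_map size_iota.
by move: k0; clear; lia.
Qed.

Lemma mem_T i : (i < k + eps)%N -> alpha`_i \in T.
Proof.
move=> /(node_mem ld); rewrite (perm_mem perm_lev_T) -(betas_last ld) !mem_cat.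
by case/orP => ->; rewrite ?orbT.
Qed.

Variables (F : nat -> R -> R) (M : nat) (C : {fset 'rV[R]_d.+2}) (g : {poly R}).
Hypothesis FD : forall j x, inD x -> dq_lim (F j) x (F j.+1 x).
Hypothesis F_ge0 : forall j x, inD x -> 0 <= F j x.
Hypothesis C1 : spherical_code C.
Hypothesis CM : (#|` C| = M)%fset.
Hypothesis Cs : max_inner C = s.
Hypothesis Hg : hermite F T g.
Hypothesis sg : (size g <= size T)%N.

Local Notation lam := (lev_lambda d.+2 T g).
Local Notation f := (lev_fh d.+2 T g).
Local Notation w := (lev_poly T).

Lemma gmean_lev_poly_gt0 i : (i <= size T)%N -> 0 < gmean d (w * geg R d i).
Proof.
by rewrite size_T lev_poly_T => iT; have [_] := spd_lev ld; apply.
Qed.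

Lemma lev_poly_pd : pd d w.
Proof. by rewrite lev_poly_T; apply: spd_pd (spd_lev ld). Qed.

Lemma ratioE i : gegenbauer_coef d.+2 i (horner g) / gegenbauer_coef d.+2 i (horner w) =
  gmean d (g * geg R d i) / gmean d (w * geg R d i).
Proof.
rewrite !gegenbauer_coef_gmean invfM invrK mulrACA mulVf ?mulr1//.
exact: geg_norm_neq0.
Qed.

Lemma ratio_le_lambda i : (0 < i)%N -> (i < size g)%N ->
  gmean d (g * geg R d i) <= lam * gmean d (w * geg R d i).
Proof.
move=> i0 ig; rewrite -ler_pdivrMr; last first.
  by apply: gmean_lev_poly_gt0; exact: leq_trans (ltnW ig) sg.
rewrite -ratioE /lev_lambda; apply: (le_bigmax_seq _ i) => //.
by rewrite mem_index_iota i0.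
Qed.

(** Used for the coefficients of index beyond the degree of g_T, and for f to lie above g_T on
    [-1, s]. *)
Lemma lev_lambda_ge0 : 0 <= lam.
Proof.
have [g1|g1] := leqP (size g) 1.
  (* For constant g_T the maximum is its default, the ratio at i = 1, which is 0. *)
  by rewrite /lev_lambda big_geq// ratioE gmean_geg_high// mul0r.
have g0 : (0 < (size g).-1 < size g)%N by move: g1; clear; lia.
have /andP[e0 eg] := g0.
have := ratio_le_lambda e0 eg.
have w0 : 0 < gmean d (w * geg R d (size g).-1).
  by apply: gmean_lev_poly_gt0; exact: leq_trans (ltnW eg) sg.
move=> H; rewrite -(pmulr_lge0 _ w0) (le_trans _ H)// ltW//.
have sgE : size g = (size g).-1.+1 by rewrite prednK// (ltn_trans _ g1).
apply: gmean_geg_lead => //.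
rewrite lt_def lead_coef_eq0 -size_poly_gt0 (ltn_trans _ g1)//= lead_coefE.
exact: (hermite_lead_ge0 FD F_ge0 admissible_T Hg sgE sg).
Qed.

Lemma lev_fh_coef_le0 i : (0 < i)%N -> 0 <= gmean d (- f * geg R d i).
Proof.
move=> i0; rewrite /lev_fh opprD scaleNr opprK mulrDl gmeanD -scalerAl gmeanZ.
rewrite -scaleN1r -scalerAl gmeanZ mulN1r subr_ge0.
have [gi|ig] := leqP (size g) i; last exact: ratio_le_lambda.
by rewrite gmean_geg_high// mulr_ge0 ?lev_lambda_ge0// lev_poly_pd.
Qed.

Lemma lev_fh_node i : (i < k + eps)%N -> f.[alpha`_i] = F 0 alpha`_i.
Proof.
move=> iN; have aT := mem_T iN.
rewrite /lev_fh hornerD hornerZ (eqP (_ : root w _)) ?root_lev_poly//.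
rewrite mulr0 add0r -[g]derivn0 Hg// -has_count has_pred1//.
Qed.

Lemma le_lev_fh t : inD t -> t <= s -> F 0 t <= f.[t].
Proof.
move=> tD ts; have [K K0 KE] := hermite_error FD F_ge0 admissible_T Hg sg tD.
have w0 : w.[t] <= 0.
  (* The polynomial is (X + 1)^eps (X - s) times the square of [core']. *)
  rewrite lev_poly_T (lev_coreE ld) !hornerM hornerXsubC.
  rewrite mulrAC (mulrA _ core'.[t]) mulr_ge0_le0 ?subr_le0// -mulrA mulr_ge0 -?expr2 ?sqr_ge0//.
  rewrite horner_exp exprn_ge0// hornerD hornerX hornerC.
  by move: tD => /andP[]; lra.
have : F 0 t - g.[t] <= 0 by rewrite KE mulr_ge0_le0.
rewrite subr_le0 => /le_trans; apply.
by rewrite /lev_fh hornerD hornerZ lerDr mulNr oppr_ge0 mulr_ge0_le0// lev_lambda_ge0.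
Qed.

Lemma pair_sum_upper_bound :
  pair_sum (F 0) C <= M%:R * (M%:R * iL - 1) * f.[1] +
    M%:R ^+ 2 * (\sum_(i < k + eps) rho i * F 0 alpha`_i).
Proof.
have sf : (size f <= 2 * k + eps)%N.
  rewrite /lev_fh (leq_trans (size_polyD _ _))// geq_max (leq_trans sg) ?andbT; last first.
    by rewrite size_T; move: k0; clear; lia.
  rewrite (leq_trans (size_scale_leq _ _))// size_lev_poly size_T.
  by move: k0; clear; lia.
have le1 : pair_sum (F 0) C <= pair_sum (horner f) C.
  by apply: pair_sum_le => // t tD; rewrite Cs; exact: le_lev_fh.
(* Delsarte's inequality is applied to -f. *)
have := code_sum_ge C1 lev_fh_coef_le0.
under eq_bigr do under eq_bigr do rewrite hornerN.
under eq_bigr do rewrite sumrN.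
rewrite sumrN pair_sum_diag// CM -scaleN1r gmeanZ (ld_quad ld sf).
under eq_bigr do rewrite lev_fh_node//.
by move: le1; lra.
Qed.

End UpperBound.

(** * Passage from the hypotheses of the theorem to the abstract node data *)

Lemma lev_dataI (R : realType) (d k : nat) (eps : bool) (s : R)
    (alpha rho : (k + eps).-tuple R) : (0 < k)%N ->
  lev_interval d.+2 k eps s -> is_lev_nodes d.+2 s alpha ->
  is_lev_weights d.+2 s alpha rho ->
  lev_data d k eps s (lev_L d.+2 k eps s)^-1 (fun i => alpha`_i) (fun i => rho`_i).
Proof.
move=> k0 sI [alpha_lt alphaP alpha_last] rhoP.
have tE (a b : bool) i : (0 < i)%N -> lev_t R d.+2 a b i = greatest_zero (jac R d a b i).
  exact: lev_tE.
have upper : s <= greatest_zero (jac R d 1 eps k).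
  by move: sI; rewrite /lev_interval; case: (eps); rewrite /= in_itv/= => /andP[_];
     rewrite tE.
have lower : (0 < k.-1 + eps)%N -> greatest_zero (jac R d 1 (~~ eps) (k.-1 + eps)) <= s.
  move: sI; rewrite /lev_interval; case: (eps); rewrite /= in_itv/= => /andP[+ _].
    by rewrite addn1 prednK// tE.
  by rewrite addn0 => + k10; rewrite tE.
have s_ge : -1 <= s.
  (* For m = 1 the lower end of I_m is the conventional value -1, not a Jacobi zero. *)
  have [k10|k10] := posnP (k.-1 + eps).
    move: k10 sI => /eqP; rewrite addn_eq0 => /andP[/eqP k10 /eqP e0].
    have -> : eps = false by move: e0; case: (eps).
    by rewrite /lev_interval k10 /= in_itv/= => /andP[].
  apply: le_trans (lower k10); have /andP[/ltW] := greatest_zero_bounds R d 1 (~~ eps) k10.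
  by [].
have s_lt : s < 1 by apply: le_lt_trans upper _; have /andP[] := greatest_zero_bounds R d 1 eps k0.
have nodeE : lev_node_poly d.+2 k eps s = ('X + 1) ^+ eps *
    ((jac R d 1 eps k.-1).[s] *: jac R d 1 eps k
      - (jac R d 1 eps k).[s] *: jac R d 1 eps k.-1).
  by rewrite /lev_node_poly !lev_QE.
split=> //.
- move=> i j ij jN; apply: (sorted_ltn_nth lt_trans) => //; rewrite inE size_tuple//.
  exact: ltn_trans ij jN.
- by rewrite -subn1.
- move=> e; have : -1 \in alpha.
    rewrite alphaP /lev_node_poly e expr1 rootM.
    by rewrite /root hornerD hornerX hornerC addNr eqxx.
  by move=> /(nthP 0)[j]; rewrite size_tuple => jN jE; exists j.
- by rewrite s_ge s_lt.
- by move=> i iN; rewrite -nodeE -alphaP mem_nth// size_tuple.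
move=> f sf; rewrite -rhoP.
  rewrite gegenbauer_coef_gmean geg0 mulr1 expr1n gmean1 divr1 //.
apply: (leq_trans sf); rewrite /lev_deg; move: k0; clear; lia.
Qed.

Lemma node_inD (R : realType) (d k : nat) (eps : bool) (s iL : R) (A rho : nat -> R) i :
  lev_data d k eps s iL A rho -> (i < k + eps)%N -> inD (A i).
Proof.
move=> ld iN; have [TD _] := admissible_double ld; apply: (allP TD).
by have := node_mem ld iN; rewrite !mem_cat => /orP[->|->]; rewrite ?orbT.
Qed.

Lemma am_dq_lim (R : realType) (h : R -> \bar R) : absolutely_monotone h ->
  forall j x, inD x -> dq_lim (deriven_within `[-1, 1[ j (fine \o h)) x
    (deriven_within `[-1, 1[ j.+1 (fine \o h) x).
Proof. by move=> h_am j x xD; apply: dq_limP; exact: am_smooth. Qed.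

Lemma sum_node_fine (R : realType) (d k : nat) (eps : bool) (s iL : R)
    (A rho : nat -> R) (h : R -> \bar R) :
  lev_data d k eps s iL A rho -> absolutely_monotone h ->
  (\sum_(i < k + eps) (rho i)%:E * h (A i) =
    (\sum_(i < k + eps) rho i * (fine \o h) (A i))%:E)%E.
Proof.
move=> ld h_am; rewrite -sumEFin; apply: eq_bigr => i _.
by rewrite EFinM /= fineK//; apply: (am_fin h_am); exact: (node_inD ld).
Qed.

Theorem theorem3p11 (R : realType) (n M : nat) (s r : R) (h : R -> \bar R)
  (k : nat) (eps : bool) (alpha rho alpha' rho' : (k + eps).-tuple R)
  (gT : {poly R}) (C : {fset 'rV[R]_n})
  (n_ge2 : (2 <= n)%N) (M_ge2 : (2 <= M)%N)
  (s_bnd : -1 <= s < 1)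
  (h_am : absolutely_monotone h)
  (k_ge1 : (1 <= k)%N)
  (s_in : lev_interval n k eps s)
  (r_in : lev_interval n k eps r)
  (M_def : M%:R = lev_L n k eps r)
  (alpha_nodes : is_lev_nodes n s alpha)
  (rho_weights : is_lev_weights n s alpha rho)
  (alpha'_nodes : is_lev_nodes n r alpha')
  (rho'_weights : is_lev_weights n r alpha' rho')
  (gT_hermite : is_hermite_interpolant `[-1, 1[ (lev_T alpha) (fine \o h) gT)
  (C_code : code_class M s C) :
  ((M%:R ^+ 2)%:E * (\sum_(i < k + eps) (rho'`_i)%:E * h alpha'`_i)
     <= energy h C)%E /\
  (energy h C <=
     (M%:R * (M%:R / lev_L n k eps s - 1) * (lev_fh n (lev_T alpha) gT).[1])%:E
     + (M%:R ^+ 2)%:E * (\sum_(i < k + eps) (rho`_i)%:E * h alpha`_i))%E.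
Proof.
case: n C n_ge2 s_in r_in M_def alpha_nodes rho_weights alpha'_nodes rho'_weights C_code
  => [|[|d]]// C _ sI rI LM aN rW a'N r'W [C1 CM Cs].
have ld := lev_dataI k_ge1 sI aN rW; have ld' := lev_dataI k_ge1 rI a'N r'W.
pose F j := deriven_within `[-1, 1[ j (fine \o h).
have FD : forall j x, inD x -> dq_lim (F j) x (F j.+1 x) by exact: am_dq_lim.
have F0 j x : inD x -> 0 <= F j x by exact: am_ge0.
rewrite (energyE C1 (am_fin h_am)).
rewrite (sum_node_fine ld' h_am) (sum_node_fine ld h_am) -!EFinM -EFinD !lee_fin.
have [sg Hg] := gT_hermite; split.
- have iLE : (lev_L d.+2 k eps r)^-1 = M%:R^-1 by rewrite LM.
  by apply: (pair_sum_lower_bound ld' FD F0 C1 CM _ iLE); exact: ltnW.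
- exact: (pair_sum_upper_bound ld FD F0 C1 CM Cs Hg sg).
Qed.
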